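(* Let $f(x)=\mathbb{E}_{Z\sim\pi}[F(x,Z)]$ on $\mathbb{R}^d$ satisfy: (i) for every $Z\in\mathsf{Z}$, $F(\cdot,Z)$ is differentiable and $\|\nabla F(x,Z)-\nabla F(y,Z)\|\le L\|x-y\|$ for all $x,y\in\mathbb{R}^d$, with $L>0$ (gradients in the first argument); (ii) $f$ is continuously differentiable and $\mu$-strongly convex, $\mu>0$, i.e. $\frac{\mu}{2}\|x-y\|^2\le f(x)-f(y)-\langle\nabla f(y),x-y\rangle$ for all $x,y$; (iii) the noise $\{Z_i\}$ is a stationary Markov chain with unique invariant distribution $\pi$, uniformly geometrically ergodic with mixing time $\tau$; (iv) for all $x\in\mathbb{R}^d$, $\mathbb{E}_\pi[\nabla F(x,Z)]=\nabla f(x)$, and for all $x\in\mathbb{R}^d$ and all $Z\in\mathsf{Z}$, $\|\nabla F(x,Z)-\nabla f(x)\|^2\le\sigma_2^2$. Let $x^*$ be the minimizer of $f$, and consider the Randomized Accelerated ZO GD algorithm (described in the context) with two-point feedback. Then for any target accuracy $\varepsilon>0$ and any batch size multiplier $B$, and for a suitable choice of $\gamma,t,p$, the number of two-point oracle calls required to ensure $\mathbb{E}\|x^N-x^*\|^2\le\varepsilon$ is bounded by $$B\cdot\tilde{\mathcal{O}}\left(\max\Bigl[1,\frac dB\Bigr]\sqrt{\frac L\mu}\,\log\frac1\varepsilon+\frac{(d+\tau)\,\sigma_2^2}{B\mu^2\varepsilon}\right).$$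
   Context: Norms and inner products are Euclidean. $(\mathsf{Z},\mathcal{Z})$ is a complete separable metric space with its Borel $\sigma$-algebra, $\mathrm{Q}$ a Markov kernel on it. A chain with kernel $\mathrm{Q}$ is uniformly geometrically ergodic with mixing time $\tau\in\mathbb{N}$, $\tau\ge1$, if for every $k\in\mathbb{N}$, $\sup_{z,z'\in\mathsf{Z}}\frac12\|\mathrm{Q}^k(z,\cdot)-\mathrm{Q}^k(z',\cdot)\|_{\mathsf{TV}}\le(1/4)^{\lfloor k/\tau\rfloor}$. Oracle (two-point feedback): each call at a pair of points $x,y$ returns $F(x,Z)$ and $F(y,Z)$ with the same $Z$, the next state of the chain. Gradient estimators. For a direction $e$, $\hat g(x,Z,e)=d\,\frac{F(x+te,Z)-F(x-te,Z)}{2t}\,e$. $\hat g_{rd}[n](x)=\frac1n\sum_{i=1}^n\hat g(x,Z_i,e_i)$ with $Z_i$ successive states of the chain and $e_i$ i.i.d. uniform on the unit Euclidean sphere, independent of the chain. Let $J$ be geometric, $\mathbb{P}(J=j)=2^{-j}$, $j\ge1$, independent of everything else. Then $\hat g_{ml}(x)=\hat g_{rd}[l](x)+2^J\bigl(\hat g_{rd}[2^Jl](x)-\hat g_{rd}[2^{J-1}l](x)\bigr)$ if $2^J\le M$ and $\hat g_{ml}(x)=\hat g_{rd}[l](x)$ otherwise; within one evaluation of $\hat g_{ml}$, $\hat g_{rd}[n]$ uses the first $n$ of the drawn samples. Successive evaluations continue along the same chain with fresh $J$ and $e_i$. Randomized Accelerated ZO GD. Parameters: stepsize $\gamma\in(0,\frac{3}{4L}]$,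 approximation step $t>0$, batch size multiplier $B$ (positive integer), number of iterations $N$, $p\in(0,1]$; $\beta=\sqrt{4p^2\mu\gamma/3}$, $\eta=\sqrt{3/(\mu\gamma)}$, $\theta=\frac{p\eta^{-1}-1}{\beta p\eta^{-1}-1}$, $M=\frac1p+\frac2\beta$, $l=(\lfloor\log_2M\rfloor+1)B$. Start with $x_f^0=x^0$. For $k=0,\dots,N-1$: $x_g^k=\theta x_f^k+(1-\theta)x^k$; $\hat g^k=\hat g_{ml}(x_g^k)$; $x_f^{k+1}=x_g^k-p\gamma\hat g^k$; $x^{k+1}=\eta x_f^{k+1}+(p-\eta)x_f^k+(1-p)(1-\beta)x^k+(1-p)\beta x_g^k$. The number of oracle calls is understood in expectation. $T=\tilde{\mathcal{O}}(S)$ means $T\le\mathrm{poly}(\log S)\cdot S$ as $\varepsilon\to0$, with a universal polynomial. *)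

(* Defs.v *)
From HB Require Import structures.
From mathcomp Require Import all_boot all_order all_algebra.
From mathcomp Require Import all_classical all_reals all_analysis.

Set Implicit Arguments.
Unset Strict Implicit.
Unset Printing Implicit Defensive.

Import Order.TTheory GRing.Theory Num.Theory.
Import numFieldNormedType.Exports.

Local Open Scope classical_set_scope.
Local Open Scope ring_scope.

#[short(type="completeMetricType")]
HB.structure Definition CompleteMetric (K : numDomainType) :=
  { T of Metric K T & Complete T }.

Definition separable (T : topologicalType) : Prop :=
  exists2 D : set T, countable D & dense D.

Notation borel T := (g_sigma_algebraType (@open T)).

Section euclidean.
Context {R : realType} {d : nat}.
Implicit Types (x y : 'rV[R]_d) (f : 'rV[R]_d -> R).

(* The library's norm `|x| on 'rV[R]_d is the sup norm. It induces the same
   topology and the same differentials as enorm. *)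
Definition dotp x y : R := \sum_i x ord0 i * y ord0 i.
Definition enorm x : R := Num.sqrt (dotp x x).

(* The row vector representing the differential; meaningful only where f is
   differentiable. *)
Definition grad f x : 'rV[R]_d := \row_i 'd f x (delta_mx 0 i).

(* The uniform law on the sphere is the unique probability measure carried by
   it that is invariant under all orthogonal maps. *)
Definition uniform_on_sphere (nu : probability (borel 'rV[R]_d) R) : Prop :=
  nu [set v | enorm v = 1] = 1%E /\
  forall (U : 'M[R]_d) (A : set (borel 'rV[R]_d)),
    U *m U^T = 1%:M -> measurable A ->
    nu [set v | A ((v : 'rV[R]_d) *m U)] = nu A.

End euclidean.

Section markov_kernels.
Local Open Scope ereal_scope.
Context {d : measure_display} {T : measurableType d} {R : realType}.

(* |nu|(T); the value does not depend on the chosen Hahn decomposition. *)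
Definition tv_norm (nu : {charge set T -> \bar R}) : \bar R :=
  charge_variation (svalP (cid (svalP (cid (Hahn_decomposition nu))))) setT.

Fixpoint kpow (Q : R.-pker T ~> T) (k : nat) : R.-spker T ~> T :=
  if k is k'.+1 then mkcomp_noparam Q (kpow Q k')
  else kdirac (@measurable_id _ T setT).

(* Wrapper giving Q^k(z, .) its finite measure structure, so that the
   difference of two such measures is a charge. *)
Definition kpow_at (Q : R.-pker T ~> T) (k : nat) (z : T) : set T -> \bar R :=
  kpow Q k z.
HB.instance Definition _ Q k z := Measure.on (kpow_at Q k z).
HB.instance Definition _ Q k z := Measure_isFinite.Build _ _ _ (kpow_at Q k z)
  (finite_kernel_measure (kpow Q k) z).

Definition uniformly_geometrically_ergodic (Q : R.-pker T ~> T) (tau : nat) :=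
  forall k : nat,
    ereal_sup [set (2^-1)%:E *
        tv_norm (cadd (charge_of_finite_measure (kpow_at Q k zz.1))
                      (copp (charge_of_finite_measure (kpow_at Q k zz.2))))
      | zz in [set: T * T]] <= ((4^-1) ^+ (k %/ tau))%:E.

Definition invariant_measure (Q : R.-pker T ~> T) (pi : probability T R) : Prop :=
  forall A, measurable A -> \int[pi]_z Q z A = pi A.

End markov_kernels.

Section random_variables.
Local Open Scope ereal_scope.
Context {d : measure_display} {Om : measurableType d} {R : realType}.
Variable P : probability Om R.

Definition mutually_independent {I : choiceType} (G : I -> set_system Om) :=
  forall (s : seq I) (E : I -> set Om), uniq s ->
    (forall i, i \in s -> G i (E i)) ->
    P (\big[setI/setT]_(i <- s) E i) = \prod_(i <- s) P (E i).

Context {d' : measure_display} {T : measurableType d'}.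

Definition sigma_of (X : {RV P >-> T}) : set_system Om :=
  preimage_set_system setT X measurable.

Definition sigma_of_family (D : set nat) (X : nat -> {RV P >-> T}) :=
  <<s \bigcup_(i in D) sigma_of (X i) >>.

(* The second clause is P(X_{n+1} \in A | X_0, ..., X_n) = Q(X_n, A) a.s. *)
Definition stationary_markov_chain (Q : R.-pker T ~> T) (pi : probability T R)
    (X : nat -> {RV P >-> T}) : Prop :=
  [/\ invariant_measure Q pi,
      (forall A, measurable A -> P (X 0%N @^-1` A) = pi A) &
      forall n E A, sigma_of_family `I_n.+1 X E -> measurable A ->
        P (E `&` X n.+1 @^-1` A) = \int[P]_(w in E) Q (X n w) A].

(* These masses sum to 1, so J = 0 has probability 0. *)
Definition geometric_half (J : {RV P >-> nat}) : Prop :=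
  forall j, (0 < j)%N -> P (J @^-1` [set j]) = (2^-1 ^+ j)%:E.

(* The index None stands for the whole chain, Some (inl i) for e_i and
   Some (inr k) for J_k. *)
Definition sampling_model {n : nat} (Q : R.-pker T ~> T)
    (pi : probability T R) (X : nat -> {RV P >-> T})
    (e : nat -> {RV P >-> borel 'rV[R]_n}) (J : nat -> {RV P >-> nat}) : Prop :=
  [/\ stationary_markov_chain Q pi X,
      (forall i, uniform_on_sphere (distribution P (e i))),
      (forall k, geometric_half (J k)) &
      mutually_independent (fun a : option (nat + nat) =>
        match a with
        | None => sigma_of_family setT X
        | Some (inl i) => preimage_set_system setT (e i) measurable
        | Some (inr k) => preimage_set_system setT (J k) measurable
        end)].

End random_variables.

(* The algorithm along one realization: oracle call number m (counted over the
   whole run) uses the m-th chain state z m and the m-th direction e m, and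
   iteration k uses the level j k. *)
Section algorithm.
Context {R : realType} {d : nat} {Z : Type}.
Variable F : 'rV[R]_d -> Z -> R.
Variables (mu : R) (B : nat) (gamma t p : R).
Variables (z : nat -> Z) (e : nat -> 'rV[R]_d) (j : nat -> nat).

Definition beta : R := Num.sqrt (4 * p ^+ 2 * mu * gamma / 3).
Definition eta : R := Num.sqrt (3 / (mu * gamma)).
Definition theta : R := (p * eta^-1 - 1) / (beta * p * eta^-1 - 1).
Definition Mlev : R := 1 / p + 2 / beta.

(* Num.truncn is the floor here: log_2 M is nonnegative since M >= 1. *)
Definition batch : nat := ((Num.truncn (ln Mlev / ln 2)).+1 * B)%N.

Definition g_hat (x : 'rV[R]_d) (m : nat) : 'rV[R]_d :=
  (d%:R * ((F (x + t *: e m) (z m) - F (x - t *: e m) (z m)) / (2 * t))) *: e m.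

(* s is the number of calls made before the current evaluation. *)
Definition g_rd (n s : nat) (x : 'rV[R]_d) : 'rV[R]_d :=
  n%:R^-1 *: \sum_(i < n) g_hat x (s + i).

Definition g_ml (J s : nat) (x : 'rV[R]_d) : 'rV[R]_d :=
  g_rd batch s x +
  if 2 ^+ J <= Mlev then
    2 ^+ J *: (g_rd (2 ^ J * batch) s x - g_rd (2 ^ J.-1 * batch) s x)
  else 0.

Definition g_ml_calls (J : nat) : nat :=
  if 2 ^+ J <= Mlev then (2 ^ J * batch)%N else batch.

Record state := State { st_xf : 'rV[R]_d; st_x : 'rV[R]_d; st_calls : nat }.

Definition step (k : nat) (s : state) : state :=
  let xg := theta *: st_xf s + (1 - theta) *: st_x s in
  let xf' := xg - (p * gamma) *: g_ml (j k) (st_calls s) xg in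
  State xf'
    (eta *: xf' + (p - eta) *: st_xf s
       + ((1 - p) * (1 - beta)) *: st_x s + ((1 - p) * beta) *: xg)
    (st_calls s + g_ml_calls (j k)).

Fixpoint run (x0 : 'rV[R]_d) (N : nat) : state :=
  if N is k.+1 then step k (run x0 k) else State x0 x0 0.

End algorithm.

Definition complexity {R : realType} (d B tau : nat) (L mu sigma eps : R) : R :=
  Num.max 1 (d%:R / B%:R) * Num.sqrt (L / mu) * ln (1 / eps)
  + (d + tau)%:R * sigma ^+ 2 / (B%:R * mu ^+ 2 * eps).

(* Main.v *)
Require Import Defs.
From HB Require Import structures.
From mathcomp Require Import all_boot all_order all_algebra.
From mathcomp Require Import all_classical all_reals all_analysis.
From mathcomp Require Import measurable_realfun ring lra.

Set Implicit Arguments.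
Unset Strict Implicit.
Unset Printing Implicit Defensive.

Import Order.TTheory GRing.Theory Num.Theory.
Import numFieldNormedType.Exports.

Local Open Scope classical_set_scope.
Local Open Scope ring_scope.

(** The proof follows a potential argument. For the pair of iterates (xf, x) let
    V be |x - xstar|^2 + (6 / mu) (f xf - f xstar). With exact gradients an
    iteration of the accelerated scheme multiplies V by 1 - a p, up to terms of
    order p^2, where a is the square root of mu gamma / 3. If a vector S replaces
    the gradient G at the query point, the step adds a term linear in S - G, whose
    slope has norm O(p sqrt V), and a term O(p^2 |S - G|^2) (lyapunov_descent,
    slope_le). An iteration thus contracts V by 1 - a p / 2, up to O(p^2), as soon
    as the estimator has, conditionally on the past, a bias O(p) and a second
    moment O(1 + V).

    Both hold for the multilevel estimator. It is a weighted sum of two-point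
    estimates with weights of sum 1. Averaged over the level its mean telescopes
    to that of the plain average over the longest batch, whose length is at least
    1 / (2 p); geometric ergodicity makes the sum of the conditional means of the
    samples bounded by a multiple of tau, hence the bias is O(tau p). For the
    second moment the m.+1 levels contribute O(1 / l) each, and l is at least m.+1
    (batch_bound). Two further facts about a single estimate enter: it is isotropic
    in the direction, so that it reproduces the gradient up to O(t), and its noise
    is bounded by d sigma, uniformly in t, with mean 0 under pi
    (mean_field_decay).

    The probabilistic part is to condition on the past although the number of
    samples consumed so far is random. The run is analysed on the events where the
    levels have given values: there it is a fixed number of updates, each of them
    reading the next state and the next direction, and the conditional expectations
    are iterated integrals against the kernel and the law of the direction (tower,
    random_run_event_bound). Outside a null set the directions have norm 1;
    setting the others to 0 makes every estimate bounded (clip).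

    Summing the errors of the iterations gives an error O(p) in the presence of
    noise. With p proportional to eps, t tiny and N of order ln(1/eps) / p the
    expected number of calls is at most N m.+1^2 B, that is O(ln(1/eps)^3 / eps);
    without noise p is a constant and the number of calls is O(ln(1/eps)). The
    complexity S of the theorem dominates 1 / eps, respectively ln(1/eps). As S
    tends to infinity when eps tends to 0, one factor ln S absorbs every constant
    that depends on the problem, and the fourth power of ln S suffices. *)

(** * Independence of the past and of the future randomness *)

Section kernels.
Local Open Scope ereal_scope.
Context {R : realType}.

Section kcst.
Context d d' (X : measurableType d) (Y : measurableType d').
Variable m : {finite_measure set Y -> \bar R}.
(** A finite measure as a constant kernel, and below a kernel precomposed with a
    measurable map: composition of kernels then expresses the joint laws used
    for the chain. *)
Definition kcst (_ : X) : {measure set Y -> \bar R} := m.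
Let mkcst U : measurable U -> measurable_fun [set: X] (kcst ^~ U).
Proof. by move=> mU; exact: measurable_cst. Qed.
HB.instance Definition _ := isKernel.Build _ _ _ _ _ kcst mkcst.
Let kcst_uub : measure_fam_uub kcst.
Proof.
exists (fine (m setT) + 1)%R => x; rewrite /kcst EFinD fineK ?fin_num_measure//.
by rewrite lteDl ?lte01// fin_num_measure.
Qed.
HB.instance Definition _ := Kernel_isFinite.Build _ _ _ _ _ kcst kcst_uub.
End kcst.

Section kpre.
Context d d' d'' (W : measurableType d) (X : measurableType d')
  (Y : measurableType d'').
Variables (k : R.-fker X ~> Y) (f : W -> X).
Hypothesis mf : measurable_fun setT f.
Definition kpre of measurable_fun setT f := fun w => k (f w) : {measure set Y -> \bar R}.
Let mkpre U : measurable U -> measurable_fun [set: W] (kpre mf ^~ U).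
Proof.
move=> mU; rewrite /kpre.
exact: (measurableT_comp (measurable_kernel k U mU) mf).
Qed.
HB.instance Definition _ := isKernel.Build _ _ _ _ _ (kpre mf) mkpre.
Let kpre_uub : measure_fam_uub (kpre mf).
Proof. by have [r kr] := measure_uub k; exists r => w; exact: kr. Qed.
HB.instance Definition _ := Kernel_isFinite.Build _ _ _ _ _ (kpre mf) kpre_uub.
End kpre.

Lemma ge0_integral_mrestr d (T : measurableType d) (m : {measure set T -> \bar R})
    (D : set T) (mD : measurable D) (f : T -> \bar R) :
  measurable_fun setT f -> (forall x, 0 <= f x) ->
  \int[mrestr m mD]_x f x = \int[m]_(x in D) f x.
Proof.
move=> mf f0; rewrite -(setUv D) ge0_integral_setU//=.
- rewrite [X in _ + X](_ : _ = 0) ?adde0.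
    by apply: eq_measure_integral => A mA AD; rewrite -[LHS]/(m (A `&` D)) setIidl.
  rewrite -(integral_measure_zero (~` D) f).
  apply: eq_measure_integral => A mA AD.
  by rewrite -[LHS]/(m (A `&` D)) (_ : A `&` D = set0) ?measure0//; apply/disjoints_subset.
- exact: measurableC.
- exact: measurable_funTS.
- exact/disj_setPCl.
Qed.

End kernels.

Section past.
Local Open Scope ereal_scope.
Context {R : realType} {dO : measure_display} {Om : measurableType dO}
  {P : probability Om R}.
Context {dZ : measure_display} {Z : measurableType dZ}.
Variables (Q : R.-pker Z ~> Z) (pi : probability Z R) (X : nat -> {RV P >-> Z}).
Context {dE : measure_display} {E : measurableType dE}.
Variables (e : nat -> {RV P >-> E}) (J : nat -> {RV P >-> nat}).

Definition source (a : option (nat + nat)) : set_system Om :=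
  match a with
  | None => sigma_of_family setT X
  | Some (inl i) => preimage_set_system setT (e i) measurable
  | Some (inr k) => preimage_set_system setT (J k) measurable
  end.

(** Events of X_0 .. X_{s-1} and e_0 .. e_{s'-1}, as a pi-system of rectangles.
    The two indices differ for an instant within each draw, when the state X_s
    is known and the direction e_s is not. *)
Definition past_gen (s s' : nat) : set_system Om :=
  [set C | exists CX B, [/\ sigma_of_family `I_s X CX,
     forall i, measurable (B i) &
     C = CX `&` \big[setI/setT]_(i <- iota 0 s') (e i @^-1` B i)]].

Definition past s s' : set_system Om := <<s past_gen s s' >>.

Hypothesis indep : mutually_independent P source.

Lemma sub_sigma_of_family (D D' : set nat) : D `<=` D' ->
  sigma_of_family D X `<=` sigma_of_family D' X.
Proof.
move=> DD'; apply: smallest_sub; first exact: smallest_sigma_algebra.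
apply: bigcup_sub => i Di A XA; apply: sub_sigma_algebra.
by exists i => //; exact: DD'.
Qed.

Lemma sigma_of_family_measurable D : sigma_of_family D X `<=` measurable.
Proof.
apply: smallest_sub; first exact: sigma_algebra_measurable.
apply: bigcup_sub => i Di _ [A mA <-].
exact: measurable_funP.
Qed.

Lemma source_measurable a : source a `<=` measurable.
Proof.
case: a => [[i|k]|] /=; last exact: sigma_of_family_measurable.
- by move=> _ [A mA <-]; exact: measurable_funP.
- by move=> _ [A mA <-]; exact: measurable_funP.
Qed.

Lemma source_bigI_measurable r (D : option (nat + nat) -> set Om) :
  (forall a, a \in r -> source a (D a)) -> measurable (\big[setI/setT]_(a <- r) D a).
Proof.
move=> rD; rewrite big_seq; apply: (big_ind measurable) => // [? ?|a ar].
  exact: measurableI.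
exact: source_measurable (rD a ar).
Qed.

Lemma past_measurable s s' : past s s' `<=` measurable.
Proof.
apply: smallest_sub; first exact: sigma_algebra_measurable.
move=> _ [CX [B [CXX mB ->]]]; apply: measurableI.
  exact: sigma_of_family_measurable CXX.
apply: bigsetI_measurable => i _; rewrite -[X in measurable X]setTI; exact: measurable_funP.
Qed.

Lemma past_gen_setI s s' : setI_closed (past_gen s s').
Proof.
move=> _ _ [C1 [B1 [C1X mB1 ->]]] [C2 [B2 [C2X mB2 ->]]].
exists (C1 `&` C2), (fun i => B1 i `&` B2 i); split.
- exact: (@measurableI _
    (g_sigma_algebraType (\bigcup_(i in `I_s) sigma_of (X i)))).
- by move=> i; exact: measurableI.
- by rewrite big_split/= setIACA.
Qed.

Lemma past_genT s s' : past_gen s s' setT.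
Proof.
exists setT, (fun=> setT); split => //.
  exact: (@measurableT _
    (g_sigma_algebraType (\bigcup_(i in `I_s) sigma_of (X i)))).
by rewrite big1 ?setIT// => i _; rewrite preimage_setT.
Qed.

(** The sources that have not been consulted by the time s'. The chain itself is
    left out: its future does depend on the past, through the kernel only. *)
Definition future (s' : nat) (a : option (nat + nat)) :=
  match a with
  | None => false | Some (inl i) => (s' <= i)%N | Some (inr _) => true
  end.

(** The product rule holds on the rectangles, which are finite intersections of
    events of distinct sources, and two finite measures that agree on a
    pi-system agree on the sigma-algebra it generates. *)
Lemma past_indep s s' r (D : option (nat + nat) -> set Om) C :
    uniq r -> all (future s') r -> (forall a, a \in r -> source a (D a)) ->
    past s s' C ->
  P (C `&` \big[setI/setT]_(a <- r) D a) = P C * P (\big[setI/setT]_(a <- r) D a).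
Proof.
move=> ur fr rD pC.
set DD := \big[setI/setT]_(a <- r) D a.
have mDD : measurable DD by exact: source_bigI_measurable rD.
have Pf : P DD \is a fin_num by rewrite fin_num_measure.
pose k : {nonneg R} := NngNum (fine_ge0 (measure_ge0 P DD)).
rewrite muleC -(fineK Pf).
apply: (@g_sigma_algebra_measure_unique _ _ _ (past_gen s s') _ (fun=> setT) _ _
  (mrestr P mDD) (mscale k P)) pC.
- by move=> A sA; apply: (@past_measurable s s'); exact: sub_sigma_algebra.
- by move=> _; exact: past_genT.
- by rewrite bigcup_const.
- exact: past_gen_setI.
- move=> _ [CX [B [CXX mB ->]]].
  pose E1 (a : option (nat + nat)) : set Om := match a with None => CX | Some (inl i) => e i @^-1` B i
    | _ => setT end.
  pose t : seq (option (nat + nat)) := None :: [seq Some (inl i) | i <- iota 0 s'].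
  have tE : \big[setI/setT]_(a <- t) E1 a =
      CX `&` \big[setI/setT]_(i <- iota 0 s') (e i @^-1` B i).
    by rewrite big_cons big_map.
  have ut : uniq t.
    rewrite /t/= map_inj_uniq ?iota_uniq; last by move=> i j [].
    by rewrite andbT; apply/mapP => -[].
  have tE1 a : a \in t -> source a (E1 a).
    rewrite inE => /orP[/eqP ->|/mapP[i _ ->]] /=.
      exact: (sub_sigma_of_family _ CXX).
    by exists (B i) => //; rewrite setTI.
  have tr a : a \in t -> a \notin r.
    move=> at_; apply/negP => ar; move: (allP fr a ar) at_.
    case: a {ar} => [[i|k']|]//=; rewrite inE/=; last by move=> _ /mapP[].
    by move=> si /mapP[j]; rewrite mem_iota/= add0n => js' [ij]; rewrite ij leqNgt js' in si.
  rewrite -[RHS]/((fine (P DD))%:E * _) fineK// -[LHS]/(P (_ `&` DD)) -tE.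
  pose E2 a := if a \in r then D a else E1 a.
  have tE2 : \big[setI/setT]_(a <- t) E1 a = \big[setI/setT]_(a <- t) E2 a.
    by apply: eq_big_seq => a at_; rewrite /E2 (negbTE (tr a at_)).
  have rE2 : DD = \big[setI/setT]_(a <- r) E2 a.
    by apply: eq_big_seq => a ar; rewrite /E2 ar.
  have rE3 a : a \in r -> source a (E2 a) by move=> ar; rewrite /E2 ar; exact: rD.
  have tE3 a : a \in t -> source a (E2 a).
    by move=> at_; rewrite /E2 (negbTE (tr a at_)); exact: tE1.
  have trE3 a : a \in t ++ r -> source a (E2 a).
    by rewrite mem_cat => /orP[/tE3|/rE3].
  have utr : uniq (t ++ r).
    rewrite cat_uniq ut ur andbT; apply/hasPn => a ar; apply/negP => at_.
    by have := tr a at_; rewrite ar.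
  rewrite tE2 rE2 -big_cat (indep utr trE3).
  rewrite big_cat muleC; congr (_ * _); apply/esym.
    exact: (indep ut tE3).
  exact: (indep ur rE3).
- move=> _; rewrite -[X in X < _]/(P (setT `&` DD)) setTI; apply: (le_lt_trans (probability_le1 P mDD)).
  by rewrite ltry.
Qed.

Definition past_meas d (T : measurableType d) s s' (Y : Om -> T) :=
  forall A, measurable A -> past s s' (Y @^-1` A).

Lemma past_measP d (T : measurableType d) s s' (Y : Om -> T) :
  past_meas s s' Y <->
  measurable_fun (setT : set (g_sigma_algebraType (past_gen s s'))) Y.
Proof.
split=> [mY _ A mA|mY A mA]; first by rewrite setTI; exact: mY.
by have := mY measurableT A mA; rewrite setTI.
Qed.

Lemma past_measW d (T : measurableType d) s s' (Y : Om -> T) :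
  past_meas s s' Y -> measurable_fun setT Y.
Proof.
by move=> mY _ A mA; rewrite setTI; apply: (@past_measurable s s'); exact: mY.
Qed.

Lemma past_meas_le d (T : measurableType d) s s' u u' (Y : Om -> T) :
  (s <= u)%N -> (s' <= u')%N -> past_meas s s' Y -> past_meas u u' Y.
Proof.
move=> su su' mY A mA; move: (mY A mA); apply: smallest_sub.
  exact: smallest_sigma_algebra.
move=> _ [CX [B [CXX mB ->]]]; apply: sub_sigma_algebra.
exists CX, (fun i => if (i < s')%N then B i else setT); split.
- by move: CXX; apply: sub_sigma_of_family => i /= /leq_trans; exact.
- by move=> i; case: ifP.
- congr (_ `&` _); rewrite -(subnKC su') iotaD add0n big_cat/=.
  rewrite [X in _ `&` X]big1_seq ?setIT.
    by apply: eq_big_seq => i; rewrite mem_iota/= add0n => ->.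
  move=> i; rewrite mem_iota => /andP[_ /andP[si _]].
  by rewrite ltnNge si preimage_setT.
Qed.

Lemma past_measX s s' i : (i < s)%N -> past_meas s s' (X i).
Proof.
move=> si A mA; apply: sub_sigma_algebra.
exists (X i @^-1` A), (fun=> setT); split => //.
  apply: sub_sigma_algebra; exists i => //=.
  by exists A => //; rewrite setTI.
by rewrite big1 ?setIT// => j _; rewrite preimage_setT.
Qed.

Lemma past_mease s s' i : (i < s')%N -> past_meas s s' (e i).
Proof.
move=> si A mA; apply: sub_sigma_algebra.
exists setT, (fun j => if j == i then A else setT); split => //.
- exact: (@measurableT _ (g_sigma_algebraType (\bigcup_(i in `I_s) sigma_of (X i)))).
- by move=> j; case: ifP.
- rewrite setTI (bigD1_seq i)/= ?mem_iota ?add0n ?iota_uniq// eqxx.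
  rewrite big1 ?setIT// => j /negPf ->; exact: preimage_setT.
Qed.

Lemma past_meas_comp d1 d2 (T1 : measurableType d1) (T2 : measurableType d2)
    s s' (Y : Om -> T1) (g : T1 -> T2) :
  measurable_fun setT g -> past_meas s s' Y -> past_meas s s' (g \o Y).
Proof.
move=> mg mY A mA; rewrite comp_preimage; apply: mY.
by rewrite -[X in measurable X]setTI; exact: mg.
Qed.

Lemma past_meas_pair d1 d2 (T1 : measurableType d1) (T2 : measurableType d2)
    s s' (Y1 : Om -> T1) (Y2 : Om -> T2) :
  past_meas s s' Y1 -> past_meas s s' Y2 ->
  past_meas s s' (fun w => (Y1 w, Y2 w)).
Proof.
move=> /past_measP m1 /past_measP m2; apply/past_measP.
exact: measurable_fun_pair.
Qed.

(** Both sides integrate f against a measure, P restricted to the event and a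
    multiple of P; these agree on the past. *)
Lemma past_indep_integral s s' r (D : option (nat + nat) -> set Om) (f : Om -> \bar R) :
    uniq r -> all (future s') r -> (forall a, a \in r -> source a (D a)) ->
    past_meas s s' f -> (forall w, 0 <= f w) ->
  \int[P]_(w in \big[setI/setT]_(a <- r) D a) f w =
  P (\big[setI/setT]_(a <- r) D a) * \int[P]_w f w.
Proof.
move=> ur fr rD pf f0.
set DD := \big[setI/setT]_(a <- r) D a.
have mDD : measurable DD by exact: source_bigI_measurable rD.
have mf := past_measW pf.
have Pf : P DD \is a fin_num by rewrite fin_num_measure.
pose k : {nonneg R} := NngNum (fine_ge0 (measure_ge0 P DD)).
have -> : \int[P]_(w in DD) f w = \int[mrestr P mDD]_w f w.
  by rewrite ge0_integral_mrestr.
have -> : P DD * \int[P]_w f w = \int[mscale k P]_w f w.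
  by rewrite ge0_integral_mscale// -[LHS]/(P DD * _) -[RHS]/((fine (P DD))%:E * _) fineK.
have key (m : {measure set Om -> \bar R}) :
    \int[m]_w f w = \int[pushforward m f]_y (maxe y 0).
  rewrite [RHS](ge0_integral_pushforward mf)//=.
  - by apply: eq_integral => w _ /=; rewrite max_l.
  - exact: measurable_maxe.
  - by move=> y _; rewrite le_max lexx orbT.
rewrite !key; apply: eq_measure_integral => A mA _.
rewrite /pushforward -[LHS]/(P (_ `&` DD)) -[RHS]/((fine (P DD))%:E * _) fineK//.
by rewrite muleC; apply: (past_indep ur fr rD); exact: pf.
Qed.

End past.

(** * Markov property and iterated conditional expectations *)

Section chain.
Local Open Scope ereal_scope.
Context {R : realType} {dO : measure_display} {Om : measurableType dO}
  {P : probability Om R}.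
Context {dZ : measure_display} {Z : measurableType dZ}.
Variables (Q : R.-pker Z ~> Z) (pi : probability Z R) (X : nat -> {RV P >-> Z}).
Context {dE : measure_display} {E : measurableType dE}.
Variables (e : nat -> {RV P >-> E}) (J : nat -> {RV P >-> nat}).
Hypothesis indep : mutually_independent P (source X e J).
Local Notation past := (past X e).
Local Notation past_gen := (past_gen X e).
Local Notation past_meas := (past_meas X e).
Local Notation source := (source X e J).

(** Law of X_s conditionally on the past. Before the first draw there is no
    previous state and stationarity gives pi. *)
Definition next_law (s : nat) (w : Om) : {measure set Z -> \bar R} :=
  if s is s'.+1 then Q (X s' w) else pi.

Let mnext_law s U : measurable U -> measurable_fun [set: Om] (next_law s ^~ U).
Proof.
move=> mU; case: s => [|s]; first exact: measurable_cst.
exact: (measurableT_comp (measurable_kernel Q U mU)).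
Qed.

HB.instance Definition _ s :=
  isKernel.Build _ _ Om Z R (next_law s) (@mnext_law s).

Let next_law_prob s w : next_law s w setT = 1.
Proof.
case: s => [|s]; first exact: (probability_setT pi).
by rewrite /next_law prob_kernel.
Qed.

HB.instance Definition _ s := Kernel_isProbability.Build _ _ _ _ _
  (next_law s) (@next_law_prob s).

Hypothesis markov : stationary_markov_chain Q pi X.

Lemma past00 C : past 0 0 C -> C = set0 \/ C = setT.
Proof.
have sal : sigma_algebra setT [set A : set Om | A = set0 \/ A = setT].
  split; first by left.
    by move=> A [->|->] /=; [right; rewrite setD0|left; rewrite setDv].
  move=> F F01; have [[n Fn]|nF] := pselect (exists n, F n = setT).
    by right; apply/seteqP; split => // w _; exists n; rewrite ?Fn.
  left; rewrite -subset0 => w [n _ Fnw].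
  by case: (F01 n) Fnw => [->//|FnT] _; apply: nF; exists n.
have s0 : sigma_of_family `I_0 X `<=` [set A | A = set0 \/ A = setT].
  by apply: smallest_sub => // A [].
suff : past 0 0 `<=` [set A | A = set0 \/ A = setT] by exact.
apply: smallest_sub => // _ [CX [B [CXX mB ->]]].
by rewrite big_nil setIT; exact: s0.
Qed.

(** The chain is Markov for its own past; the directions seen so far are
    independent of the chain, so that conditioning on them as well changes
    nothing. Dynkin's lemma reduces the claim to rectangles. *)
Lemma past_markov s C A : past s s C -> measurable A ->
  P (C `&` X s @^-1` A) = \int[P]_(w in C) next_law s w A.
Proof.
move=> pC mA; have [piinv X0 XS] := markov.
case: s pC => [|s] pC.
  rewrite integral_cst ?probability_fin//; last exact: past_measurable pC.
  case: (past00 pC) => ->; first by rewrite set0I !measure0 mule0.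
  rewrite setTI (X0 _ mA) -[LHS]mule1; congr (_ * _); apply/esym.
  exact: (probability_setT P).
have mXA : measurable (X s.+1 @^-1` A).
  by rewrite -[X in measurable X]setTI; exact: measurable_funP.
have mQ : measurable_fun setT (fun w => Q (X s w) A).
  exact: (measurableT_comp (measurable_kernel Q A mA)).
pose Pr (C : set Om) :=  P (C `&` X s.+1 @^-1` A) = \int[P]_(w in C) Q (X s w) A.
have PsT : sigma_of_family `I_s.+1 X setT.
  exact: (@measurableT _ (g_sigma_algebraType (\bigcup_(i in `I_s.+1) sigma_of (X i)))).
have PrT : Pr setT by exact: (XS s setT A PsT mA).
apply: (@dynkin_induction _ (g_sigma_algebraType (past_gen s.+1 s.+1))
  (past_gen s.+1 s.+1) Pr) pC => //.
- exact: (@past_gen_setI _ _ _ _ _ _ X _ _ e).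
- move=> _ [CX [B [CXX mB ->]]]; rewrite /Pr.
  pose D (a : option (nat + nat)) : set Om := match a with
    | Some (inl i) => e i @^-1` B i | _ => setT end.
  pose t : seq (option (nat + nat)) := [seq Some (inl i) | i <- iota 0 s.+1].
  have tE : \big[setI/setT]_(a <- t) D a =
      \big[setI/setT]_(i <- iota 0 s.+1) (e i @^-1` B i).
    by rewrite big_map.
  have ut : uniq t by rewrite map_inj_uniq ?iota_uniq// => i j [].
  have ft : all (future 0) t by rewrite all_map; apply/allP.
  have tD a : a \in t -> source a (D a).
    by move=> /mapP[i _ ->]; exists (B i) => //; rewrite setTI.
  have mCX := sigma_of_family_measurable CXX.
  have mD := source_bigI_measurable tD.
  have sX B' (m : nat) : sigma_of_family `I_m X B' -> past m 0 B'.
    move=> B'X; apply: sub_sigma_algebra; exists B', (fun=> setT); split => //.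
    by rewrite big_nil setIT.
  have pXA : past s.+2 0 (CX `&` X s.+1 @^-1` A).
    apply: sX; apply: (@measurableI _ (g_sigma_algebraType _)).
      by move: CXX; apply: sub_sigma_of_family => i /= /leqW.
    by apply: sub_sigma_algebra; exists s.+1 => //=; exists A => //; rewrite setTI.
  rewrite -tE setIAC (past_indep indep ut ft tD pXA) (XS _ _ _ CXX mA).
  pose f := (fun w => Q (X s w) A) \_ CX.
  have pf : past_meas s.+1 0 f.
    rewrite /f epatch_indic; apply/past_measP; apply: emeasurable_funM.
      apply/past_measP; apply: (past_meas_comp (measurable_kernel Q A mA)).
      exact: past_measX.
    apply/measurable_EFinP.
    exact: (@measurable_indic _ (g_sigma_algebraType (past_gen s.+1 0)) _ _ _ (sX _ _ CXX)).
  have f0 w : 0 <= f w by rewrite /f patchE; case: ifP.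
  rewrite integral_mkcondl -/f.
  by rewrite (past_indep_integral indep ut ft tD pf f0) muleC -integral_mkcond.
- move=> S pS PrS; have mS := past_measurable pS.
  have PrT' := PrT; rewrite /Pr -(setUv S) setIUl measureU in PrT'; last 3 first.
  + exact: measurableI.
  + by apply: measurableI => //; exact: measurableC.
  + by rewrite setIACA setICr set0I.
  rewrite ge0_integral_setU//= in PrT'; last 3 first.
  + exact: measurableC.
  + exact: measurable_funTS.
  + exact/disj_setPCl.
  rewrite PrS in PrT'.
  have fS : \int[P]_(x in S) Q (X s x) A \is a fin_num.
    by rewrite -PrS fin_num_measure//; exact: measurableI.
  have := congr1 (fun x => x - \int[P]_(x in S) Q (X s x) A) PrT'.
  by rewrite [X in X - _]addeC addeK// [X in X - _]addeC addeK.
- move=> F mF tF PrF; rewrite /Pr setI_bigcupl.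
  have mF' n : dO.-measurable (F n) by exact: (past_measurable (mF n)).
  rewrite measure_bigcup//; last 2 first.
  + by move=> n _; exact: measurableI.
  + exact: trivIset_setIr.
  rewrite ge0_integral_bigcup//.
  + by rewrite (eq_eseriesl (Q := xpredT))//; [apply: eq_eseriesr => n _; exact: PrF|move=> n; rewrite in_setT].
  + exact: measurable_funTS.
Qed.

(** The Markov property passes from events to nonnegative functions since the two
    joint laws agree on rectangles. *)
Lemma past_next_state d (T : measurableType d) s (Y : Om -> T) (g : T * Z -> \bar R) :
  past_meas s s Y -> measurable_fun setT g -> (forall x, 0 <= g x) ->
  \int[P]_w g (Y w, X s w) = \int[P]_w \int[next_law s w]_z g (Y w, z).
Proof.
move=> pY mg g0; have mY := past_measW pY.
pose W := fun w => (Y w, X s w).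
have mXs : measurable_fun setT (X s) by exact: measurable_funP.
have mW : measurable_fun setT W by exact: measurable_fun_pair.
have mq : measurable_fun setT (fun u : (unit * Om) * Z => (Y u.1.2, u.2)).
  apply: measurable_fun_pair => //=.
  by apply: (measurableT_comp mY); exact: measurableT_comp.
pose l : R.-fker unit ~> Om := kcst P.
pose k1 : R.-fker (unit * Om)%type ~> Z :=
  kpre (next_law s) (measurable_snd : measurable_fun setT (snd : unit * Om -> Om)).
pose k2 := kdirac (R := R) mq.
pose k12 : R.-sfker (unit * Om)%type ~> (T * Z)%type := mkcomp k1 k2.
pose m2 := mkcomp l k12 tt.
have m2E (h : T * Z -> \bar R) : (forall x, 0 <= h x) -> measurable_fun setT h ->
    \int[m2]_x h x = \int[P]_w \int[next_law s w]_z h (Y w, z).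
  move=> h0 mh; rewrite (integral_kcomp l k12)//; apply: eq_integral => w _.
  rewrite (integral_kcomp k1 k2)//; apply: eq_integral => z _.
  by rewrite integral_dirac ?diracT ?mul1e.
have -> : \int[P]_w g (Y w, X s w) = \int[pushforward P W]_x g x.
  by rewrite ge0_integral_pushforward.
rewrite -m2E//; apply: eq_measure_integral => S mS _.
pose G := [set A `*` B | A in @measurable _ T & B in @measurable _ Z].
apply: (@measure_unique _ R _ G (fun=> setT)) => //.
- exact: measurable_prod_measurableType.
- move=> _ _ [A mA [B mB <-]] [A' mA' [B' mB' <-]].
  exists (A `&` A'); first exact: measurableI.
  by exists (B `&` B'); [exact: measurableI|rewrite setXI].
- by move=> _; exists setT => //; exists setT => //; rewrite setXTT.
- by rewrite bigcup_const.
- move=> _ [A mA [B mB <-]].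
  have mAB : measurable (A `*` B) by exact: measurableX.
  rewrite /pushforward -[LHS]/(P (Y @^-1` A `&` X s @^-1` B)) past_markov//; last exact: pY.
  have -> : m2 (A `*` B) = \int[m2]_x (\1_(A `*` B) x)%:E.
    by rewrite -[in LHS](setIT (A `*` B)); apply/esym/integral_indic.
  rewrite m2E//; last exact/measurable_EFinP/measurable_indic.
  rewrite integral_mkcond; apply: eq_integral => w _.
  rewrite patchE; case: ifPn => [/set_mem /= Aw|/negP Aw].
    have -> : next_law s w B = \int[next_law s w]_x (\1_B x)%:E.
      by rewrite integral_indic// setIT.
    apply: eq_integral => z _.
    by rewrite !indicE in_setX (mem_set Aw).
  rewrite integral0_eq// => z _; rewrite indicE in_setX/=.
  by case: (boolP (Y w \in A)) => //= YA; exfalso; apply: Aw; rewrite inE; exact/set_mem.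
- move=> _; rewrite -[X in X < _]/(P (W @^-1` setT)) preimage_setT; apply: (le_lt_trans (probability_le1 P measurableT)).
  by rewrite ltry.
Qed.

(** The direction e_s is independent of the pair formed by the past and X_s,
    which gives a product measure and Tonelli applies. *)
Lemma past_next_sample d (T : measurableType d) s (Y : Om -> T)
    (g : T * (Z * E) -> \bar R) :
  past_meas s s Y -> measurable_fun setT g -> (forall x, 0 <= g x) ->
  \int[P]_w g (Y w, (X s w, e s w)) =
  \int[P]_w \int[next_law s w]_z \int[distribution P (e s)]_v g (Y w, (z, v)).
Proof.
move=> pY mg g0; have mY := past_measW pY.
pose W := fun w => (Y w, X s w).
have pW : past_meas s.+1 s W.
  by apply: past_meas_pair; [exact: past_meas_le pY|exact: past_measX].
have mW := past_measW pW.
have mes : measurable_fun setT (e s) by exact: measurable_funP.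
have mWe : measurable_fun setT (fun w => (W w, e s w)) by exact: measurable_fun_pair.
pose g' (u : (T * Z) * E) := g (u.1.1, (u.1.2, u.2)).
have mg' : measurable_fun setT g'.
  apply: (measurableT_comp mg); apply: measurable_fun_pair => /=.
    exact: (measurableT_comp measurable_fst).
  apply: measurable_fun_pair => //=.
  exact: (measurableT_comp measurable_snd).
pose G x := \int[distribution P (e s)]_v g' (x, v).
have mG : measurable_fun setT G by exact: (measurable_fun_fubini_tonelli_F (m2 := distribution P (e s)) g' mg' (fun x => g0 _)).
have G0 x : 0 <= G x by apply: integral_ge0 => v _; exact: g0.
rewrite -(past_next_state pY mG G0).
have -> : \int[P]_w g (Y w, (X s w, e s w)) =
    \int[pushforward P (fun w => (W w, e s w))]_x g' x.
  by rewrite ge0_integral_pushforward// => y _; exact: g0.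
have -> : \int[P]_w G (Y w, X s w) = \int[distribution P (mfun_Sub (mem_set mW))]_x G x.
  by rewrite ge0_integral_distribution.
rewrite /G -(fubini_tonelli1 (m2 := distribution P (e s)))//; last first.
  by move=> x; exact: g0.
apply: eq_measure_integral => S mS _; apply/esym.
apply: product_measure_unique => // A B mA mB.
rewrite /pushforward -[LHS]/(P (W @^-1` A `&` e s @^-1` B)).
have := past_indep indep (s := s.+1) (s' := s) (r := [:: Some (inl s)]) (D := fun=> e s @^-1` B) (C := W @^-1` A).
rewrite big_seq1; apply => //=; first by rewrite leqnn.
  by move=> a; rewrite inE => /eqP ->; exists B => //; rewrite setTI.
exact: pW.
Qed.

Section tower.
Context {d : measure_display} {T : measurableType d}.
Implicit Types (us : seq (T * (Z * E) -> T)) (Phi : T -> \bar R).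

(** Iterated conditional expectation: [r] is the law of the next chain state,
    and the direction with index [s] has law [distribution P (e s)]. *)
Fixpoint iter_exp us (s : nat) Phi (y : T) (r : {measure set Z -> \bar R}) : \bar R :=
  if us is u :: us' then
    \int[r]_z \int[distribution P (e s)]_v iter_exp us' s.+1 Phi (u (y, (z, v))) (Q z)
  else Phi y.

Fixpoint trajectory us (s : nat) (Y : Om -> T) : Om -> T :=
  if us is u :: us' then trajectory us' s.+1 (fun w => u (Y w, (X s w, e s w)))
  else Y.

Definition all_measurable us :=
  forall u, List.In u us -> measurable_fun setT u.

Lemma iter_exp_ge0 us s Phi y r : (forall y, 0 <= Phi y) -> 0 <= iter_exp us s Phi y r.
Proof.
move=> Phi0; elim: us s y r => [|u us IH] s y r //=.
by apply: integral_ge0 => z _; apply: integral_ge0 => v _; exact: IH.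
Qed.

(** Each step of the induction adds the sampled state and direction to the
    parameters, hence the arbitrary parameter space W and kernel k. *)
Lemma measurable_iter_exp dW (W : measurableType dW) (k : R.-fker W ~> Z) us s
    (Y : W -> T) Phi :
    (forall y, 0 <= Phi y) -> measurable_fun setT Phi -> all_measurable us ->
    measurable_fun setT Y ->
  measurable_fun setT (fun w => iter_exp us s Phi (Y w) (k w)).
Proof.
move=> Phi0 mPhi; elim: us s dW W k Y => [|u us IH] s dW W k Y mus mY /=.
  exact: (measurableT_comp mPhi mY).
have mu : measurable_fun setT u by apply: mus; left.
have mus' : all_measurable us by move=> v vus; apply: mus; right.
have m12 : measurable_fun setT (fun x : (W * Z) * E => x.1.2).
  exact: (measurableT_comp measurable_snd measurable_fst).
pose G (x : (W * Z) * E) := iter_exp us s.+1 Phi (u (Y x.1.1, (x.1.2, x.2))) (Q x.1.2).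
have mG : measurable_fun setT G.
  apply: (IH s.+1 _ _ (kpre Q m12) (fun x => u (Y x.1.1, (x.1.2, x.2))) mus').
  apply: (measurableT_comp mu); apply: measurable_fun_pair.
    apply: (measurableT_comp mY).
    exact: (measurableT_comp measurable_fst measurable_fst).
  exact: measurable_fun_pair.
have G0 x : 0 <= G x by exact: iter_exp_ge0.
have mG1 := measurable_fun_fubini_tonelli_F (m2 := distribution P (e s)) G mG G0.
apply: (measurable_fun_integral_finite_kernel (fubini_F (distribution P (e s)) G) k) => //.
by move=> z; apply: integral_ge0 => v _; exact: G0.
Qed.

(** A batch is computed by successive updates, and each of them integrates out
    one state and one direction conditionally on the past. *)
Lemma tower us s (Y : Om -> T) Phi :
    (forall y, 0 <= Phi y) -> measurable_fun setT Phi -> all_measurable us ->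
    past_meas s s Y ->
  \int[P]_w Phi (trajectory us s Y w) = \int[P]_w iter_exp us s Phi (Y w) (next_law s w).
Proof.
move=> Phi0 mPhi; elim: us s Y => [|u us IH] s Y mus pY //=.
have mu : measurable_fun setT u by apply: mus; left.
have mus' : all_measurable us by move=> v vus; apply: mus; right.
rewrite IH//; last first.
  apply: (past_meas_comp mu); apply: past_meas_pair.
    exact: past_meas_le pY.
  by apply: past_meas_pair; [exact: past_measX|exact: past_mease].
pose g (x : T * (Z * E)) := iter_exp us s.+1 Phi (u x) (Q x.2.1).
have mg : measurable_fun setT g.
  have m21 : measurable_fun setT (fun x : T * (Z * E) => x.2.1).
    exact: (measurableT_comp measurable_fst measurable_snd).
  exact: (measurable_iter_exp (kpre Q m21)).
have g0 x : 0 <= g x by exact: iter_exp_ge0.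
exact: (past_next_sample pY mg g0).
Qed.

Lemma past_meas_trajectory us s (Y : Om -> T) :
  all_measurable us -> past_meas s s Y ->
  past_meas (s + size us) (s + size us) (trajectory us s Y).
Proof.
elim: us s Y => [|u us IH] s Y mus pY /=; first by rewrite addn0.
rewrite addnS -addSn; apply: IH; first by move=> v vus; apply: mus; right.
have mu : measurable_fun setT u by apply: mus; left.
apply: (past_meas_comp mu); apply: past_meas_pair.
  exact: past_meas_le pY.
by apply: past_meas_pair; [exact: past_measX|exact: past_mease].
Qed.

End tower.

End chain.

(** * Runs with random levels *)

Lemma integral_cst_prob {R : realType} d (T : measurableType d)
  (P : probability T R) (c : \bar R) : (\int[P]_w c = c)%E.
Proof.
rewrite integral_cst// -[RHS]mule1; congr (_ * _)%E; exact: probability_setT.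
Qed.

Section random_levels.
Local Open Scope ereal_scope.
Context {R : realType} {dO : measure_display} {Om : measurableType dO}
  {P : probability Om R}.
Context {dZ : measure_display} {Z : measurableType dZ}.
Variables (Q : R.-pker Z ~> Z) (pi : probability Z R) (X : nat -> {RV P >-> Z}).
Context {dE : measure_display} {E : measurableType dE}.
Variables (e : nat -> {RV P >-> E}) (J : nat -> {RV P >-> nat}).
Hypothesis indep : mutually_independent P (source X e J).
Hypothesis markov : stationary_markov_chain Q pi X.
Context {d : measure_display} {T : measurableType d}.
Variables (us : nat -> seq (T * (Z * E) -> T)) (fin : T -> T) (y0 : T).
Hypothesis mus : forall j, all_measurable (us j).
Hypothesis mfin : measurable_fun setT fin.
Variables (m : nat) (lev : nat -> nat).
Hypothesis lev_le : forall n, (lev n <= m)%N.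

(** The number of samples consumed before iteration k. It depends on the levels:
    the whole analysis is therefore carried out first for a fixed sequence js of
    levels, on the event where the random levels equal js. *)
Definition pos (js : nat -> nat) (k : nat) : nat := (\sum_(i < k) size (us (js i)))%N.

Fixpoint level_run (js : nat -> nat) (k : nat) : Om -> T :=
  if k is k'.+1
  then fin \o trajectory X e (us (js k')) (pos js k') (level_run js k')
  else cst y0.

Lemma eq_pos js js' k : (forall i, (i < k)%N -> js i = js' i) -> pos js k = pos js' k.
Proof. by move=> E'; apply: eq_bigr => i _; rewrite E'. Qed.

Lemma eq_level_run js js' k :
  (forall i, (i < k)%N -> js i = js' i) -> level_run js k = level_run js' k.
Proof.
elim: k => [//|k IH] E' /=; rewrite IH ?E'//; last first.
  by move=> i ik; apply: E'; exact: ltnW.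
by rewrite (@eq_pos js js')// => i ik; apply: E'; exact: ltnW.
Qed.

Lemma past_meas_level_run js k :
  past_meas X e (pos js k) (pos js k) (level_run js k).
Proof.
elim: k => [|k IH] /=.
  apply/past_measP; exact: measurable_cst.
apply: (past_meas_comp mfin); rewrite /pos big_ord_recr/=.
exact: past_meas_trajectory.
Qed.

Definition level_event (k : nat) (js : nat -> nat) : set Om :=
  [set w | forall i, (i < k)%N -> lev (J i w) = js i].

Definition upd (js : nat -> nat) k j := fun i => if i == k then j else js i.

Let sel js (a : option (nat + nat)) : set Om :=
  match a with Some (inr i) => J i @^-1` (lev @^-1` [set js i]) | _ => setT end.
Let idx k : seq (option (nat + nat)) := [seq Some (inr i) | i <- iota 0 k].

Let level_eventE k js : level_event k js = \big[setI/setT]_(a <- idx k) sel js a.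
Proof.
rewrite big_map -bigcap_seq; apply/seteqP; split => w /= H i.
  by rewrite /= mem_iota add0n /=; exact: H.
by move=> ik; apply: H; rewrite /= mem_iota add0n.
Qed.

Let idx_uniq k : uniq (idx k).
Proof. by rewrite map_inj_uniq ?iota_uniq// => i j []. Qed.

Let idx_future s k : all (future s) (idx k).
Proof. by rewrite all_map; apply/allP. Qed.

Let sel_source js a k : a \in idx k -> source X e J a (sel js a).
Proof.
by move=> /mapP[i _ ->]; exists (lev @^-1` [set js i]) => //; rewrite setTI.
Qed.

Let lev_mass (j : nat) k := P (J k @^-1` (lev @^-1` [set j])).

Lemma level_event_measurable k js : measurable (level_event k js).
Proof.
rewrite level_eventE.
exact: source_bigI_measurable (fun a (ak : a \in idx k) => sel_source js ak).
Qed.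

Lemma level_eventS k js j :
  P (level_event k.+1 (upd js k j)) = P (level_event k js) * lev_mass j k.
Proof.
have H js' n : P (level_event n js') = \prod_(i <- iota 0 n) lev_mass (js' i) i.
  rewrite level_eventE (indep (idx_uniq n)); last by move=> a; exact: sel_source.
  by rewrite big_map.
rewrite !H -addn1 iotaD big_cat/= add0n big_seq1 /upd eqxx; congr (_ * _).
by apply: eq_big_seq => i; rewrite mem_iota add0n /= => ik; rewrite (ltn_eqF ik).
Qed.

Lemma level_event_split k js :
  level_event k js = \big[setU/set0]_(j <- iota 0 m.+1) level_event k.+1 (upd js k j).
Proof.
rewrite -bigcup_seq; apply/seteqP; split => [w H|w [j /= _ H]].
  exists (lev (J k w)).
    suff : lev (J k w) \in iota 0 m.+1 by [].
    by rewrite mem_iota add0n ltnS lev_le.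
  move=> i; rewrite ltnS leq_eqVlt /upd => /orP[/eqP ->|ik]; first by rewrite eqxx.
  by rewrite (ltn_eqF ik); exact: H.
by move=> i ik; have := H i (ltnW ik); rewrite /upd (ltn_eqF ik).
Qed.

Lemma level_event_trivIset k js A :
  trivIset A (fun j => level_event k.+1 (upd js k j)).
Proof.
move=> i j _ _ [w [/= Hi Hj]].
by have := Hi k (ltnSn k); have := Hj k (ltnSn k); rewrite /upd eqxx => <- <-.
Qed.

Definition random_run k (w : Om) : T := level_run (fun i => lev (J i w)) k w.

Lemma random_run_event k js w : level_event k js w -> random_run k w = level_run js k w.
Proof. by move=> H; rewrite /random_run (@eq_level_run _ js). Qed.

Lemma measurable_random_run_event r k js :
  measurable_fun (level_event k js) (random_run (k + r)).
Proof.
elim: r k js => [|r IH] k js.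
  rewrite addn0; apply: (eq_measurable_fun (level_run js k)).
    by move=> w /set_mem /random_run_event ->.
  apply: measurable_funTS; exact: (past_measW (@past_meas_level_run js k)).
have -> : level_event k js = \bigcup_j level_event k.+1 (upd js k j).
  rewrite level_event_split -bigcup_seq; apply/seteqP; split => [w [j _ H]|w [j _ H]].
    by exists j.
  exists j => //=; have <- : lev (J k w) = j by rewrite H// /upd eqxx.
  suff : lev (J k w) \in iota 0 m.+1 by [].
  by rewrite mem_iota add0n ltnS lev_le.
apply/measurable_fun_bigcup => j; first exact: level_event_measurable.
by rewrite addnS -addSn; exact: IH.
Qed.

Lemma measurable_random_run k : measurable_fun setT (random_run k).
Proof.
have := @measurable_random_run_event k 0 (fun=> 0%N).
by rewrite add0n (_ : level_event _ _ = setT)//; apply/seteqP; split.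
Qed.

Variables (q : nat -> R) (clean : T -> Prop) (V : T -> R) (a c : R).
Hypothesis q0 : forall j, (0 <= q j)%R.
Hypothesis qsum : (\sum_(j <- iota 0 m.+1) q j = 1)%R.
Hypothesis qE : forall k j, (j <= m)%N -> lev_mass j k = (q j)%:E.
Hypothesis clean0 : clean y0.
Hypothesis clean_fin : forall y, clean (fin y).
Hypothesis V0 : forall y, (0 <= V y)%R.
Hypothesis mV : measurable_fun setT V.
Hypotheses (a0 : (0 <= a)%R) (c0 : (0 <= c)%R).
Hypothesis contraction : forall s w y, clean y ->
  \sum_(j <- iota 0 m.+1)
    (q j)%:E * iter_exp Q e (us j) s (EFin \o V \o fin) y (next_law Q pi X s w)
  <= (a * V y + c)%:E.

Lemma clean_level_run js k w : clean (level_run js k w).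
Proof. by case: k => [|k] //=; exact: clean_fin. Qed.

Let mVE : measurable_fun setT (EFin \o V : T -> \bar R).
Proof. exact/measurable_EFinP. Qed.

(** Conditionally on the past of iteration k only the new level and the new batch
    are random, so the one-step hypothesis can be integrated. *)
Lemma level_run_contraction k js :
  \sum_(j <- iota 0 m.+1) (q j)%:E * \int[P]_w (V (level_run (upd js k j) k.+1 w))%:E
  <= a%:E * \int[P]_w (V (level_run js k w))%:E + c%:E.
Proof.
pose s := pos js k; pose Y := level_run js k.
have pY : past_meas X e s s Y by exact: past_meas_level_run.
have mY := past_measW pY.
have mVY : measurable_fun setT (fun w => (V (Y w))%:E) by exact: (measurableT_comp mVE mY).
have mVf : measurable_fun setT (EFin \o V \o fin : T -> \bar R).
  exact: measurableT_comp.
have Vf0 y : 0 <= (EFin \o V \o fin) y by rewrite lee_fin.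
pose I j w := iter_exp Q e (us j) s (EFin \o V \o fin) (Y w) (next_law Q pi X s w).
have mI j : measurable_fun setT (I j) by exact: (measurable_iter_exp Q e (next_law Q pi X s)).
have I0 j w : 0 <= I j w by exact: iter_exp_ge0.
have -> : \sum_(j <- iota 0 m.+1) (q j)%:E * \int[P]_w (V (level_run (upd js k j) k.+1 w))%:E =
    \int[P]_w \sum_(j <- iota 0 m.+1) (q j)%:E * I j w.
  rewrite ge0_integral_sum//; last 2 first.
  - by move=> j; exact: emeasurable_funM.
  - by move=> j w _; rewrite mule_ge0 ?lee_fin.
  apply: eq_bigr => j _; rewrite ge0_integralZl//; last by rewrite lee_fin.
  congr (_ * _); rewrite -(tower indep markov Vf0 mVf (@mus j) pY).
  apply: eq_integral => w _ /=; rewrite {1}/upd eqxx.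
  have E1 i : (i < k)%N -> upd js k j i = js i by rewrite /upd => /ltn_eqF ->.
  by rewrite (eq_pos E1) (eq_level_run E1).
rewrite -ge0_integralZl//; last first.
  by move=> w _; rewrite lee_fin.
have -> : c%:E = \int[P]_w (cst c%:E w).
  by rewrite integral_cst_prob.
rewrite -ge0_integralD//; last 2 first.
- by move=> w _; rewrite mule_ge0 ?lee_fin.
- exact: emeasurable_funM.
apply: ge0_le_integral => //.
- by move=> w _; apply: sume_ge0 => j _; rewrite mule_ge0 ?lee_fin.
- by apply: emeasurable_sum => j; exact: emeasurable_funM.
- apply: emeasurable_funD => //; exact: emeasurable_funM.
- by move=> w _; apply: contraction; exact: clean_level_run.
Qed.

(** Backwards induction on the number r of remaining iterations: the event on the
    first k levels splits according to the level of iteration k, and the levels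
    are independent of everything the first k iterations have used. *)
Lemma random_run_event_bound r k js :
  \int[P]_(w in level_event k js) (V (random_run (k + r) w))%:E <=
  P (level_event k js) *
    ((a ^+ r)%:E * \int[P]_w (V (level_run js k w))%:E + (c * \sum_(i < r) a ^+ i)%:E).
Proof.
elim: r k js => [|r IH] k js.
  rewrite addn0 expr0 mul1e big_ord0 mulr0 adde0.
  have -> : \int[P]_(w in level_event k js) (V (random_run k w))%:E =
      \int[P]_(w in level_event k js) (V (level_run js k w))%:E.
    by apply: eq_integral => w /set_mem /random_run_event ->.
  rewrite level_eventE (past_indep_integral (e := e) (J := J) indep (s := pos js k) (s' := pos js k))//.
  - by move=> a' a'k; exact: sel_source a'k.
  - apply: (past_meas_comp mVE); exact: past_meas_level_run.
  - by move=> w; rewrite lee_fin.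
rewrite [in leLHS]level_event_split ge0_integral_bigsetU//; last 5 first.
- by move=> j; exact: level_event_measurable.
- exact: (iota_uniq 0 m.+1).
- exact: level_event_trivIset.
- rewrite -(level_event_split k js); apply: (measurableT_comp mVE).
  exact: measurable_random_run_event.
- by move=> w _; rewrite lee_fin.
pose Il j := \int[P]_w (V (level_run (upd js k j) k.+1 w))%:E.
have Il0 j : 0 <= Il j by apply: integral_ge0 => w _; rewrite lee_fin.
set sr := (\sum_(i < r) a ^+ i)%R.
have sr0 : (0 <= sr)%R by apply: sumr_ge0 => i _; exact: exprn_ge0.
have Pf : P (level_event k js) \is a fin_num.
  by rewrite fin_num_measure//; exact: level_event_measurable.
apply: (@le_trans _ _ (\sum_(j <- iota 0 m.+1) P (level_event k js) *
    ((q j)%:E * ((a ^+ r)%:E * Il j + (c * sr)%:E)))).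
  rewrite big_seq [leRHS]big_seq; apply: lee_sum => j; rewrite mem_iota add0n => /= jm.
  rewrite addnS -addSn; apply: (le_trans (IH _ _)).
  by rewrite level_eventS qE// muleA.
rewrite -ge0_sume_distrr; last first.
  by move=> j _; rewrite mule_ge0 ?lee_fin// adde_ge0 ?mule_ge0 ?lee_fin ?exprn_ge0// mulr_ge0.
apply: lee_wpmul2l; first exact: measure_ge0.
have -> : \sum_(j <- iota 0 m.+1) (q j)%:E * ((a ^+ r)%:E * Il j + (c * sr)%:E) =
    (a ^+ r)%:E * (\sum_(j <- iota 0 m.+1) (q j)%:E * Il j) + (c * sr)%:E.
  rewrite ge0_sume_distrr; last by move=> j _; rewrite mule_ge0 ?lee_fin.
  transitivity (\sum_(j <- iota 0 m.+1) ((a ^+ r)%:E * ((q j)%:E * Il j) + (q j)%:E * (c * sr)%:E)).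
    apply: eq_bigr => j _.
    rewrite ge0_muleDr ?mule_ge0 ?lee_fin ?exprn_ge0 ?mulr_ge0//.
    by congr (_ + _); rewrite muleCA.
  rewrite big_split; congr (_ + _).
  by under eq_bigr do rewrite -EFinM; rewrite sumEFin -mulr_suml qsum mul1r.
apply: (@le_trans _ _ ((a ^+ r)%:E * (a%:E * \int[P]_w (V (level_run js k w))%:E + c%:E) + (c * sr)%:E)).
  apply: leeD => //; apply: lee_wpmul2l; first by rewrite lee_fin exprn_ge0.
  exact: level_run_contraction.
have IV0 : 0 <= \int[P]_w (V (level_run js k w))%:E.
  by apply: integral_ge0 => w _; rewrite lee_fin.
rewrite ge0_muleDr ?mule_ge0 ?lee_fin// muleA -EFinM -exprSr -addeA.
rewrite big_ord_recr/= -/sr (_ : (c * (sr + a ^+ r))%:E = (a ^+ r)%:E * c%:E + (c * sr)%:E)//.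
by rewrite -EFinM -EFinD; congr EFin; ring.
Qed.

Lemma random_run_bound N :
  \int[P]_w (V (random_run N w))%:E <=
  (a ^+ N * V y0 + c * \sum_(i < N) a ^+ i)%:E.
Proof.
have := random_run_event_bound N 0 (fun=> 0%N); rewrite add0n.
rewrite (_ : level_event _ _ = setT); last by apply/seteqP; split.
rewrite probability_setT mul1e /=.
rewrite (_ : \int[P]_w (V y0)%:E = (V y0)%:E) ?EFinD ?EFinM//.
exact: integral_cst_prob.
Qed.

End random_levels.

(** * Mixing of the chain for bounded functions *)

Section bounded_expectation.
Context {R : realType}.

Definition bmeas d (T : measurableType d) (f : T -> R) : Prop :=
  measurable_fun setT f /\ exists C : R, forall x, `|f x| <= C.

Definition Ex d (T : measurableType d) (m : {measure set T -> \bar R}) (f : T -> R) : R :=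
  fine (\int[m]_x (f x)%:E)%E.

Section closure.
Context d (T : measurableType d).
Implicit Types f g : T -> R.

Lemma bmeas_cst (c : R) : bmeas (fun _ : T => c).
Proof. by split; [exact: measurable_cst|exists `|c|]. Qed.

Lemma bmeasD f g : bmeas f -> bmeas g -> bmeas (fun x => f x + g x).
Proof.
move=> [mf [C fC]] [mg [D gD]]; split; first exact: measurable_funD.
by exists (C + D) => x; apply: (le_trans (ler_normD _ _)); exact: lerD.
Qed.

Lemma bmeasM f g : bmeas f -> bmeas g -> bmeas (fun x => f x * g x).
Proof.
move=> [mf [C fC]] [mg [D gD]]; split; first exact: measurable_funM.
by exists (C * D) => x; rewrite normrM; exact: ler_pM.
Qed.

Lemma bmeasZ (c : R) f : bmeas f -> bmeas (fun x => c * f x).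
Proof. by apply: bmeasM; exact: bmeas_cst. Qed.

Lemma bmeas_sum (I : Type) (s : seq I) (F : I -> T -> R) :
  (forall i, bmeas (F i)) -> bmeas (fun x => \sum_(i <- s) F i x).
Proof.
move=> bF; elim: s => [|i s IH].
  by under eq_fun do rewrite big_nil; exact: bmeas_cst.
by under eq_fun do rewrite big_cons; exact: bmeasD.
Qed.

Lemma bmeas_comp d' (T' : measurableType d') (g : T' -> T) f :
  measurable_fun setT g -> bmeas f -> bmeas (f \o g).
Proof.
move=> mg [mf [C fC]]; split; first exact: measurableT_comp.
by exists C => x; exact: fC.
Qed.

Section expectation.
Variable m : {measure set T -> \bar R}.
Hypothesis m1 : m setT = 1%E.

Lemma bmeas_integrable f : bmeas f -> m.-integrable setT (EFin \o f).
Proof.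
move=> [mf [C fC]]; apply: measurable_bounded_integrable => //.
  by rewrite m1 ltry.
exists C; split; first exact: num_real.
by move=> y Cy x _; apply: (le_trans (fC x)); exact: ltW.
Qed.

Lemma ExE f : bmeas f -> (\int[m]_x (f x)%:E = (Ex m f)%:E)%E.
Proof.
move=> bf; rewrite /Ex fineK//.
exact: integrable_fin_num (bmeas_integrable bf).
Qed.

Lemma ExD f g : bmeas f -> bmeas g -> Ex m (fun x => f x + g x) = Ex m f + Ex m g.
Proof. by move=> bf bg; apply: RintegralD => //; exact: bmeas_integrable. Qed.

Lemma ExZ (c : R) f : bmeas f -> Ex m (fun x => c * f x) = c * Ex m f.
Proof. by move=> bf; apply: RintegralZl => //; exact: bmeas_integrable. Qed.

Lemma Ex_cst (c : R) : Ex m (fun _ => c) = c.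
Proof. by rewrite [LHS]Rintegral_cst// m1 mulr1. Qed.

Lemma Ex_shift f (c : R) : bmeas f -> Ex m f = Ex m (fun x => f x + c) - c.
Proof. by move=> bf; rewrite ExD ?Ex_cst ?addrK//; exact: bmeas_cst. Qed.

Lemma Ex_sum (I : Type) (s : seq I) (F : I -> T -> R) : (forall i, bmeas (F i)) ->
  Ex m (fun x => \sum_(i <- s) F i x) = \sum_(i <- s) Ex m (F i).
Proof.
move=> bF; elim: s => [|i s IH].
  rewrite big_nil -[RHS](Ex_cst 0); congr Ex.
  by apply/funext => x; rewrite big_nil.
rewrite big_cons -IH -ExD//; last exact: bmeas_sum.
by congr Ex; apply/funext => x; rewrite big_cons.
Qed.

Lemma Ex_le f g : bmeas f -> bmeas g -> (forall x, f x <= g x) -> Ex m f <= Ex m g.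
Proof. by move=> bf bg fg; apply: le_Rintegral => //; exact: bmeas_integrable. Qed.

Lemma Ex_le_cst f c : bmeas f -> (forall x, f x <= c) -> Ex m f <= c.
Proof. by move=> bf fc; rewrite -[leRHS]Ex_cst; apply: Ex_le => //; exact: bmeas_cst. Qed.

Lemma Ex_abs_le f c : bmeas f -> (forall x, `|f x| <= c) -> `|Ex m f| <= c.
Proof.
move=> bf fc; rewrite ler_norml; apply/andP; split; last first.
  by apply: Ex_le_cst => // x; apply: le_trans (fc x); exact: ler_norm.
rewrite -[leLHS]Ex_cst; apply: Ex_le => //; first exact: bmeas_cst.
by move=> x; have := fc x; rewrite ler_norml => /andP[].
Qed.

End expectation.
End closure.

Lemma bmeas_Ex_kernel d d' (X : measurableType d) (Y : measurableType d')
    (k : R.-fker X ~> Y) (f : X * Y -> R) :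
  (forall x, k x setT = 1%E) -> bmeas f -> bmeas (fun x => Ex (k x) (fun y => f (x, y))).
Proof.
move=> k1 bf; have [mf [C fC]] := bf; split; last first.
  exists C => x; apply: Ex_abs_le => //.
  exact: (bmeas_comp (pair1_measurable x) bf).
have -> : (fun x => Ex (k x) (fun y => f (x, y))) =
    (fun x => fine (\int[k x]_y (f (x, y) + C)%:E)%E - C).
  apply/funext => x.
  have bfx : bmeas (fun y => f (x, y)) by exact: (bmeas_comp (pair1_measurable x) bf).
  rewrite -[X in _ - X](@Ex_cst _ _ (k x)) ?k1//.
  rewrite -/(Ex (k x) _) (ExD (k1 x))//; first by rewrite addrK.
  exact: bmeas_cst.
apply: measurable_funB => //; apply: (@measurableT_comp _ _ _ _ _ _ (@fine R)) => //.
pose f' (xy : X * Y) := (f xy + C)%:E.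
apply: (measurable_fun_integral_finite_kernel f' k).
  by move=> xy; rewrite lee_fin -lerBlDr sub0r; have := fC xy; rewrite ler_norml => /andP[].
by apply/measurable_EFinP; exact: measurable_funD.
Qed.

Lemma bmeas_Ex_cst d d' (X : measurableType d) (Y : measurableType d')
    (P : probability Y R) (f : X * Y -> R) :
  bmeas f -> bmeas (fun x => Ex P (fun y => f (x, y))).
Proof.
move=> bf; apply: (bmeas_Ex_kernel (k := kcst P)) => // x.
exact: (probability_setT P).
Qed.

Lemma Ex_fubini d d' (X : measurableType d) (Y : measurableType d')
    (P : probability X R) (P' : probability Y R) (f : X * Y -> R) : bmeas f ->
  Ex P (fun x => Ex P' (fun y => f (x, y))) = Ex P' (fun y => Ex P (fun x => f (x, y))).
Proof.
move=> bf; have [mf [C fC]] := bf.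
have P1 := probability_setT P; have P1' := probability_setT P'.
have bfx x : bmeas (fun y => f (x, y)) by exact: (bmeas_comp (pair1_measurable x) bf).
have bfy y : bmeas (fun x => f (x, y)) by exact: (bmeas_comp (pair2_measurable y) bf).
rewrite {1}/Ex; under eq_integral do rewrite -(ExE P1')//.
rewrite {1}[RHS]/Ex; under [in RHS]eq_integral do rewrite -(ExE P1)//.
congr fine; have := @Fubini _ _ X Y R P P' (EFin \o f); apply.
apply/integrable12ltyP; first exact/measurable_EFinP.
apply: (@le_lt_trans _ _ (\int[P]_x \int[P']_y C%:E)%E); last first.
  by rewrite !integral_cst_prob ltry.
have m1 : measurable_fun setT (fun xy : X * Y => `|(EFin \o f) xy|%E).
  by apply: measurableT_comp => //; exact/measurable_EFinP.
apply: ge0_le_integral => //.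
- by move=> x _; exact: integral_ge0.
- exact: (measurable_fun_fubini_tonelli_F (m2 := P') _ m1).
- move=> x _; apply: ge0_le_integral => //.
  + exact: (measurableT_comp m1 (pair1_measurable x)).
  + by move=> y _; rewrite /= lee_fin.
Qed.

End bounded_expectation.

Section mixing.
Local Open Scope ereal_scope.
Context {R : realType} {dZ : measure_display} {Z : measurableType dZ}.
Variables (Q : R.-pker Z ~> Z) (pi : probability Z R).

Lemma kpow1 k z : kpow Q k z setT = 1.
Proof.
elim: k z => [|k IH] z /=; first by rewrite /kdirac/= diracT.
rewrite /mkcomp_noparam/= /kcomp_noparam; under eq_integral do rewrite IH.
by rewrite integral_cst// mul1e prob_kernel.
Qed.

Lemma integral_kpowS k z (g : Z -> \bar R) : (forall x, 0 <= g x) ->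
  measurable_fun setT g ->
  \int[kpow Q k.+1 z]_x g x = \int[Q z]_y \int[kpow Q k y]_x g x.
Proof.
move=> g0 mg.
pose k' : R.-fker (Z * Z)%type ~> Z :=
  kpre (kpow Q k) (measurable_snd : measurable_fun setT (snd : Z * Z -> Z)).
by rewrite -(integral_kcomp Q k')//; exact: eq_measure_integral.
Qed.

Hypothesis invpi : invariant_measure Q pi.

Lemma integral_invariant (g : Z -> \bar R) : (forall x, 0 <= g x) ->
  measurable_fun setT g -> \int[pi]_z \int[Q z]_x g x = \int[pi]_x g x.
Proof.
move=> g0 mg.
pose l : R.-fker unit ~> Z := kcst pi.
pose k' : R.-fker (unit * Z)%type ~> Z :=
  kpre Q (measurable_snd : measurable_fun setT (snd : unit * Z -> Z)).
have -> : \int[pi]_x g x = \int[mkcomp l k' tt]_x g x.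
  by apply: eq_measure_integral => A mA _; apply/esym; exact: (invpi mA).
by rewrite (integral_kcomp l k').
Qed.

Lemma integral_kpow_invariant k (g : Z -> \bar R) : (forall x, 0 <= g x) ->
  measurable_fun setT g -> \int[pi]_z \int[kpow Q k z]_x g x = \int[pi]_x g x.
Proof.
move=> g0 mg; elim: k => [|k IH].
  apply: eq_integral => z _ /=.
  by rewrite /kdirac integral_dirac// diracT mul1e.
under eq_integral do rewrite integral_kpowS//.
rewrite (integral_invariant (g := fun y => \int[kpow Q k y]_x g x))//.
  by move=> x; exact: integral_ge0.
apply: (measurable_fun_integral_finite_kernel (fun xy : Z * Z => g xy.2) (kpow Q k)) => //.
exact: (measurableT_comp mg measurable_snd).
Qed.

(** In a Hahn decomposition mu is at most nu plus the positive part of mu - nu,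
    whose mass is at most the total variation. *)
Lemma charge_variation_integral (mu nu : {finite_measure set Z -> \bar R}) A N
    (h : hahn_decomposition (cadd (charge_of_finite_measure mu)
      (copp (charge_of_finite_measure nu))) A N) (g : Z -> \bar R) (C : R) :
  (0 <= C)%R -> measurable_fun setT g -> (forall x, 0 <= g x <= C%:E) ->
  \int[mu]_x g x <= \int[nu]_x g x + C%:E * charge_variation h setT.
Proof.
move=> C0 mg gC; set jp := jordan_pos h; set jn := jordan_neg h.
have g0 x : 0 <= g x by case/andP: (gC x).
have le_meas B : measurable B -> mu B <= measure_add nu jp B.
  move=> mB; rewrite measure_addE.
  have H : mu B - nu B = jp B + (-1)%:E * jn B := jordan_decomp h mB.
  have gen (a b x y : \bar R) : a \is a fin_num -> b \is a fin_num ->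
      x \is a fin_num -> y \is a fin_num -> a - b = x + (-1)%:E * y -> 0 <= y -> a <= b + x.
    case: a b x y => [a||] [b||] [x||] [y||] // _ _ _ _.
    by rewrite -EFinN -EFinM -!EFinD !lee_fin => -[]; lra.
  by apply: (gen _ _ _ _ _ _ _ _ H); rewrite ?fin_num_measure//; exact: measure_ge0.
apply: (le_trans (ge0_le_measure_integral le_meas _ _ _)) => //.
rewrite ge0_integral_measure_add//; apply: leeD => //.
apply: (@le_trans _ _ (\int[jp]_x C%:E)).
  by apply: ge0_le_integral => // x _; case/andP: (gC x).
rewrite integral_cst//; apply: lee_wpmul2l; first by rewrite lee_fin.
rewrite /charge_variation -/jp -/jn leeDl//; exact: measure_ge0.
Qed.

Variable tau : nat.
Hypothesis ergQ : uniformly_geometrically_ergodic Q tau.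

Lemma ergodic_integral k z z' (g : Z -> \bar R) (C : R) :
  measurable_fun setT g -> (forall x, 0 <= g x <= C%:E) ->
  \int[kpow Q k z]_x g x <= \int[kpow Q k z']_x g x + (2 * C * 4^-1 ^+ (k %/ tau))%:E.
Proof.
move=> mg gC.
have C0 : (0 <= C)%R.
  by case/andP: (gC z) => a b; rewrite -lee_fin; exact: le_trans a b.
have := charge_variation_integral (svalP (cid (svalP (cid (Hahn_decomposition
  (cadd (charge_of_finite_measure (kpow_at Q k z))
    (copp (charge_of_finite_measure (kpow_at Q k z'))))))))) C0 mg gC.
rewrite -/(tv_norm _).
move=> /le_trans; apply; apply: leeD => //.
have tvb : (2^-1)%:E * tv_norm (cadd (charge_of_finite_measure (kpow_at Q k z))
      (copp (charge_of_finite_measure (kpow_at Q k z')))) <= ((4^-1) ^+ (k %/ tau))%:E.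
  apply: le_trans (ergQ k); apply: ereal_sup_ubound.
  by exists (z, z').
set tv := tv_norm _ in tvb *.
have -> : (2 * C * 4^-1 ^+ (k %/ tau))%:E = C%:E * (2%:E * ((4^-1) ^+ (k %/ tau))%:E).
  by rewrite -!EFinM; congr EFin; ring.
apply: lee_wpmul2l; first by rewrite lee_fin.
apply: le_trans (lee_wpmul2l _ tvb); last by rewrite lee_fin.
by rewrite muleA -EFinM divff ?mul1e// lt0r_neq0.
Qed.

Lemma Ex_kpowS k z (h : Z -> R) : bmeas h ->
  Ex (kpow Q k.+1 z) h = Ex (Q z) (fun y => Ex (kpow Q k y) h).
Proof.
move=> bh; have [mh [C hC]] := bh.
have bhC : bmeas (fun x => h x + C)%R by apply: bmeasD => //; exact: bmeas_cst.
have hC0 x : 0 <= (h x + C)%:E.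
  by rewrite lee_fin -lerBlDr sub0r; have := hC x; rewrite ler_norml => /andP[].
have Q1 y : Q y setT = 1 by rewrite prob_kernel.
have bk : bmeas (fun y => Ex (kpow Q k y) h).
  apply: (bmeas_Ex_kernel (k := kpow Q k) (f := fun xy : Z * Z => h xy.2)).
    by move=> x; exact: kpow1.
  exact: (bmeas_comp measurable_snd bh).
rewrite (Ex_shift (kpow1 _ _) C bh) (Ex_shift (Q1 z) C bk); congr (_ - _)%R.
rewrite {1}/Ex integral_kpowS//; last exact/measurable_EFinP/(bhC.1).
rewrite [RHS]/Ex; congr fine; apply: eq_integral => y _.
rewrite (ExE (kpow1 _ _))//; congr EFin.
by rewrite (Ex_shift (kpow1 k y) C bh) subrK.
Qed.

(** Averaging the comparison of two starting points over the second one, drawn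
    from pi, compares with the stationary mean, which is 0. *)
Lemma mixing_bound k z (h : Z -> R) (C : R) : measurable_fun setT h ->
    (forall x, `|h x| <= C)%R -> Ex pi h = 0%R ->
  (`|Ex (kpow Q k z) h| <= 4 * C * 4^-1 ^+ (k %/ tau))%R.
Proof.
move=> mh hC pih; have bh : bmeas h by split => //; exists C.
set q := (_ ^+ _)%R.
have bhC : bmeas (fun x => h x + C)%R by apply: bmeasD => //; exact: bmeas_cst.
have mhC : measurable_fun setT (fun x => (h x + C)%:E) by exact/measurable_EFinP/(bhC.1).
have hC2 x : 0 <= (h x + C)%:E <= (2 * C)%:E.
  have := hC x; rewrite ler_norml => /andP[h1 h2].
  by rewrite !lee_fin -lerBlDr sub0r h1/= mulr2n mulrDl mul1r lerD2r.
have key z1 z2 : (Ex (kpow Q k z1) h <= Ex (kpow Q k z2) h + 4 * C * q)%R.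
  have := ergodic_integral k z1 z2 mhC hC2.
  rewrite !(ExE (kpow1 _ _))// -EFinD lee_fin !(ExD (kpow1 _ _))//; try exact: bmeas_cst.
  rewrite !(Ex_cst (kpow1 _ _)) -/q => H.
  rewrite -(lerD2r C); apply: (le_trans H); rewrite le_eqVlt; apply/orP; left; apply/eqP; ring.
have bk : bmeas (fun y => Ex (kpow Q k y) h).
  apply: (bmeas_Ex_kernel (k := kpow Q k) (f := fun xy : Z * Z => h xy.2)).
    by move=> x; exact: kpow1.
  exact: (bmeas_comp measurable_snd bh).
have P1 := probability_setT pi.
have mean0 : Ex pi (fun y => Ex (kpow Q k y) h) = 0%R.
  rewrite -pih (Ex_shift P1 C bk) (Ex_shift P1 C bh); congr (_ - _)%R.
  rewrite [RHS]/Ex -(integral_kpow_invariant k)//; last by move=> x; case/andP: (hC2 x).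
  rewrite [LHS]/Ex; congr fine; apply: eq_integral => y _.
  by rewrite (ExE (kpow1 _ _))//; congr EFin; rewrite [in LHS](Ex_shift (kpow1 k y) C bh) subrK.
rewrite ler_norml; apply/andP; split.
- have : (Ex pi (fun y => Ex (kpow Q k y) h) <= Ex (kpow Q k z) h + 4 * C * q)%R.
    by apply: Ex_le_cst => // y; exact: key.
  by rewrite mean0 -lerBlDr sub0r.
- have : (Ex (kpow Q k z) h - 4 * C * q <= Ex pi (fun y => Ex (kpow Q k y) h))%R.
    rewrite -(Ex_cst P1 (Ex (kpow Q k z) h - 4 * C * q)).
    apply: Ex_le => //; first exact: bmeas_cst.
    by move=> y; rewrite lerBlDr; exact: key.
  by rewrite mean0 subr_le0.
Qed.

End mixing.

(** * Mean and second moment of a weighted sum of samples *)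

Section integral_monotone.
Context {R : realType} {d : measure_display} {T : measurableType d}.

Lemma ge0_le_integral_nomeas (m : {measure set T -> \bar R}) (f g : T -> \bar R) :
  (forall x, 0 <= f x)%E -> (forall x, f x <= g x)%E ->
  (\int[m]_x f x <= \int[m]_x g x)%E.
Proof.
move=> f0 fg; have g0 x : (0 <= g x)%E by exact: le_trans (fg x).
rewrite !ge0_integralTE//; apply: ge_ereal_sup => _ [h /= hf <-].
by apply: ereal_sup_ubound; exists h => //= x; exact: le_trans (hf x) (fg x).
Qed.

End integral_monotone.

Section batch_moments.
Context {R : realType} {dO : measure_display} {Om : measurableType dO}
  {P : probability Om R}.
Context {dZ : measure_display} {Z : measurableType dZ} (Q : R.-pker Z ~> Z).
Context {dE : measure_display} {E : measurableType dE} (e : nat -> {RV P >-> E}).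
Local Notation nu s := (distribution P (e s)).

Let nu1 s : nu s setT = 1%E. Proof. exact: (probability_setT (nu s)). Qed.
Let Q1 z : Q z setT = 1%E. Proof. by rewrite prob_kernel. Qed.

Section one_step.
Variables (r : {measure set Z -> \bar R}) (s : nat).
Hypothesis r1 : r setT = 1%E.

Definition sample_exp (B : Z * E -> R) : R := Ex r (fun z => Ex (nu s) (fun v => B (z, v))).

Let bin (B : Z * E -> R) : bmeas B -> bmeas (fun z => Ex (nu s) (fun v => B (z, v))).
Proof. exact: bmeas_Ex_cst. Qed.
Let bin1 (B : Z * E -> R) z : bmeas B -> bmeas (fun v => B (z, v)).
Proof. by move=> bB; exact: (bmeas_comp (pair1_measurable z) bB). Qed.

Lemma sample_expE B : bmeas B ->
  (\int[r]_z \int[nu s]_v (B (z, v))%:E = (sample_exp B)%:E)%E.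
Proof.
move=> bB; rewrite /sample_exp -(ExE r1); last exact: bin.
by apply: eq_integral => z _; rewrite (ExE (nu1 s))//; exact: bin1.
Qed.

Lemma sample_expD B C : bmeas B -> bmeas C ->
  sample_exp (fun x => B x + C x) = sample_exp B + sample_exp C.
Proof.
move=> bB bC; rewrite /sample_exp -(ExD r1); [|exact: bin|exact: bin].
by congr Ex; apply/funext => z; rewrite (ExD (nu1 s)); [|exact: bin1|exact: bin1].
Qed.

Lemma sample_expZ c B : bmeas B -> sample_exp (fun x => c * B x) = c * sample_exp B.
Proof.
move=> bB; rewrite /sample_exp -(ExZ r1); last exact: bin.
by congr Ex; apply/funext => z; rewrite (ExZ (nu1 s))//; exact: bin1.
Qed.

Lemma sample_exp_cst c : sample_exp (fun=> c) = c.
Proof. by rewrite /sample_exp (Ex_cst (nu1 s)) (Ex_cst r1). Qed.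

Lemma sample_exp_sum (I : Type) (t : seq I) (F : I -> Z * E -> R) :
  (forall i, bmeas (F i)) ->
  sample_exp (fun x => \sum_(i <- t) F i x) = \sum_(i <- t) sample_exp (F i).
Proof.
move=> bF; rewrite /sample_exp -(Ex_sum r1); last by move=> i; exact: bin.
by congr Ex; apply/funext => z; rewrite (Ex_sum (nu1 s)) => // i; exact: bin1.
Qed.

Lemma sample_exp_fst f : bmeas f -> sample_exp (fun x => f x.1) = Ex r f.
Proof.
by move=> bf; congr Ex; apply/funext => z; exact: (Ex_cst (nu1 s) (f z)).
Qed.

End one_step.

Context {d : measure_display} {T : measurableType d} (n : nat).
Variables (upd : R -> T * (Z * E) -> T) (Inv : T -> Prop).
Variables (S : 'I_n -> T -> R) (g : 'I_n -> R) (H : 'I_n -> Z * E -> R).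
Hypothesis Inv_upd : forall w y zv, Inv y -> Inv (upd w (y, zv)).
Hypothesis S_upd : forall w y zv i, Inv y -> S i (upd w (y, zv)) = S i y + w * (g i + H i zv).
Variables (K : R) (eta : nat -> R).
Hypothesis K0 : 0 <= K.
Hypothesis mH : forall i, measurable_fun setT (H i).
Hypothesis HK : forall i zv, `|H i zv| <= K.

(** The state z of the chain acts on the mean only through the average of the
    sample over the direction. *)
Definition mean_field i s (z : Z) : R := Ex (nu s) (fun v => H i (z, v)).
Hypothesis eta0 : forall k, 0 <= eta k.
Hypothesis mean_decay : forall i s k z, `|Ex (kpow Q k z) (mean_field i s)| <= eta k.

Let bH i : bmeas (H i). Proof. by split => //; exists K. Qed.
Let bh i s : bmeas (mean_field i s).
Proof. exact: bmeas_Ex_cst. Qed.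
Definition decayed i s k z := Ex (kpow Q k z) (mean_field i s).
Let bdec i s k : bmeas (decayed i s k).
Proof.
apply: (bmeas_Ex_kernel (k := kpow Q k) (f := fun xy : Z * Z => mean_field i s xy.2)).
  by move=> x; exact: kpow1.
exact: (bmeas_comp measurable_snd (bh i s)).
Qed.

(** Mean of the sample drawn k steps after the next one when the next state has
    law r. *)
Definition lag_mean (r : {measure set Z -> \bar R}) i s k : R := Ex r (decayed i (s + k) k).

Definition weighted_mean (ws : seq R) s r i : R :=
  \sum_(k < size ws) ws`_k * lag_mean r i s k.

Lemma lag_mean_le (r : {measure set Z -> \bar R}) i s k : r setT = 1%E -> `|lag_mean r i s k| <= eta k.
Proof. by move=> r1; apply: (Ex_abs_le r1) => // z; exact: mean_decay. Qed.

Lemma weighted_mean_le W (ws : seq R) s (r : {measure set Z -> \bar R}) i : r setT = 1%E ->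
  0 <= W -> (forall k, `|ws`_k| <= W) ->
  `|weighted_mean ws s r i| <= W * \sum_(k < size ws) eta k.
Proof.
move=> r1 W0 wsW; apply: (le_trans (ler_norm_sum _ _ _)).
rewrite mulr_sumr; apply: ler_sum => k _; rewrite normrM.
by apply: ler_pM => //; exact: lag_mean_le.
Qed.

Lemma weighted_mean_cons w ws s (r : {measure set Z -> \bar R}) i : r setT = 1%E ->
  sample_exp r s (fun zv => w * H i zv + weighted_mean ws s.+1 (Q zv.1) i) =
  weighted_mean (w :: ws) s r i.
Proof.
move=> r1.
have lagE k : (fun z => lag_mean (Q z) i s.+1 k) = decayed i (s + k.+1) k.+1.
  apply/funext => z; rewrite /lag_mean /decayed addSnnS.
  by rewrite Ex_kpowS.
have bwm : bmeas (fun z => weighted_mean ws s.+1 (Q z) i).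
  by apply: bmeas_sum => k; apply: bmeasZ; rewrite lagE.
rewrite sample_expD//; last 2 first.
- exact: bmeasZ.
- exact: (bmeas_comp measurable_fst bwm).
have -> : weighted_mean (w :: ws) s r i =
    w * lag_mean r i s 0 + \sum_(k < size ws) ws`_k * lag_mean r i s k.+1.
  by rewrite /weighted_mean /= big_ord_recl.
rewrite sample_expZ// (sample_exp_fst _ _ bwm) /weighted_mean; congr (_ + _).
  congr (_ * _); rewrite /lag_mean addn0; congr Ex; apply/funext => z.
  have mh : measurable_fun setT (fun x => (mean_field i s x)%:E).
    by apply/measurable_EFinP; have [] := bh i s.
  rewrite /decayed /= [RHS]/Ex /kdirac integral_dirac//.
  by rewrite diracT mul1e.
rewrite (Ex_sum r1); last by move=> k; apply: bmeasZ; rewrite lagE.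
apply: eq_bigr => k _; rewrite (ExZ r1); last by rewrite lagE.
by rewrite lagE /lag_mean.
Qed.

Variables (Phi : T -> \bar R) (alpha c : R) (b : 'I_n -> R).
Hypothesis Phi0 : forall y, (0 <= Phi y)%E.
Hypothesis c0 : 0 <= c.
Hypothesis PhiB : forall y, Inv y ->
  (Phi y <= (alpha + \sum_i (b i * (S i y - g i) + c * (S i y - g i) ^+ 2))%:E)%E.

(** Backwards induction over the weights. D is the deviation from g that would
    remain if all samples were exact. Expanding the square of the next partial
    sum leaves the square of one sample and its product with the conditional
    mean of the later ones, which mixing bounds by W * Cm: correlations cost a
    multiple of the number of samples, as independence would. *)
Lemma iter_exp_bound (W Cm : R) (ws : seq R) s y (r : {measure set Z -> \bar R}) :
    Inv y -> r setT = 1%E -> 0 <= W -> (forall k, `|ws`_k| <= W) ->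
    \sum_(k < size ws) eta k <= Cm ->
  (iter_exp Q e [seq upd w | w <- ws] s Phi y r <=
   (alpha + \sum_i
     let D := S i y + (\sum_(w <- ws) w - 1) * g i in
     (b i * (D + weighted_mean ws s r i) +
      c * (D ^+ 2 + 2 * D * weighted_mean ws s r i +
           (size ws)%:R * (W ^+ 2 * (K ^+ 2 + 2 * K * Cm)))))%:E)%E.
Proof.
elim: ws s y r => [|w ws IH] s y r Iy r1 W0 wsW etaC /=.
  apply: (le_trans (PhiB Iy)); rewrite lee_fin lerD2l; apply: ler_sum => i _.
  by rewrite /weighted_mean big_nil big_ord0 sub0r mulN1r mulr0 !addr0 mul0r addr0.
set kap := W ^+ 2 * (K ^+ 2 + 2 * K * Cm).
have wW : `|w| <= W by exact: (wsW 0%N).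
have wsW' k : `|ws`_k| <= W by exact: (wsW k.+1).
have etaC' : \sum_(k < size ws) eta k <= Cm.
  by apply: le_trans etaC; rewrite /= big_ord_recr/= lerDl.
pose rho := \sum_(w' <- ws) w' - 1.
pose D i := S i y + (\sum_(w' <- w :: ws) w' - 1) * g i.
have DE i : D i = S i y + w * g i + rho * g i by rewrite /D /rho big_cons; ring.
pose M' i z := weighted_mean ws s.+1 (Q z) i.
have M'C i z : `|M' i z| <= W * Cm.
  apply: (le_trans (weighted_mean_le _ _ _ W0 wsW')) => //.
  exact: ler_wpM2l.
pose xi i (zv : Z * E) := w * H i zv + M' i zv.1.
pose B2 zv := alpha + \sum_i (b i * D i + c * D i ^+ 2 + c * ((size ws).+1%:R * kap))
  + \sum_i (b i + 2 * c * D i) * xi i zv.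
have bM' i : bmeas (M' i).
  apply: bmeas_sum => k; apply: bmeasZ.
  rewrite (_ : (fun z => _) = decayed i (s + k.+1) k.+1)//; apply/funext => z.
  by rewrite /lag_mean /decayed addSnnS Ex_kpowS.
have bxi i : bmeas (xi i).
  apply: bmeasD; first exact: bmeasZ.
  exact: (bmeas_comp measurable_fst (bM' i)).
have bB2 : bmeas B2.
  by apply: bmeasD; [exact: bmeas_cst|apply: bmeas_sum => i; exact: bmeasZ].
apply: (@le_trans _ _ (\int[r]_z \int[nu s]_v (B2 (z, v))%:E)%E).
  apply: ge0_le_integral_nomeas.
    by move=> z; apply: integral_ge0 => v _; exact: iter_exp_ge0.
  move=> z; apply: ge0_le_integral_nomeas => [v|v]; first exact: iter_exp_ge0.
  apply: (le_trans (IH _ _ _ (Inv_upd _ _ Iy) (Q1 z) W0 wsW' etaC')).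
  rewrite lee_fin /B2 -addrA lerD2l -big_split/=; apply: ler_sum => i _.
  rewrite S_upd// -/rho -/kap /xi -/(M' i z).
  have -> : S i y + w * (g i + H i (z, v)) + rho * g i = D i + w * H i (z, v).
    by rewrite DE; ring.
  set h := H i (z, v); set mm := M' i z.
  have hk : (w * h) ^+ 2 + 2 * (w * h) * mm <= kap.
    have wh : `|w * h| <= W * K by rewrite normrM; apply: ler_pM => //; exact: HK.
    have Cm0 : 0 <= Cm by apply: le_trans etaC; exact: sumr_ge0.
    have e1 : (w * h) ^+ 2 <= (W * K) ^+ 2.
      by rewrite -real_normK ?num_real// lerXn2r ?nnegrE ?mulr_ge0.
    have e2 : w * h * mm <= W * K * (W * Cm).
      apply: (le_trans (ler_norm _)); rewrite normrM; apply: ler_pM => //.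
      exact: M'C.
    have -> : kap = (W * K) ^+ 2 + 2 * (W * K * (W * Cm)) by rewrite /kap; ring.
    by rewrite -mulrA lerD// ler_pM2l.
  have := ler_wpM2l c0 hk; rewrite -addn1 natrD.
  lra.
rewrite sample_expE// lee_fin /B2 sample_expD//; last 2 first.
- exact: bmeas_cst.
- by apply: bmeas_sum => i; exact: bmeasZ.
rewrite sample_exp_cst// sample_exp_sum//; last by move=> i; exact: bmeasZ.
rewrite -addrA lerD2l -big_split/=; apply: ler_sum => i _.
rewrite sample_expZ// /xi /M' weighted_mean_cons// -/(D i) le_eqVlt; apply/orP; left.
by apply/eqP; ring.
Qed.

End batch_moments.

(** * Multilevel weights *)

Section multilevel.
Context {R : realType}.

Definition avg (V : lmodType R) (k : nat) (y : nat -> V) : V :=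
  k%:R^-1 *: \sum_(i < k) y i.

(** Coefficient of the i-th sample in the multilevel estimator of level j over
    batches of base size l. *)
Definition ml_weight (l j i : nat) : R :=
  (i < l)%:R / l%:R + 2 ^+ j * ((i < 2 ^ j * l)%:R / (2 ^ j * l)%:R
                              - (i < 2 ^ j.-1 * l)%:R / (2 ^ j.-1 * l)%:R).

Definition ml_weights l j : seq R := mkseq (ml_weight l j) (2 ^ j * l).

Lemma size_ml_weights l j : size (ml_weights l j) = (2 ^ j * l)%N.
Proof. by rewrite size_mkseq. Qed.

Lemma nth_ml_weights l j i : (i < 2 ^ j * l)%N -> (ml_weights l j)`_i = ml_weight l j i.
Proof. by move=> ij; rewrite nth_mkseq. Qed.

Lemma sum_indicator (V : lmodType R) (a k : nat) (y : nat -> V) : (a <= k)%N ->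
  \sum_(i < k) ((i < a)%:R / a%:R : R) *: y i = avg a y.
Proof.
move=> ak; rewrite /avg scaler_sumr.
rewrite -(big_mkord xpredT (fun i => ((i < a)%:R / a%:R : R) *: y i)).
rewrite (big_cat_nat (n := a))//= [X in _ + X]big_nat_cond [X in _ + X]big1 ?addr0.
  rewrite -(big_mkord xpredT (fun i => a%:R^-1 *: y i)).
  rewrite big_nat_cond [RHS]big_nat_cond; apply: eq_bigr => i /andP[/andP[_ ia] _].
  by rewrite ia mul1r.
move=> i /andP[/andP[ai _] _].
by rewrite ltnNge ai mul0r scale0r.
Qed.

Lemma sum_ml_weights (V : lmodType R) (l j : nat) (y : nat -> V) :
  \sum_(i < 2 ^ j * l) ml_weight l j i *: y i =
  avg l y + 2 ^+ j *: (avg (2 ^ j * l) y - avg (2 ^ j.-1 * l) y).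
Proof.
have lj : (l <= 2 ^ j * l)%N by rewrite leq_pmull// expn_gt0.
have jj : (2 ^ j.-1 * l <= 2 ^ j * l)%N by rewrite leq_mul2r leq_exp2l// leq_pred orbT.
rewrite -(sum_indicator y lj) -(sum_indicator y (leqnn (2 ^ j * l))) -(sum_indicator y jj).
rewrite -sumrB scaler_sumr -big_split/=; apply: eq_bigr => i _.
by rewrite /ml_weight scalerDl -scalerBl scalerA.
Qed.

Lemma avg_cst k (c : R) : (0 < k)%N -> avg k (fun=> c : R^o) = c.
Proof.
move=> k0; rewrite /avg sumr_const card_ord -[c *+ k]mulr_natl -[LHS]/(k%:R^-1 * (k%:R * c)).
by rewrite mulKf// pnatr_eq0 -lt0n.
Qed.

Lemma ml_weights_sum l j : (0 < l)%N -> \sum_(w <- ml_weights l j) w = 1.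
Proof.
move=> l0; rewrite /ml_weights big_map.
have -> : iota 0 (2 ^ j * l) = index_iota 0 (2 ^ j * l) by rewrite /index_iota subn0.
rewrite big_mkord; have := @sum_ml_weights R^o l j (fun=> 1).
rewrite !avg_cst ?muln_gt0 ?expn_gt0// subrr scaler0 addr0 => <-.
by apply: eq_bigr => i _; rewrite -[RHS]/(_ * _) mulr1.
Qed.

Lemma ml_weight_le l j i : (0 < l)%N -> `|ml_weight l j i| <= 4 / l%:R.
Proof.
move=> l0; have l0R : 0 < l%:R :> R by rewrite ltr0n.
have ind (a : nat) : `|(i < a)%:R / a%:R : R| <= a%:R^-1.
  by rewrite normrM normfV !normr_nat ler_piMl ?invr_ge0 ?ler0n//; case: (_ < _)%N; rewrite ?ler01.
have E1 : 2 ^+ j * (2 ^ j * l)%:R^-1 = l%:R^-1 :> R.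
  by rewrite natrM natrX invfM mulrA mulfV ?mul1r// expf_neq0.
have E2 : 2 ^+ j * (2 ^ j.-1 * l)%:R^-1 <= 2 * l%:R^-1 :> R.
  rewrite natrM natrX invfM mulrA ler_pM2r ?invr_gt0//.
  case: j {E1} => [|j] /=; first by rewrite expr0 invr1 mulr1 ler1n.
  by rewrite exprS mulfK// expf_neq0.
rewrite /ml_weight; apply: (le_trans (ler_normD _ _)).
rewrite [X in _ + X]normrM [`|2 ^+ j|]ger0_norm ?exprn_ge0//.
apply: (@le_trans _ _ (l%:R^-1 + 2 ^+ j * ((2 ^ j * l)%:R^-1 + (2 ^ j.-1 * l)%:R^-1))).
  apply: lerD; first exact: ind.
  apply: ler_wpM2l; first exact: exprn_ge0.
  by apply: (le_trans (ler_normB _ _)); apply: lerD; exact: ind.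
rewrite mulrDr E1; lra.
Qed.

(** The law of the level: level [0] stands for a disabled correction. *)
Definition level_prob (m j : nat) : R := if j == 0%N then 2^-1 ^+ m else 2^-1 ^+ j.

Lemma level_prob_ge0 m j : 0 <= level_prob m j.
Proof. by rewrite /level_prob; case: ifP => _; rewrite exprn_ge0// invr_ge0. Qed.

Lemma level_probS (V : lmodType R) m (F : nat -> V) :
  \sum_(j < m.+1) level_prob m j *: F j =
  2^-1 ^+ m *: F 0%N + \sum_(j < m) 2^-1 ^+ j.+1 *: F j.+1.
Proof. by rewrite big_ord_recl. Qed.

Lemma level_prob_sum m : \sum_(j < m.+1) level_prob m j = 1.
Proof.
rewrite big_ord_recl /level_prob/=; elim: m => [|m IH]; first by rewrite expr0 big_ord0 addr0.
by rewrite big_ord_recr/= addrCA -[RHS]IH addrC; congr (_ + _); rewrite exprS; field.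
Qed.

(** Level j is 2^j times as long and 2^j times as rare, so each of the m.+1
    levels contributes one unit to the expected cost. *)
Lemma level_prob_pow m : \sum_(j < m.+1) level_prob m j * 2 ^+ j <= m.+1%:R.
Proof.
have h1 : level_prob m 0 * 2 ^+ 0 <= 1.
  by rewrite expr0 mulr1 /level_prob/=; apply: exprn_ile1; lra.
have h2 : \sum_(j < m) level_prob m j.+1 * 2 ^+ j.+1 = m%:R.
  rewrite (eq_bigr (fun=> 1)); first by rewrite sumr_const card_ord.
  by move=> j _; rewrite /level_prob/= -exprMn mulVf// expr1n.
by rewrite big_ord_recl/= h2 -[leRHS]natr1 [leRHS]addrC; exact: lerD.
Qed.

(** Averaging over the level telescopes: on average the estimator is the plain
    average over the longest batch. *)
Lemma ml_average (V : lmodType R) (m l : nat) (y : nat -> V) :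
  \sum_(j < m.+1) level_prob m j *:
     (avg l y + 2 ^+ j *: (avg (2 ^ j * l) y - avg (2 ^ j.-1 * l) y)) =
  avg (2 ^ m * l) y.
Proof.
rewrite (level_probS m (fun j => avg l y + 2 ^+ j *: (avg (2 ^ j * l) y - avg (2 ^ j.-1 * l) y))).
rewrite expr0 scale1r expn0 mul1n subrr addr0.
rewrite (eq_bigr (fun j : 'I_m => 2^-1 ^+ j.+1 *: avg l y +
    (avg (2 ^ j.+1 * l) y - avg (2 ^ j * l) y))); last first.
  by move=> j _; rewrite scalerDr [X in _ + X]scalerA -exprMn mulVf// expr1n scale1r.
rewrite big_split/= addrA -scaler_suml -scalerDl.
have -> : 2^-1 ^+ m + \sum_(i < m) 2^-1 ^+ i.+1 = 1 :> R.
  by rewrite -[RHS](level_prob_sum m) big_ord_recl.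
rewrite scale1r -(big_mkord xpredT (fun j => avg (2 ^ j.+1 * l) y - avg (2 ^ j * l) y)).
by rewrite (telescope_sumr (fun j => avg (2 ^ j * l) y))// expn0 mul1n addrC subrK.
Qed.

(** Each block of tau terms is a quarter of the previous one. *)
Lemma sum_mixing tau k : (0 < tau)%N ->
  \sum_(i < k) 4^-1 ^+ (i %/ tau) <= 2 * tau%:R :> R.
Proof.
move=> tau0; elim/ltn_ind: k => k IH.
have [ktau|tauk] := ltnP k tau.
  apply: (@le_trans _ _ (\sum_(i < k) 1)).
    by apply: ler_sum => i _; apply: exprn_ile1; lra.
  rewrite sumr_const card_ord; apply: (@le_trans _ _ tau%:R); first by rewrite ler_nat ltnW.
  by rewrite ler_peMl// ler1n.
have -> : \sum_(i < k) 4^-1 ^+ (i %/ tau) =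
    tau%:R + 4^-1 * \sum_(i < k - tau) 4^-1 ^+ (i %/ tau) :> R.
  rewrite -(big_mkord xpredT (fun i => 4^-1 ^+ (i %/ tau) : R)).
  rewrite (big_cat_nat (n := tau))//=; congr (_ + _).
    rewrite big_nat_cond (eq_bigr (fun=> 1)) => [|i /andP[/andP[_ it] _]].
      by rewrite -big_nat_cond sumr_const_nat subn0.
    by rewrite divn_small.
  rewrite -{1}(add0n tau) big_addn mulr_sumr.
  rewrite -(big_mkord xpredT (fun i => 4^-1 * 4^-1 ^+ (i %/ tau) : R)).
  by apply: eq_bigr => i _; rewrite divnDr ?dvdnn// divnn tau0 addn1 exprS.
have := IH (k - tau)%N; rewrite ltn_subrL tau0 (leq_trans tau0 tauk) => /(_ isT).
have : 0 <= tau%:R :> R by exact: ler0n.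
lra.
Qed.

End multilevel.

(** * The multilevel estimator inside a quadratic bound *)

Section batch_bound.
Context {R : realType} {dO : measure_display} {Om : measurableType dO}
  {P : probability Om R}.
Context {dZ : measure_display} {Z : measurableType dZ} (Q : R.-pker Z ~> Z).
Context {dE : measure_display} {E : measurableType dE} (e : nat -> {RV P >-> E}).
Context {d : measure_display} {T : measurableType d} (n : nat).
Variables (upd : R -> T * (Z * E) -> T) (Inv : T -> Prop).
Variables (S : 'I_n -> T -> R) (g : 'I_n -> R) (H : 'I_n -> Z * E -> R).
Hypothesis Inv_upd : forall w y zv, Inv y -> Inv (upd w (y, zv)).
Hypothesis S_upd : forall w y zv i, Inv y -> S i (upd w (y, zv)) = S i y + w * (g i + H i zv).
Variables (K A delta : R) (tau : nat).
Hypothesis tau0 : (0 < tau)%N.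
Hypotheses (K0 : 0 <= K) (A0 : 0 <= A) (delta0 : 0 <= delta).
Hypothesis mH : forall i, measurable_fun setT (H i).
Hypothesis HK : forall i zv, `|H i zv| <= K.
Hypothesis mean_decay : forall i s k z,
  `|Ex (kpow Q k z) (mean_field e H i s)| <= A * 4^-1 ^+ (k %/ tau) + delta.
Variables (Phi : T -> \bar R) (alpha c : R) (b : 'I_n -> R).
Hypothesis Phi0 : forall y, (0 <= Phi y)%E.
Hypothesis c0 : 0 <= c.
Hypothesis PhiB : forall y, Inv y ->
  (Phi y <= (alpha + \sum_i (b i * (S i y - g i) + c * (S i y - g i) ^+ 2))%:E)%E.

Let eta k := A * 4^-1 ^+ (k %/ tau) + delta.

Let eta_sum k : \sum_(i < k) eta i <= 2 * tau%:R * A + k%:R * delta.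
Proof.
rewrite big_split/= sumr_const card_ord -[delta *+ k]mulr_natl lerD2r -mulr_sumr mulrC.
by apply: ler_wpM2r => //; exact: sum_mixing.
Qed.

(** The terms linear in the error see only the mean, which after averaging over
    the level is that of the longest batch: this divides the mixing sum by
    2^m * l. The quadratic terms see weights of size 4 / l on 2^j * l samples,
    hence 16 * 2^j / l on level j and at most 16 * m.+1 / l <= 16 on average,
    which is why the base size l has to exceed m. *)
Lemma batch_bound m l s y (r : {measure set Z -> \bar R}) :
    Inv y -> (forall i, S i y = 0) -> r setT = 1%E -> (m < l)%N ->
  (\sum_(j <- iota 0 m.+1) (level_prob m j)%:E *
     iter_exp Q e [seq upd w | w <- ml_weights l j] s Phi y r <=
   (alpha + \sum_i `|b i| * (2 * tau%:R * A / (2 ^ m * l)%:R + delta) +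
    c * n%:R * 16 * (K ^+ 2 + 2 * K * (2 * tau%:R * A + (2 ^ m * l)%:R * delta)))%:E)%E.
Proof.
move=> Iy Sy r1 ml.
set Cm := 2 * tau%:R * A + (2 ^ m * l)%:R * delta.
have l0 : (0 < l)%N by exact: leq_ltn_trans ml.
have lR : 0 < l%:R :> R by rewrite ltr0n.
have eta0 k : 0 <= eta k by rewrite addr_ge0// mulr_ge0// exprn_ge0// invr_ge0.
have Cm0 : 0 <= Cm by rewrite addr_ge0// !mulr_ge0.
pose yk i k := lag_mean Q e H r i s k.
pose kap := K ^+ 2 + 2 * K * Cm.
have kap0 : 0 <= kap by rewrite addr_ge0 ?sqr_ge0// !mulr_ge0.
have main j : (j <= m)%N ->
  (iter_exp Q e [seq upd w | w <- ml_weights l j] s Phi y r <=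
   (alpha + \sum_i (b i * (avg l (yk i : nat -> R^o) + 2 ^+ j *: (avg (2 ^ j * l) (yk i : nat -> R^o) -
        avg (2 ^ j.-1 * l) (yk i : nat -> R^o))) +
      c * (16 / l%:R * 2 ^+ j * kap)))%:E)%E.
  move=> jm.
  have W0 : 0 <= 4 / l%:R :> R by rewrite divr_ge0.
  have wW k : `|(ml_weights l j)`_k| <= 4 / l%:R :> R.
    have [kj|kj] := ltnP k (2 ^ j * l).
      by rewrite nth_ml_weights//; exact: ml_weight_le.
    by rewrite nth_default ?size_ml_weights// normr0.
  have eC : \sum_(k < size (ml_weights (R:=R) l j)) eta k <= Cm.
    rewrite size_ml_weights; apply: (le_trans (eta_sum _)).
    by rewrite lerD2l ler_wpM2r// ler_nat leq_mul2r leq_exp2l// jm orbT.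
  have := iter_exp_bound Inv_upd S_upd K0 mH HK eta0 mean_decay Phi0 c0 PhiB s Iy r1 W0 wW eC.
  move=> /le_trans; apply; rewrite lee_fin lerD2l; apply: ler_sum => i _ /=.
  rewrite ml_weights_sum// Sy subrr mul0r addr0 add0r expr0n/= !mulr0 !mul0r !add0r.
  have -> : weighted_mean Q e H (ml_weights l j) s r i =
     avg l (yk i : nat -> R^o) + 2 ^+ j *: (avg (2 ^ j * l) (yk i : nat -> R^o) -
        avg (2 ^ j.-1 * l) (yk i : nat -> R^o)).
    rewrite -(sum_ml_weights (V := R^o)) /weighted_mean size_ml_weights; apply: eq_bigr => k _.
    by rewrite nth_ml_weights.
  rewrite lerD2l; apply: ler_wpM2l => //.
  rewrite size_ml_weights -/kap mulrA; apply: ler_wpM2r => //.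
  rewrite natrM natrX le_eqVlt; apply/orP; left; apply/eqP; field.
  by rewrite lt0r_neq0.
have -> : (alpha + \sum_i `|b i| * (2 * tau%:R * A / (2 ^ m * l)%:R + delta) +
    c * n%:R * 16 * kap) = alpha + \sum_i (`|b i| * (2 * tau%:R * A / (2 ^ m * l)%:R + delta) +
    c * 16 * kap).
  by rewrite big_split/= sumr_const card_ord -addrA -[_ *+ n]mulr_natr; congr (_ + (_ + _)); ring.
apply: (@le_trans _ _ (\sum_(j <- iota 0 m.+1) (level_prob m j)%:E *
   (alpha + \sum_i (b i * (avg l (yk i : nat -> R^o) + 2 ^+ j *: (avg (2 ^ j * l) (yk i : nat -> R^o) -
        avg (2 ^ j.-1 * l) (yk i : nat -> R^o))) +
      c * (16 / l%:R * 2 ^+ j * kap)))%:E)%E).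
  rewrite big_seq [leRHS]big_seq; apply: lee_sum => j; rewrite mem_iota add0n => /= jm.
  by apply: lee_wpmul2l; [rewrite lee_fin level_prob_ge0|exact: main].
under eq_bigr do rewrite -EFinM; rewrite sumEFin lee_fin.
have -> : iota 0 m.+1 = index_iota 0 m.+1 by rewrite /index_iota subn0.
rewrite big_mkord.
under eq_bigr do rewrite mulrDr mulr_sumr.
rewrite big_split/= -mulr_suml level_prob_sum mul1r lerD2l exchange_big/=.
apply: ler_sum => i _.
under eq_bigr do rewrite mulrDr.
rewrite big_split/=; apply: lerD.
  have -> : \sum_(j < m.+1) level_prob m j * (b i * (avg l (yk i : nat -> R^o) + 2 ^+ j *: (avg (2 ^ j * l) (yk i : nat -> R^o) - avg (2 ^ j.-1 * l) (yk i : nat -> R^o)))) =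
      b i * avg (2 ^ m * l) (yk i : nat -> R^o).
    rewrite -(ml_average m l (yk i : nat -> R^o)) mulr_sumr; apply: eq_bigr => j _.
    by rewrite mulrCA.
  apply: (le_trans (ler_norm _)); rewrite normrM; apply: ler_wpM2l => //.
  have nR : 0 < (2 ^ m * l)%:R :> R by rewrite ltr0n muln_gt0 expn_gt0.
  rewrite /avg -[_ *: _]/(_ * _) normrM gtr0_norm ?invr_gt0//.
  rewrite mulrC ler_pdivrMr// mulrDl mulfVK ?lt0r_neq0// (mulrC delta).
  apply: (le_trans (ler_norm_sum _ _ _)); apply: le_trans (eta_sum _).
  by apply: ler_sum => k _; exact: lag_mean_le.
have -> : \sum_(j < m.+1) level_prob m j * (c * (16 / l%:R * 2 ^+ j * kap)) =
    c * 16 * kap * ((\sum_(j < m.+1) level_prob m j * 2 ^+ j) / l%:R).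
  rewrite mulr_suml mulr_sumr; apply: eq_bigr => j _; ring.
rewrite -[leRHS]mulr1; apply: ler_wpM2l; first by rewrite !mulr_ge0.
rewrite ler_pdivrMr// mul1r; apply: (le_trans (level_prob_pow m)).
by rewrite ler_nat.
Qed.

End batch_bound.

(** * Borel measurability of vector-valued maps *)

Section row_vectors.
Context {R : realType} {n : nat}.
Local Notation rV := 'rV[R]_n.

Lemma continuous_borel_measurable (T : ptopologicalType) (g : T -> R) :
  continuous g -> measurable_fun setT (g : borel T -> R).
Proof.
move=> cg; apply: (measurability _ (RGenOInfty.measurableE R)) => _ [_ [x ->] <-].
rewrite setTI; apply: sub_sigma_algebra.
by move/continuousP : cg; apply; exact: interval_open.
Qed.

Lemma coord_measurable i : measurable_fun setT (fun v : borel rV => (v : rV) 0 i).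
Proof. by apply: continuous_borel_measurable; exact: coord_continuous. Qed.

Definition box (q : 'rV[rat]_n) (k : nat) : set rV :=
  [set v | forall i, `|v 0 i - ratr (q 0 i)| < k.+1%:R^-1].

Lemma open_boxes (U : set rV) : open U ->
  U = \bigcup_(qk in [set qk : 'rV[rat]_n * nat | box qk.1 qk.2 `<=` U]) box qk.1 qk.2.
Proof.
move=> oU; apply/seteqP; split=> [x Ux|x [qk /= +]]; last by apply.
have /nbhs_ballP[e /= e0 eU] : nbhs x U by exact: open_nbhs_nbhs.
have [k ke] : exists k : nat, k.+1%:R^-1 < e / 2.
  exists (Num.truncn (2 / e)).
  rewrite invf_plt ?posrE ?divr_gt0// invf_div.
  exact: truncnS_gt.
have k0 : 0 < k.+1%:R^-1 :> R by rewrite invr_gt0.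
have qx i : exists q : rat, `|x 0 i - ratr q| < k.+1%:R^-1.
  have /rat_in_itvoo[q] : x 0 i - k.+1%:R^-1 < x 0 i + k.+1%:R^-1.
    by rewrite ltrBlDr -addrA ltrDl addr_gt0.
  by rewrite inE/= => qi; exists q; rewrite distrC ltr_distl.
pose q : 'rV[rat]_n := \row_i sval (cid (qx i)).
have xq : box q k x by move=> i; rewrite mxE; case: cid.
exists (q, k) => //= y yq; apply: eU; split=> // i j; rewrite ord1 /ball/=.
have := ler_distD (ratr (q 0 j)) (x 0 j) (y 0 j).
move=> /le_lt_trans; apply; rewrite [e]splitr; apply: ltrD.
  exact: lt_trans (xq j) ke.
by rewrite distrC; exact: lt_trans (yq j) ke.
Qed.

(** Open sets are countable unions of boxes with rational centres, and the
    preimage of a box is an intersection of conditions on coordinates. *)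
Lemma measurable_rowP d (T : measurableType d) (g : T -> borel rV) :
  (forall i, measurable_fun setT (fun x => (g x : rV) 0 i)) -> measurable_fun setT g.
Proof.
move=> mg; apply: (@measurability _ _ _ _ setT g (@open rV)) => // _ [U oU <-].
rewrite setTI (open_boxes oU) preimage_bigcup bigcup_mkcond.
apply: countable_bigcupT_measurable => [|[q k]]; first exact: countableP.
case: ifP => // _.
rewrite (_ : _ @^-1` _ =
    \bigcap_(i in [set: 'I_n]) [set x | `|(g x : rV) 0 i - ratr (q 0 i)| < k.+1%:R^-1]).
  apply: fin_bigcap_measurable => // i _.
  rewrite -[X in measurable X]setTI.
  apply: (measurable_fun_ltr (f := fun x => `|(g x : rV) 0 i - ratr (q 0 i)|)
     (g := cst (k.+1%:R^-1)) _ _ measurableT) => //.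
  apply: (measurableT_comp (@normr_measurable R setT)).
  exact: measurable_funB.
by apply/seteqP; split=> x /= H i; have := H i; [move=> h _|move=> /(_ Logic.I)].
Qed.

Lemma measurable_rowD d (T : measurableType d) (f g : T -> borel rV) :
  measurable_fun setT f -> measurable_fun setT g ->
  measurable_fun setT (fun x => (f x : rV) + (g x : rV) : borel rV).
Proof.
move=> mf mg; apply: measurable_rowP => i; under eq_fun do rewrite mxE.
apply: measurable_funD; first exact: (measurableT_comp (coord_measurable i) mf).
exact: (measurableT_comp (coord_measurable i) mg).
Qed.

Lemma measurable_rowZ d (T : measurableType d) (a : T -> R) (g : T -> borel rV) :
  measurable_fun setT a -> measurable_fun setT g ->
  measurable_fun setT (fun x => a x *: (g x : rV) : borel rV).
Proof.
move=> ma mg; apply: measurable_rowP => i; under eq_fun do rewrite mxE.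
by apply: measurable_funM => //; exact: (measurableT_comp (coord_measurable i) mg).
Qed.

Lemma measurable_rowB d (T : measurableType d) (f g : T -> borel rV) :
  measurable_fun setT f -> measurable_fun setT g ->
  measurable_fun setT (fun x => (f x : rV) - (g x : rV) : borel rV).
Proof.
move=> mf mg; apply: measurable_rowP => i; under eq_fun do rewrite !mxE.
apply: measurable_funB; first exact: (measurableT_comp (coord_measurable i) mf).
exact: (measurableT_comp (coord_measurable i) mg).
Qed.

Definition grid (k : nat) (x : rV) : 'rV[int]_n := \row_i Num.floor (x 0 i * k.+1%:R).
Definition ungrid (k : nat) (q : 'rV[int]_n) : rV := \row_i ((q 0 i)%:~R / k.+1%:R).

Lemma grid_cvg (x : rV) : ungrid k (grid k x) @[k --> \oo] --> x.
Proof.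
apply/cvg_ballP => e e0; near=> k; split=> // i j; rewrite ord1 /ball/= !mxE.
have c0 : 0 < k.+1%:R :> R by [].
have /andP[f1 f2] := floor_itv (x 0 j * k.+1%:R).
apply: (@le_lt_trans _ _ k.+1%:R^-1); last first.
  by near: k; exact: (near_infty_natSinv_lt (PosNum e0)).
set fl := Num.floor _ in f1 f2 *.
have -> : x 0 j - fl%:~R / k.+1%:R = (x 0 j * k.+1%:R - fl%:~R) / k.+1%:R.
  by rewrite mulrBl mulfK// lt0r_neq0.
rewrite normrM [X in _ * X]ger0_norm ?invr_ge0// ler_piMl ?invr_ge0//.
rewrite ger0_norm ?subr_ge0// lerBlDl; apply: ltW; apply: lt_le_trans f2 _.
by rewrite intrD.
Unshelve. all: by end_near.
Qed.

(** Rounding the vector argument to a grid of mesh 1 / k.+1 leaves countably many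
    values, for which measurability in the other variable suffices; continuity
    removes the rounding in the limit. *)
Lemma caratheodory_measurable d (T : measurableType d) (F : rV -> T -> R) :
  (forall x, measurable_fun setT (F x)) -> (forall z, continuous (F^~ z)) ->
  measurable_fun setT (fun xz : borel rV * T => F xz.1 xz.2).
Proof.
move=> mF cF.
apply: (@measurable_fun_cvg _ _ _ setT
   (fun k (xz : borel rV * T) => F (ungrid k (grid k xz.1)) xz.2)); last first.
  move=> [x z] _ /=; exact: (cvg_comp _ _ (@grid_cvg x) (cF z x)).
move=> k _ A mA; rewrite setTI.
rewrite (_ : _ @^-1` A = \bigcup_(q : 'rV[int]_n)
   ([set x : rV | grid k x = q] `*` (F (ungrid k q) @^-1` A))).
  apply: countable_bigcupT_measurable => [|q]; first exact: countableP.
  apply: measurableX; last first.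
    by rewrite -[X in measurable X]setTI; exact: mF.
  rewrite (_ : [set x : rV | _] =
     \bigcap_(i in [set: 'I_n]) ((fun x : borel rV => (x : rV) 0 i) @^-1`
       [set u : R | Num.floor (u * k.+1%:R) = q 0 i])).
    apply: fin_bigcap_measurable => // i _; rewrite -[X in measurable X]setTI.
    apply: coord_measurable => //.
    have c0 : 0 < k.+1%:R :> R by [].
    rewrite (_ : [set u | _] = [set` `[(q 0 i)%:~R / k.+1%:R, (q 0 i + 1)%:~R / k.+1%:R[]).
      exact: measurable_itv.
    apply/seteqP; split=> [u /= <-|u /=].
      by rewrite in_itv/= ler_pdivrMr// ltr_pdivlMr//; exact: floor_itv.
    by rewrite in_itv/= ler_pdivrMr// ltr_pdivlMr// => /floor_def.
  apply/seteqP; split=> [x /= <- i _|x /= H]; first by rewrite mxE.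
  by apply/rowP => i; rewrite mxE; exact: H.
apply/seteqP; split=> [[x z] /= H|[x z] [q _ [/= <-]]] //.
by exists (grid k x).
Qed.

End row_vectors.

(** * Euclidean geometry and gradients *)

Section euclidean_algebra.
Context {R : realType} {d : nat}.
Implicit Types x y z u v : 'rV[R]_d.

Lemma dotpC x y : dotp x y = dotp y x.
Proof. by apply: eq_bigr => i _; rewrite mulrC. Qed.

Lemma dotpDl x y z : dotp (x + y) z = dotp x z + dotp y z.
Proof. by rewrite -big_split/=; apply: eq_bigr => i _; rewrite mxE mulrDl. Qed.

Lemma dotpZl a x z : dotp (a *: x) z = a * dotp x z.
Proof. by rewrite mulr_sumr; apply: eq_bigr => i _; rewrite mxE mulrA. Qed.

Lemma dotpNl x z : dotp (- x) z = - dotp x z.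
Proof. by rewrite -scaleN1r dotpZl mulN1r. Qed.

Lemma dotpDr x y z : dotp z (x + y) = dotp z x + dotp z y.
Proof. by rewrite !(dotpC z) dotpDl. Qed.

Lemma dotpZr a x z : dotp z (a *: x) = a * dotp z x.
Proof. by rewrite !(dotpC z) dotpZl. Qed.

Lemma dotpNr x z : dotp z (- x) = - dotp z x.
Proof. by rewrite !(dotpC z) dotpNl. Qed.

Definition dotpE := (dotpDl, dotpDr, dotpNl, dotpNr, dotpZl, dotpZr).

Lemma dotp_ge0 x : 0 <= dotp x x.
Proof. by apply: sumr_ge0 => i _; rewrite -expr2 sqr_ge0. Qed.

Lemma enorm_ge0 x : 0 <= enorm x.
Proof. exact: sqrtr_ge0. Qed.

Lemma enorm_sqr x : enorm x ^+ 2 = dotp x x.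
Proof. by rewrite sqr_sqrtr// dotp_ge0. Qed.

Lemma enormZ a x : enorm (a *: x) = `|a| * enorm x.
Proof.
by rewrite /enorm !dotpE mulrA -expr2 sqrtrM ?sqr_ge0// sqrtr_sqr.
Qed.

Lemma cauchy_schwarz x y : `|dotp x y| <= enorm x * enorm y.
Proof.
rewrite -sqrtrM ?dotp_ge0// -sqrtr_sqr ler_wsqrtr//.
have [y0|y0] := eqVneq (dotp y y) 0.
  have y_0 i : y ord0 i = 0.
    have /psumr_eq0P : \sum_i y ord0 i * y ord0 i = 0 by exact: y0.
    move=> /(_ (fun i _ => _)) H; apply/eqP; rewrite -(sqrf_eq0 (y ord0 i)) expr2 H//.
    by move=> j; rewrite -expr2 sqr_ge0.
  rewrite y0 mulr0 (_ : dotp x y = 0) ?expr0n//.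
  by apply: big1 => i _; rewrite y_0 mulr0.
have yp : 0 < dotp y y by rewrite lt_neqAle eq_sym y0 dotp_ge0.
have := dotp_ge0 (dotp y y *: x - dotp x y *: y).
rewrite !dotpE (dotpC y x); set a := dotp x x; set b := dotp x y; set c := dotp y y in yp *.
have -> : c * (c * a - b * b) + (c * - (b * b) - b * - (b * c)) = c * (a * c - b ^+ 2) by ring.
by rewrite pmulr_rge0// subr_ge0.
Qed.

Lemma dotp_young x y : `|dotp x y| <= (dotp x x + dotp y y) / 2.
Proof.
have := dotp_ge0 (x + y); have := dotp_ge0 (x - y).
rewrite !dotpE (dotpC y x) => h1 h2; rewrite ler_norml; apply/andP; split; lra.
Qed.

Lemma coord_le_enorm x i : `|x ord0 i| <= enorm x.
Proof.
rewrite /enorm -sqrtr_sqr ler_wsqrtr// /dotp (bigD1 i)//= -expr2 lerDl.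
by apply: sumr_ge0 => j _; rewrite -expr2 sqr_ge0.
Qed.

End euclidean_algebra.

Lemma second_difference_dotp {R : realType} {d : nat} (G1 G2 h : 'rV[R]_d) (a b m : R) :
  a - m = dotp G1 h -> b - m = dotp G2 (- h) -> a + b - 2 * m = dotp (G1 - G2) h.
Proof. by rewrite !dotpE => H1 H2; rewrite -H1 -H2; ring. Qed.

Section gradients.
Context {R : realType} {d : nat}.
Implicit Types (x h : 'rV[R]_d) (g : 'rV[R]_d -> R).

Lemma diff_grad g x h : differentiable g x -> 'd g x h = dotp (grad g x) h.
Proof.
move=> dg; rewrite {1}(row_sum_delta h) linear_sum/=; apply: eq_bigr => i _.
by rewrite linearZ/= mxE mulrC.
Qed.

Lemma line_derive g x h (s : R) : differentiable g (x + s *: h) ->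
  is_derive s 1 (fun s : R => g (x + s *: h)) (dotp (grad g (x + s *: h)) h).
Proof.
move=> dg; rewrite -diff_grad//.
have E : (fun t : R => t^-1 *: (((fun s : R => g (x + s *: h)) \o shift s) (t *: 1) - g (x + s *: h))) =
         (fun t : R => t^-1 *: ((g \o shift (x + s *: h)) (t *: h) - g (x + s *: h))).
  apply/funext => t /=; congr (_ *: (g _ - _)).
  by rewrite scalerDl -[t *: 1]/(t * 1) mulr1 addrCA.
have dd := diff_derivable (v := h) dg.
apply: DeriveDef.
  by rewrite /derivable E.
by rewrite /derive E -deriveE.
Qed.

Lemma line_MVT g x h : (forall y, differentiable g y) ->
  exists2 c, 0 < c < 1 & g (x + h) - g x = dotp (grad g (x + c *: h)) h.
Proof.
move=> dg.
have [] := @MVT R (fun s : R => g (x + s *: h))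
  (fun s => dotp (grad g (x + s *: h)) h) 0 1 ltr01.
- by move=> s _; exact: line_derive.
- apply: continuous_subspaceT => s.
  have := line_derive (dg (x + s *: h)) => - [/derivable1_diffP /differentiable_continuous].
  by [].
- move=> c; rewrite in_itv/= => c01; rewrite scale1r scale0r addr0 subr0 mulr1 => H.
  by exists c.
Qed.

Lemma gradB (g1 g2 : 'rV[R]_d -> R) x : differentiable g1 x -> differentiable g2 x ->
  grad (g1 - g2) x = grad g1 x - grad g2 x.
Proof. by move=> d1 d2; apply/rowP => i; rewrite !mxE diffB. Qed.

End gradients.

(* from here on gradients are only compared, never computed *)
Opaque grad.

(** * Isotropy of uniform directions *)

Section isotropy.
Context {R : realType} {n : nat}.
Local Notation rV := 'rV[R]_n.

(** The direction itself on the unit sphere and 0 elsewhere: almost surely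
    equal to a uniform direction, but bounded everywhere. *)
Definition clip (v : rV) : rV := ((dotp v v == 1)%:R : R) *: v.

Lemma enorm1E (v : rV) : (enorm v = 1) = (dotp v v = 1).
Proof.
apply/propext; split => [v1|v1]; first by rewrite -enorm_sqr v1 expr1n.
by rewrite /enorm v1 sqrtr1.
Qed.

Lemma dotp_clip v : dotp (clip v) (clip v) = (dotp v v == 1)%:R.
Proof.
rewrite !dotpE; case: eqP => [->|_]; by rewrite ?mul1r ?mul0r.
Qed.

Lemma enorm_clip_le v : enorm (clip v) <= 1.
Proof.
rewrite -[leRHS]sqrtr1 /enorm ler_wsqrtr// dotp_clip; by case: eqP.
Qed.

Lemma clip_coord_le v i : `|clip v ord0 i| <= 1.
Proof. exact: le_trans (coord_le_enorm _ i) (enorm_clip_le v). Qed.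

Lemma measurable_dotp d (T : measurableType d) (f g : T -> borel rV) :
  measurable_fun setT f -> measurable_fun setT g ->
  measurable_fun setT (fun x => dotp (f x : rV) (g x : rV)).
Proof.
move=> mf mg; apply: measurable_sum => i; apply: measurable_funM.
  exact: (measurableT_comp (coord_measurable i) mf).
exact: (measurableT_comp (coord_measurable i) mg).
Qed.

Lemma measurable_sphere : measurable ([set v | dotp v v = 1] : set (borel rV)).
Proof.
rewrite -[X in measurable X]setTI.
have := measurable_dotp (@measurable_id _ (borel rV) setT) (@measurable_id _ (borel rV) setT).
by move=> /(_ measurableT [set 1] (measurable_set1 _)).
Qed.

Lemma measurable_clip : measurable_fun setT (clip : borel rV -> borel rV).
Proof.
apply: measurable_rowZ; last exact: measurable_id.
rewrite (_ : (fun x => _) = \1_([set v | dotp v v = 1] : set (borel rV))).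
  exact: measurable_indic measurable_sphere.
apply/funext => v; rewrite indicE; congr (_ %:R); congr nat_of_bool.
by apply/eqP/idP; [move=> v1; rewrite inE|rewrite inE].
Qed.

Variable nu : probability (borel rV) R.
Hypothesis unif : uniform_on_sphere nu.

Lemma sphere_mass : nu [set v | dotp v v = 1] = 1%E.
Proof.
have [<- _] := unif; congr (nu _); apply/seteqP; split=> v /=; by rewrite enorm1E.
Qed.

Let nu1 : nu setT = 1%E. Proof. exact: (probability_setT nu). Qed.

Lemma bmeas_clip_coord i : bmeas (fun v : borel rV => clip v ord0 i).
Proof.
split; first exact: (measurableT_comp (coord_measurable i) measurable_clip).
by exists 1 => v; exact: clip_coord_le.
Qed.

Lemma dotp_orth (U : 'M[R]_n) v w : U *m U^T = 1%:M -> dotp (v *m U) (w *m U) = dotp v w.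
Proof.
move=> UU; have dE (a b : rV) : dotp a b = (a *m b^T) ord0 ord0.
  by rewrite mxE; apply: eq_bigr => i _; rewrite mxE.
by rewrite !dE trmx_mul mulmxA -(mulmxA v) UU mulmx1.
Qed.

(** Change of variables for an orthogonal map, which preserves nu. *)
Lemma Ex_orth (U : 'M[R]_n) (phi : borel rV -> R) : U *m U^T = 1%:M -> bmeas phi ->
  Ex nu (fun v => phi ((v : rV) *m U)) = Ex nu phi.
Proof.
move=> UU bphi; have [mphi [C hC]] := bphi.
have mU : measurable_fun setT (fun v : borel rV => (v : rV) *m U : borel rV).
  apply: measurable_rowP => i; under eq_fun do rewrite mxE.
  apply: measurable_sum => k; apply: measurable_funM; last exact: measurable_cst.
  exact: coord_measurable.
rewrite (Ex_shift nu1 C bphi) (Ex_shift nu1 C (bmeas_comp mU bphi)); congr (_ - _).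
rewrite /Ex; congr fine.
pose g (v : borel rV) := (phi v + C)%:E.
have mg : measurable_fun setT g by apply/measurable_EFinP; exact: measurable_funD.
have g0 v : (0 <= g v)%E.
  by rewrite lee_fin -lerBlDr sub0r; have := hC v; rewrite ler_norml => /andP[].
transitivity (\int[pushforward nu (fun v : borel rV => (v : rV) *m U : borel rV)]_x g x)%E.
  by rewrite ge0_integral_pushforward.
apply: eq_measure_integral => A mA _.
by have [_ /(_ U A UU mA)] := unif.
Qed.

Lemma clip_orth (U : 'M[R]_n) v : U *m U^T = 1%:M -> clip (v *m U) = clip v *m U.
Proof. by move=> UU; rewrite /clip dotp_orth// scalemxAl. Qed.

(** Changing the sign of one coordinate kills the off-diagonal moments,
    exchanging two coordinates makes the diagonal ones equal, and these add up
    to 1. *)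
Lemma sphere_isotropy (i k : 'I_n) :
  n%:R * Ex nu (fun v => clip v ord0 i * clip v ord0 k) = (i == k)%:R.
Proof.
have bc i' k' : bmeas (fun v : borel rV => clip v ord0 i' * clip v ord0 k').
  by apply: bmeasM; exact: bmeas_clip_coord.
have [<-|ik] := eqVneq i k; last first.
  pose D : 'rV[R]_n := \row_j (if j == i then -1 else 1).
  have DD : diag_mx D *m (diag_mx D)^T = 1%:M.
    rewrite tr_diag_mx mulmx_diag; apply/matrixP => a b; rewrite !mxE.
    by case: (a == i); rewrite ?mulrNN ?mulr1.
  have := Ex_orth DD (bc i k).
  have -> : (fun v : borel rV => clip ((v : rV) *m diag_mx D) ord0 i * clip ((v : rV) *m diag_mx D) ord0 k) =
      (fun v : borel rV => -1 * (clip v ord0 i * clip v ord0 k)).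
    apply/funext => v; rewrite clip_orth// !mul_mx_diag !mxE eqxx [k == i]eq_sym (negPf ik); ring.
  rewrite ExZ// => H; have -> : Ex nu (fun v => clip v ord0 i * clip v ord0 k) = 0 by lra.
  by rewrite mulr0.
have same j : Ex nu (fun v => clip v ord0 j * clip v ord0 j) = Ex nu (fun v => clip v ord0 i * clip v ord0 i).
  have TT : tperm_mx i j *m (tperm_mx i j)^T = 1%:M :> 'M[R]_n.
    by rewrite tr_tperm_mx -perm_mxM perm.tperm2 perm_mx1.
  rewrite -(Ex_orth TT (bc i i)); congr Ex; apply/funext => v.
  rewrite clip_orth// -xcolE; congr (_ * _); by rewrite !mxE perm.tpermL.
have : Ex nu (fun v => \sum_(j < n) clip v ord0 j * clip v ord0 j) = 1.
  rewrite (_ : (fun v => _) = (fun v => \1_([set v | dotp v v = 1] : set (borel rV)) v)).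
    rewrite /Ex integral_indic ?setIT//; last exact: measurable_sphere.
    by rewrite -[RHS]/(fine 1%E); congr fine; exact: sphere_mass.
  apply/funext => v; rewrite -[LHS]/(dotp (clip v) (clip v)) dotp_clip indicE.
  congr (_ %:R); congr nat_of_bool.
  by apply/eqP/idP; [move=> v1; rewrite inE|rewrite inE].
rewrite (Ex_sum nu1)// => H.
rewrite -[RHS]H (eq_bigr (fun=> Ex nu (fun v => clip v ord0 i * clip v ord0 i))) => [|j _]; last exact: same.
by rewrite sumr_const card_ord mulr_natl.
Qed.

End isotropy.

(** * Coefficients of the accelerated scheme *)

Section coefficients.
Context {R : realType}.
Variables (mu gamma p a : R).
Hypotheses (mu0 : 0 < mu) (gamma0 : 0 < gamma) (a0 : 0 < a) (a2 : a ^+ 2 = mu * gamma / 3).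
Hypotheses (ah : a <= 2^-1) (p0 : 0 < p) (p1 : p <= 1).

Lemma betaE : Defs.beta mu gamma p = 2 * p * a.
Proof.
rewrite /Defs.beta (_ : 4 * p ^+ 2 * mu * gamma / 3 = (2 * p * a) ^+ 2).
  by rewrite sqrtr_sqr ger0_norm// !mulr_ge0// ltW.
by rewrite exprMn a2; field.
Qed.

Lemma etaE : Defs.eta mu gamma = a^-1.
Proof.
rewrite /Defs.eta (_ : 3 / (mu * gamma) = a^-1 ^+ 2).
  by rewrite sqrtr_sqr ger0_norm// invr_ge0 ltW.
by rewrite exprVn a2; field; rewrite !lt0r_neq0.
Qed.

(** The weight of x in the query point, x_g = xf + mix * (x - xf). *)
Definition mix := 1 - Defs.theta mu gamma p.
(** The new iterate is x - drift * (x - xf) up to the gradient term. The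
    contraction argument calls for mix = p a and drift = 2 p a; the lemmas below
    show that the actual values differ from these by O(p^2), which is harmless. *)
Definition drift := p - mix / a + (1 - p) * (2 * p * a) * (1 - mix).

Lemma pa_gt0 : 0 < p * a. Proof. exact: mulr_gt0. Qed.
Lemma pa_half : p * a <= 2^-1.
Proof. by rewrite -[leRHS]mul1r; apply: ler_pM => //; exact: ltW. Qed.
Lemma den_half : 2^-1 <= 1 - 2 * (p * a) ^+ 2.
Proof.
have pa0 := pa_gt0; have pah := pa_half.
have : (p * a) ^+ 2 <= 2^-1 ^+ 2 by rewrite lerXn2r// ?nnegrE ?invr_ge0// ltW.
by rewrite (_ : 2^-1 ^+ 2 = 4^-1 :> R); [lra|field].
Qed.

Lemma mixE : mix = p * a * (1 - 2 * (p * a)) / (1 - 2 * (p * a) ^+ 2).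
Proof.
have den := den_half.
rewrite /mix /Defs.theta betaE etaE invrK.
have d1 : 1 - 2 * (p * a) ^+ 2 != 0 by apply: lt0r_neq0; apply: lt_le_trans den.
have d2 : 2 * p * a * p * a - 1 != 0.
  apply: contra d1 => /eqP H; rewrite subr_eq0 eq_sym -subr_eq0; apply/eqP; rewrite -H; ring.
by field; rewrite d2 d1.
Qed.

Lemma den_inv : 0 < (1 - 2 * (p * a) ^+ 2)^-1 <= 2.
Proof.
have den := den_half.
have dp : 0 < 1 - 2 * (p * a) ^+ 2 by apply: lt_le_trans den.
rewrite invr_gt0 dp/= -[leRHS]invrK lef_pV2 ?posrE//.
Qed.

Lemma mix_ge0 : 0 <= mix.
Proof.
have pa0 := pa_gt0; have pah := pa_half; have dinv := den_inv.
rewrite mixE; case/andP: dinv => d1 _; apply: mulr_ge0; last exact: ltW.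
by apply: mulr_ge0; [exact: ltW|lra].
Qed.

Lemma mix_near : `|mix - p * a| <= p ^+ 2.
Proof.
have pa0 := pa_gt0; have pah := pa_half; have den := den_half; have dinv := den_inv.
rewrite mixE; set D := _^-1 in dinv *; case/andP: dinv => d1 d2.
have DD : D * (1 - 2 * (p * a) ^+ 2) = 1.
  by rewrite /D mulVf// lt0r_neq0//; apply: lt_le_trans den.
have -> : p * a * (1 - 2 * (p * a)) * D - p * a = - ((p * a) ^+ 2 * (2 * (1 - p * a) * D)).
  transitivity (p * a * (1 - 2 * (p * a)) * D - p * a * (D * (1 - 2 * (p * a) ^+ 2))).
    by rewrite DD mulr1.
  ring.
rewrite normrN ger0_norm; last first.
  by apply: mulr_ge0; [exact: sqr_ge0|apply: mulr_ge0; [lra|exact: ltW]].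
have -> : (p * a) ^+ 2 * (2 * (1 - p * a) * D) = p ^+ 2 * (a ^+ 2 * (2 * (1 - p * a) * D)) by ring.
rewrite -[leRHS]mulr1; apply: (ler_wpM2l (sqr_ge0 p)).
have q : a ^+ 2 <= 4^-1.
  have : a ^+ 2 <= 2^-1 ^+ 2 by rewrite lerXn2r// ?nnegrE ?invr_ge0// ltW.
  by rewrite (_ : 2^-1 ^+ 2 = 4^-1 :> R); [lra|field].
have q2 : 2 * (1 - p * a) * D <= 4.
  have : (1 - p * a) * D <= 1 * 2 by apply: ler_pM => //; [lra|exact: ltW|lra].
  lra.
apply: (@le_trans _ _ (4^-1 * 4)); last lra.
apply: ler_pM => //; first exact: sqr_ge0.
by apply: mulr_ge0; [lra|exact: ltW].
Qed.

Lemma mix_le : mix <= 2 * p.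
Proof.
have pa0 := pa_gt0; have pah := pa_half.
have := mix_near; rewrite ler_norml => /andP[_].
have : p ^+ 2 <= p by rewrite expr2 -[leRHS]mulr1 ler_pM2l.
have h2 : p * a <= p * 2^-1 by rewrite ler_pM2l.
have h3 := p0; lra.
Qed.

Lemma mix_le1 : mix <= 1.
Proof.
have pa0 := pa_gt0; have pah := pa_half; have dinv := den_inv.
rewrite mixE; case/andP: dinv => d1 d2; rewrite -[leRHS]mulr1.
have -> : p * a * (1 - 2 * (p * a)) * (1 - 2 * (p * a) ^+ 2)^-1 =
  (p * a) * ((1 - 2 * (p * a)) * (1 - 2 * (p * a) ^+ 2)^-1) by ring.
apply: (@le_trans _ _ (2^-1 * (1 * 2))); last lra.
apply: ler_pM => //; first exact: ltW.
  by apply: mulr_ge0; [lra|exact: ltW].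
by apply: ler_pM => //; [lra|exact: ltW|lra].
Qed.

Lemma drift_near : `|drift - 2 * p * a| <= 6 * p ^+ 2.
Proof.
have pa0 := pa_gt0; have pah := pa_half; have den := den_half; have dinv := den_inv.
have h1 : `|p - mix / a| <= 2 * p ^+ 2.
  rewrite mixE; set D := _^-1 in dinv *; case/andP: dinv => d1 d2.
  have DD : D * (1 - 2 * (p * a) ^+ 2) = 1.
    by rewrite /D mulVf// lt0r_neq0//; apply: lt_le_trans den.
  have -> : p - p * a * (1 - 2 * (p * a)) * D / a = p ^+ 2 * (2 * a * ((1 - p * a) * D)).
    transitivity (p * (D * (1 - 2 * (p * a) ^+ 2)) - p * (1 - 2 * (p * a)) * D).
      by rewrite DD mulr1; congr (_ - _); field; rewrite lt0r_neq0.
    ring.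
  rewrite normrM ger0_norm ?sqr_ge0// mulrC; apply: ler_wpM2r; first exact: sqr_ge0.
  rewrite ger0_norm; last by rewrite !mulr_ge0//; [exact: ltW|lra|exact: ltW].
  have : a * ((1 - p * a) * D) <= 2^-1 * (1 * 2).
    apply: ler_pM => //; [exact: ltW|by rewrite mulr_ge0//; [lra|exact: ltW]|].
    by apply: ler_pM => //; [lra|exact: ltW|lra].
  lra.
have -> : drift - 2 * p * a = (p - mix / a) - (2 * a) * (p * (p + mix - p * mix)).
  by rewrite /drift; ring.
apply: (le_trans (ler_normB _ _)).
have h2 : `|2 * a * (p * (p + mix - p * mix))| <= 4 * p ^+ 2.
  have m0 := mix_ge0; have m1 := mix_le; have m2 := mix_le1.
  have q0 : 0 <= p + mix - p * mix by have := mulr_ge0 (ltW p0) m0; nra.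
  have q1 : p + mix - p * mix <= 3 * p by have := mulr_ge0 (ltW p0) m0; lra.
  rewrite ger0_norm; last by rewrite !mulr_ge0// ltW.
  apply: (@le_trans _ _ (1 * (p * (3 * p)))).
    have h2a : 2 * a <= 1 by have := ah; lra.
    apply: ler_pM; [by rewrite mulr_ge0// ltW|by rewrite mulr_ge0// ltW|exact: h2a|].
    by rewrite ler_pM2l.
  have := sqr_ge0 p; rewrite expr2; lra.
lra.
Qed.

End coefficients.

(** * Smoothness and convexity of the objective *)

Section objective.
Context {R : realType} {d : nat} {dZ : measure_display} {Z : measurableType dZ}.
Variables (pi : probability Z R) (F : 'rV[R]_d -> Z -> R) (f : 'rV[R]_d -> R).
Variables (L mu sigma : R) (xstar : 'rV[R]_d).
Hypothesis Fint : forall x, pi.-integrable setT (EFin \o F x).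
Hypothesis Fmean : forall x, ('E_pi[F x] = (f x)%:E)%E.
Hypothesis L0 : 0 < L.
Hypothesis Fdiff : forall x z, differentiable (F^~ z) x.
Hypothesis Flip : forall x y z,
  enorm (grad (F^~ z) x - grad (F^~ z) y) <= L * enorm (x - y).
Hypothesis fdiff : forall x, differentiable f x.
Hypothesis mu0 : 0 < mu.
Hypothesis fconv : forall x y,
  mu / 2 * enorm (x - y) ^+ 2 <= f x - f y - dotp (grad f y) (x - y).
Hypothesis noise : forall x z, enorm (grad (F^~ z) x - grad f x) ^+ 2 <= sigma ^+ 2.
Hypothesis xmin : forall x, f xstar <= f x.

(** Second differences of F are bounded by the Lipschitz constant of the
    gradient and can be averaged over pi without differentiating under the
    integral sign. *)
Lemma F_second_difference x h z :
  F (x + h) z + F (x - h) z - 2 * F x z <= 2 * L * dotp h h.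
Proof.
have [c /andP[c0 c1] Hc] := line_MVT x h (Fdiff^~ z).
have [c' /andP[c'0 c'1] Hc'] := line_MVT x (- h) (Fdiff^~ z).
have -> : F (x + h) z + F (x - h) z - 2 * F x z =
    dotp (grad (F^~ z) (x + c *: h) - grad (F^~ z) (x + c' *: - h)) h.
  exact: (second_difference_dotp Hc Hc').
apply: (le_trans (ler_norm _)); apply: (le_trans (cauchy_schwarz _ _)).
rewrite -enorm_sqr expr2 mulrA; apply: ler_wpM2r; first exact: enorm_ge0.
apply: (le_trans (Flip _ _ _)).
have -> : x + c *: h - (x + c' *: - h) = (c + c') *: h.
  by rewrite scalerN opprD opprK addrACA subrr add0r scalerDl.
rewrite enormZ mulrA; apply: ler_wpM2r; first exact: enorm_ge0.
rewrite mulrC; apply: ler_wpM2r; first exact: ltW.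
by rewrite gtr0_norm; lra.
Qed.

Lemma f_second_difference x h :
  f (x + h) + f (x - h) - 2 * f x <= 2 * L * dotp h h.
Proof.
have fE y : f y = \int[pi]_z F y z.
  by have := Fmean y; rewrite unlock /Rintegral => ->.
have P1 := probability_setT pi.
have i1 y : pi.-integrable setT (EFin \o F y) by [].
have i2 : pi.-integrable setT (EFin \o (fun z => F (x + h) z + F (x - h) z)).
  exact: (integrableD measurableT (i1 _) (i1 _)).
have i3 : pi.-integrable setT (EFin \o (fun z => - 2 * F x z)).
  exact: (integrableZl measurableT (-2) (i1 x)).
have i4 : pi.-integrable setT (EFin \o (fun z => F (x + h) z + F (x - h) z + - 2 * F x z)).
  exact: (integrableD measurableT i2 i3).
have -> : f (x + h) + f (x - h) - 2 * f x =
    \int[pi]_z (F (x + h) z + F (x - h) z + - 2 * F x z).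
  by rewrite RintegralD// RintegralD// RintegralZl// -!fE; ring.
have -> : 2 * L * dotp h h = \int[pi]_z (2 * L * dotp h h).
  by rewrite Rintegral_cst//= P1 mulr1.
apply: le_Rintegral => //.
  by apply: (bmeas_integrable P1); exact: bmeas_cst.
by move=> z _; have := F_second_difference x h z; rewrite mulNr.
Qed.

Lemma f_convex x h : dotp (grad f x) h <= f (x + h) - f x.
Proof.
have := fconv (x + h) x; rewrite (addrC x) addrK.
have : 0 <= mu / 2 * enorm h ^+ 2 by rewrite mulr_ge0 ?divr_ge0 ?sqr_ge0// ltW.
lra.
Qed.

(** The second difference controls f from above once convexity controls f (x - h)
    from below; this costs a factor 2 in the constant. *)
Lemma f_smooth x h : f (x + h) <= f x + dotp (grad f x) h + 2 * L * dotp h h.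
Proof.
have := f_second_difference x h; have := f_convex x (- h); rewrite dotpNr; lra.
Qed.

(** A gradient step of length 1 / (4 L) cannot go below the minimum. *)
Lemma grad_sqr_le x : dotp (grad f x) (grad f x) <= 8 * L * (f x - f xstar).
Proof.
have := xmin (x + (- (4 * L)^-1) *: grad f x).
have := f_smooth x ((- (4 * L)^-1) *: grad f x).
rewrite !dotpZr dotpZl; set n := dotp _ _ => h1 h2.
have {h1 h2} := le_trans h2 h1.
have -> : f x + - (4 * L)^-1 * n + 2 * L * (- (4 * L)^-1 * (- (4 * L)^-1 * n)) = f x - n / (8 * L).
  by field; rewrite lt0r_neq0.
move=> h; rewrite mulrC -ler_pdivrMr ?mulr_gt0//; lra.
Qed.

Lemma grad_xstar h : dotp (grad f xstar) h = 0.
Proof.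
have g0 : dotp (grad f xstar) (grad f xstar) = 0.
  apply/eqP; rewrite eq_le dotp_ge0 andbT.
  by have := grad_sqr_le xstar; rewrite subrr mulr0.
apply/eqP; rewrite -normr_le0; apply: (le_trans (cauchy_schwarz _ _)).
by rewrite /enorm g0 sqrtr0 mul0r.
Qed.

Lemma f_gap_le x : f x - f xstar <= 2 * L * dotp (x - xstar) (x - xstar).
Proof.
have := f_smooth xstar (x - xstar); rewrite grad_xstar addrC subrK; lra.
Qed.

Lemma f_gap_ge x : mu / 2 * dotp (x - xstar) (x - xstar) <= f x - f xstar.
Proof. by have := fconv x xstar; rewrite grad_xstar enorm_sqr subr0. Qed.

Lemma f_finite_difference x v (t : R) : 0 < t ->
  `|(f (x + t *: v) - f (x - t *: v)) / (2 * t) - dotp (grad f x) v| <= L * t * dotp v v.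
Proof.
move=> t0.
have := f_convex x (t *: v); have := f_smooth x (t *: v).
have := f_convex x (- (t *: v)); have := f_smooth x (- (t *: v)).
rewrite !dotpE => h1 h2 h3 h4.
have -> : (f (x + t *: v) - f (x - t *: v)) / (2 * t) - dotp (grad f x) v =
   ((f (x + t *: v) - f (x - t *: v)) - 2 * t * dotp (grad f x) v) / (2 * t).
  by field; rewrite lt0r_neq0.
rewrite normrM [X in _ * X]gtr0_norm ?invr_gt0 ?mulr_gt0// ler_pdivrMr ?mulr_gt0//.
have -> : L * t * dotp v v * (2 * t) = 2 * L * (t * (t * dotp v v)) by ring.
rewrite ler_norml; apply/andP; split; lra.
Qed.

Definition noise_difference x (t : R) v z :=
  ((F (x + t *: v) z - F (x - t *: v) z) - (f (x + t *: v) - f (x - t *: v))) / (2 * t).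

(** The mean value theorem for F - f, whose gradient is at most sigma in norm. *)
Lemma noise_difference_le x (t : R) v z : 0 < t ->
  `|noise_difference x t v z| <= `|sigma| * enorm v.
Proof.
move=> t0; pose G : 'rV[R]_d -> R := F^~ z - f.
have dG y : differentiable G y by exact: differentiableB.
have [c _] := line_MVT (x - t *: v) ((2 * t) *: v) dG.
have -> : x - t *: v + (2 * t) *: v = x + t *: v.
  by rewrite -addrA -scaleNr -scalerDl; congr (_ + _ *: _); ring.
set y := _ + c *: _ => H.
have -> : noise_difference x t v z = dotp (grad G y) v.
  rewrite /noise_difference.
  have -> : F (x + t *: v) z - F (x - t *: v) z - (f (x + t *: v) - f (x - t *: v)) =
     G (x + t *: v) - G (x - t *: v) by rewrite /G !fctE; ring.
  by rewrite H dotpZr mulrC mulKf// lt0r_neq0// mulr_gt0.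
apply: (le_trans (cauchy_schwarz _ _)); apply: ler_wpM2r; first exact: enorm_ge0.
rewrite gradB// -(ger0_norm (enorm_ge0 _)) -ler_sqr ?nnegrE// !real_normK ?num_real//.
Qed.

(** * The two-point estimator *)

Section estimator.
Variables (Q : R.-pker Z ~> Z) (tau : nat) (t : R).
Hypothesis t0 : 0 < t.
Hypothesis invpi : invariant_measure Q pi.
Hypothesis ergQ : uniformly_geometrically_ergodic Q tau.
Local Notation rV := 'rV[R]_d.

Lemma F_measurable : measurable_fun setT (fun xz : borel rV * Z => F xz.1 xz.2).
Proof.
apply: caratheodory_measurable => [x|z x].
  by have /measurable_int/measurable_EFinP := Fint x.
exact: differentiable_continuous.
Qed.

Lemma f_measurable : measurable_fun setT (f : borel rV -> R).
Proof. by apply: continuous_borel_measurable => x; exact: differentiable_continuous. Qed.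

Definition estimate (x : rV) (z : Z) (v : rV) : rV :=
  (d%:R * ((F (x + t *: v) z - F (x - t *: v) z) / (2 * t))) *: v.

Lemma measurable_estimate dT (T : measurableType dT) (x v : T -> borel rV) (z : T -> Z) :
  measurable_fun setT x -> measurable_fun setT z -> measurable_fun setT v ->
  measurable_fun setT (fun w => estimate (x w) (z w) (v w) : borel rV).
Proof.
move=> mx mz mv; apply: measurable_rowZ => //.
apply: measurable_funM; first exact: measurable_cst.
apply: measurable_funM; last exact: measurable_cst.
have mtv : measurable_fun setT (fun w => t *: (v w : rV) : borel rV).
  by apply: measurable_rowZ => //; exact: measurable_cst.
have mF (y : T -> borel rV) : measurable_fun setT y -> measurable_fun setT (fun w => F (y w) (z w)).
  move=> my; apply: (measurableT_comp F_measurable (g := fun w => (y w, z w))).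
  exact: measurable_fun_pair.
apply: measurable_funB; apply: mF; first exact: measurable_rowD.
exact: measurable_rowB.
Qed.

Section at_a_point.
Variable x : rV.

Definition centred (i : 'I_d) (zv : Z * borel rV) : R :=
  estimate x zv.1 (clip zv.2) ord0 i - grad f x ord0 i.

Definition fd (v : rV) := (f (x + t *: v) - f (x - t *: v)) / (2 * t).

(** The error splits into a term linear in the gradient, of mean 0 by isotropy, a
    smoothing bias of order t that does not depend on z, and the noise of the
    chain. Only the last one is correlated in time. *)
Lemma centredE i z v : centred i (z, v) =
  d%:R * (dotp (grad f x) (clip v) * clip v ord0 i) - grad f x ord0 i
  + d%:R * ((fd (clip v) - dotp (grad f x) (clip v)) * clip v ord0 i)
  + d%:R * (noise_difference x t (clip v) z * clip v ord0 i).
Proof.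
rewrite /centred /estimate mxE /noise_difference /fd /=.
by field; rewrite lt0r_neq0.
Qed.

Lemma fd_bias v : `|fd (clip v) - dotp (grad f x) (clip v)| <= L * t.
Proof.
have h1 := f_finite_difference x (clip v) t0.
apply: (le_trans h1); apply: ler_piMr; first by apply: mulr_ge0; exact: ltW.
by rewrite dotp_clip; case: eqP.
Qed.

Lemma noise_clip v z : `|noise_difference x t (clip v) z| <= `|sigma|.
Proof.
apply: (le_trans (noise_difference_le x (clip v) z t0)).
by rewrite ler_piMr// enorm_clip_le.
Qed.

Definition estimator_range : R :=
  d.+1%:R * enorm (grad f x) + d%:R * (L * t) + d%:R * `|sigma|.

Lemma estimator_range_ge0 : 0 <= estimator_range.
Proof.
by apply: addr_ge0; [apply: addr_ge0|]; apply: mulr_ge0 => //;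
  [exact: enorm_ge0|apply: mulr_ge0; exact: ltW].
Qed.

Lemma centred_le i zv : `|centred i zv| <= estimator_range.
Proof.
case: zv => z v; rewrite centredE.
have c1 : `|clip v ord0 i| <= 1 by exact: clip_coord_le.
have b1 (a C : R) : `|a| <= C -> `|d%:R * (a * clip v ord0 i)| <= d%:R * C.
  move=> aC; rewrite normrM normr_nat; apply: ler_wpM2l => //.
  by rewrite normrM -[leRHS]mulr1; apply: ler_pM.
have gd : `|dotp (grad f x) (clip v)| <= enorm (grad f x).
  apply: (le_trans (cauchy_schwarz _ _)); rewrite ler_piMr ?enorm_ge0//.
  exact: enorm_clip_le.
have := b1 _ _ gd; have := b1 _ _ (fd_bias v); have := b1 _ _ (noise_clip v z).
have := coord_le_enorm (grad f x) i.
set a0 := grad f x ord0 i; set a1 := d%:R * _; set a2 := d%:R * _; set a3 := d%:R * _.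
set N := enorm _; move=> h0 h1 h2 h3.
have -> : estimator_range = d%:R * N + N + d%:R * (L * t) + d%:R * `|sigma|.
  by rewrite /estimator_range -natr1 mulrDl mul1r.
apply: (le_trans (ler_normD _ _)); apply: lerD => //.
apply: (le_trans (ler_normD _ _)); apply: lerD => //.
by apply: (le_trans (ler_normB _ _)); apply: lerD.
Qed.

Lemma centred_measurable i : measurable_fun setT (centred i).
Proof.
apply: measurable_funB; last exact: measurable_cst.
apply: (measurableT_comp (coord_measurable i)).
apply: (measurable_estimate (x := cst x)) => //.
exact: (measurableT_comp measurable_clip measurable_snd).
Qed.

Section mean_field.
Variable nu : probability (borel rV) R.
Hypothesis unif : uniform_on_sphere nu.

Let nu1 : nu setT = 1%E. Proof. exact: (probability_setT nu). Qed.
Let pi1 : pi setT = 1%E. Proof. exact: (probability_setT pi). Qed.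

Definition noise_part i (zv : Z * borel rV) : R :=
  d%:R * (noise_difference x t (clip zv.2) zv.1 * clip zv.2 ord0 i).

Let mclip2 : measurable_fun setT (fun zv : Z * borel rV => clip zv.2 : borel rV).
Proof. exact: (measurableT_comp measurable_clip measurable_snd). Qed.

Lemma noise_part_bmeas i : bmeas (noise_part i).
Proof.
split; last first.
  exists (d%:R * `|sigma|) => -[z v]; rewrite /noise_part normrM normr_nat.
  apply: ler_wpM2l => //; rewrite normrM -[leRHS]mulr1; apply: ler_pM => //.
    exact: noise_clip.
  exact: clip_coord_le.
have mtv : measurable_fun setT (fun zv : Z * borel rV => t *: clip zv.2 : borel rV).
  by apply: measurable_rowZ => //; exact: measurable_cst.
have mp : measurable_fun setT (fun zv : Z * borel rV => x + t *: clip zv.2 : borel rV).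
  by apply: (measurable_rowD (f := cst x)) => //; exact: measurable_cst.
have mm : measurable_fun setT (fun zv : Z * borel rV => x - t *: clip zv.2 : borel rV).
  by apply: (measurable_rowB (f := cst x)) => //; exact: measurable_cst.
have mF (y : Z * borel rV -> borel rV) : measurable_fun setT y ->
    measurable_fun setT (fun zv => F (y zv) zv.1).
  move=> my; apply: (measurableT_comp F_measurable (g := fun zv => (y zv, zv.1))).
  exact: measurable_fun_pair.
apply: measurable_funM; first exact: measurable_cst.
apply: measurable_funM; last exact: (measurableT_comp (coord_measurable i) mclip2).
apply: measurable_funM; last exact: measurable_cst.
apply: measurable_funB; apply: measurable_funB.
- exact: mF mp.
- exact: mF mm.
- exact: (measurableT_comp f_measurable mp).
- exact: (measurableT_comp f_measurable mm).
Qed.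

Lemma noise_part_centred i v : Ex pi (fun z => noise_part i (z, v)) = 0.
Proof.
have fE y : f y = \int[pi]_z F y z.
  by have := Fmean y; rewrite unlock /Rintegral => ->.
have i1 y : pi.-integrable setT (EFin \o F y) by [].
set c := clip v.
have -> : (fun z => noise_part i (z, v)) =
    (fun z => d%:R * c ord0 i / (2 * t) * ((F (x + t *: c) z - F (x - t *: c) z) -
              (f (x + t *: c) - f (x - t *: c)))).
  by apply/funext => z; rewrite /noise_part /noise_difference /= -/c; field; rewrite lt0r_neq0.
have i2 : pi.-integrable setT (EFin \o (fun z => F (x + t *: c) z - F (x - t *: c) z)).
  exact: (integrableB measurableT (i1 _) (i1 _)).
have i3 : pi.-integrable setT (EFin \o (fun _ : Z => f (x + t *: c) - f (x - t *: c))).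
  by apply: (bmeas_integrable pi1); exact: bmeas_cst.
rewrite [LHS]RintegralZl//; last exact: (integrableB measurableT i2 i3).
rewrite RintegralB// RintegralB// -!fE.
by rewrite [X in _ - X](Ex_cst pi1) subrr mulr0.
Qed.

Lemma linear_part_mean i :
  Ex nu (fun v => d%:R * (dotp (grad f x) (clip v) * clip v ord0 i)) = grad f x ord0 i.
Proof.
have bc k : bmeas (fun v : borel rV => clip v ord0 k * clip v ord0 i).
  by apply: bmeasM; exact: bmeas_clip_coord.
have -> : (fun v : borel rV => d%:R * (dotp (grad f x) (clip v) * clip v ord0 i)) =
    (fun v => \sum_k (grad f x ord0 k * d%:R) * (clip v ord0 k * clip v ord0 i)).
  by apply/funext => v; rewrite mulr_suml mulr_sumr; apply: eq_bigr => k _; ring.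
rewrite (Ex_sum nu1); last by move=> k; exact: bmeasZ.
rewrite (bigD1 i)//= big1 ?addr0 => [|k ki]; rewrite (ExZ nu1)// -mulrA sphere_isotropy//.
  by rewrite eqxx mulr1.
by rewrite (negPf ki) mulr0.
Qed.

(** After averaging over the direction only the smoothing bias and the noise
    remain, and the noise is bounded by d sigma and centred under pi, uniformly
    in t. *)
Lemma mean_field_decay i k z :
  `|Ex (kpow Q k z) (fun z => Ex nu (fun v => centred i (z, v)))| <=
  4 * (d%:R * `|sigma|) * 4^-1 ^+ (k %/ tau) + d%:R * (L * t).
Proof.
have bN := noise_part_bmeas i.
have bN1 z' : bmeas (fun v => noise_part i (z', v)).
  exact: (bmeas_comp (pair1_measurable z') bN).
have bl : bmeas (fun v : borel rV => d%:R * (dotp (grad f x) (clip v) * clip v ord0 i)).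
  apply: bmeasZ; apply: bmeasM; last exact: bmeas_clip_coord.
  by apply: bmeas_sum => j; apply: bmeasZ; exact: bmeas_clip_coord.
have bb : bmeas (fun v : borel rV => d%:R * ((fd (clip v) - dotp (grad f x) (clip v)) * clip v ord0 i)).
  apply: bmeasZ; apply: bmeasM; last exact: bmeas_clip_coord.
  split; last by exists (L * t) => v; exact: fd_bias.
  have mtv : measurable_fun setT (fun v : borel rV => t *: clip v : borel rV).
    by apply: measurable_rowZ; [exact: measurable_cst|exact: measurable_clip].
  apply: measurable_funB.
    apply: measurable_funM; last exact: measurable_cst.
    apply: measurable_funB; apply: (measurableT_comp f_measurable).
      by apply: (measurable_rowD (f := cst x)) => //; exact: measurable_cst.
    by apply: (measurable_rowB (f := cst x)) => //; exact: measurable_cst.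
  by apply: (measurable_dotp (f := cst (grad f x))) => //; exact: measurable_clip.
pose r := Ex nu (fun v : borel rV => d%:R * ((fd (clip v) - dotp (grad f x) (clip v)) * clip v ord0 i)).
pose h0 z := Ex nu (fun v => noise_part i (z, v)).
have bh0 : bmeas h0 by exact: bmeas_Ex_cst.
have -> : (fun z => Ex nu (fun v => centred i (z, v))) = (fun z => r + h0 z).
  apply/funext => z'.
  have -> : (fun v => centred i (z', v)) = (fun v =>
    (d%:R * (dotp (grad f x) (clip v) * clip v ord0 i) + - grad f x ord0 i
    + d%:R * ((fd (clip v) - dotp (grad f x) (clip v)) * clip v ord0 i)) + noise_part i (z', v)).
    by apply/funext => v; rewrite centredE.
  rewrite (ExD nu1)//; last by apply: bmeasD => //; apply: bmeasD => //; exact: bmeas_cst.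
  rewrite (ExD nu1)//; last by apply: bmeasD => //; exact: bmeas_cst.
  rewrite (ExD nu1)//; last exact: bmeas_cst.
  by rewrite linear_part_mean (Ex_cst nu1) subrr add0r.
have dL0 : 0 <= d%:R * `|sigma| by rewrite mulr_ge0.
rewrite (ExD (kpow1 _ _ _))//; last exact: bmeas_cst.
rewrite (Ex_cst (kpow1 _ _ _)) addrC; apply: (le_trans (ler_normD _ _)); apply: lerD; last first.
  apply: (Ex_abs_le nu1) => // v; rewrite normrM normr_nat; apply: ler_wpM2l => //.
  rewrite normrM -[leRHS]mulr1; apply: ler_pM => //; first exact: fd_bias.
  exact: clip_coord_le.
apply: (mixing_bound invpi ergQ); first by have [] := bh0.
  move=> z'; apply: (Ex_abs_le nu1) => // v; rewrite /noise_part normrM normr_nat.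
  apply: ler_wpM2l => //; rewrite normrM -[leRHS]mulr1; apply: ler_pM => //.
    exact: noise_clip.
  exact: clip_coord_le.
rewrite /h0 Ex_fubini// -[RHS](Ex_cst nu1 0); congr Ex; apply/funext => v.
exact: noise_part_centred.
Qed.

End mean_field.
End at_a_point.
End estimator.

(** * Deterministic descent of the Lyapunov function *)

Section lyapunov.
Variables (gamma a : R).
Hypotheses (gamma0 : 0 < gamma) (a0 : 0 < a) (a2 : a ^+ 2 = mu * gamma / 3).
Hypothesis ah : a <= 2^-1.
Local Notation rV := 'rV[R]_d.
Local Notation sq v := (dotp v v).

Definition lyapunov (xf x : rV) : R := sq (x - xstar) + 6 / mu * (f xf - f xstar).

Definition query p (xf x : rV) : rV :=
  Defs.theta mu gamma p *: xf + (1 - Defs.theta mu gamma p) *: x.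

Definition next_f p (xf x S : rV) : rV := query p xf x - (p * gamma) *: S.

Definition next_x p (xf x S : rV) : rV :=
  Defs.eta mu gamma *: next_f p xf x S + (p - Defs.eta mu gamma) *: xf
  + ((1 - p) * (1 - Defs.beta mu gamma p)) *: x
  + ((1 - p) * Defs.beta mu gamma p) *: query p xf x.

Let c0 := 6 / mu.
Let ell := gamma / a.
Let c0_gt0 : 0 < c0. Proof. by rewrite divr_gt0. Qed.
Let ell_gt0 : 0 < ell. Proof. by rewrite divr_gt0. Qed.

Definition step_rate : R := c0 + 79 + 2 * (ell ^+ 2 + c0 * (2 * L) * gamma ^+ 2) + 16 * ell.

Lemma step_rate_ge0 : 0 <= step_rate.
Proof.
have h1 := ltW c0_gt0; have h2 := ltW ell_gt0.
have h3 := sqr_ge0 ell; have h4 := sqr_ge0 gamma.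
have h5 : 0 <= c0 * (2 * L) * gamma ^+ 2.
  by apply: mulr_ge0 => //; apply: mulr_ge0 => //; apply: mulr_ge0 => //; exact: ltW.
rewrite /step_rate; lra.
Qed.

Lemma mul_le_bound (k x C y : R) : `|k| <= C -> `|x| <= y -> k * x <= C * y.
Proof.
by move=> h1 h2; apply: (le_trans (ler_norm _)); rewrite normrM; apply: ler_pM.
Qed.

Lemma query_sub p xf x : query p xf x - xstar =
  (x - xstar) - (1 - mix mu gamma p) *: (x - xf).
Proof. by apply/rowP => i; rewrite /query /mix !mxE; ring. Qed.

Section one_step.
Variable p : R.
Hypotheses (p0 : 0 < p) (p1 : p <= 1).
Let u := mix mu gamma p.
Let k1 := drift mu gamma p a.

Lemma next_x_sub xf x S : next_x p xf x S - xstar =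
  (x - xstar) - k1 *: (x - xf) - (p * ell) *: S.
Proof.
apply/rowP => i; rewrite /next_x /next_f /query /k1 /drift.
rewrite (_ : Defs.theta mu gamma p = 1 - mix mu gamma p); last by rewrite /mix; ring.
rewrite (betaE a0 a2 p0) (etaE mu0 gamma0 a0 a2) !mxE /ell.
by field; rewrite lt0r_neq0.
Qed.

Lemma distance_expansion (A w G h : rV) (k l : R) :
  sq (A - k *: w - l *: (G + h)) =
  sq A - 2 * k * dotp A w + k ^+ 2 * sq w - 2 * l * dotp A G - 2 * l * dotp A h
  + 2 * l * k * dotp w (G + h) + l ^+ 2 * sq (G + h).
Proof. rewrite !dotpE (dotpC w A) (dotpC G A) (dotpC h A) (dotpC h w) (dotpC G w); ring. Qed.

(** The inner products of lyapunov_step as independent real numbers, with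
    c = 6 / mu and m = 2 L: p^2 bounds every discrepancy between the coefficients
    and their ideal values. *)
Lemma descent_scalar (c m nA nw nG nh nS Aw AG wG wS Ah Gh ph phg phn : R) :
    0 <= c -> 0 <= m -> 0 <= nA -> 0 <= nw -> 0 <= nG -> 0 <= nh -> 0 <= nS ->
    nS <= 2 * (nG + nh) ->
    `|Aw| <= (nA + nw) / 2 -> `|wG| <= (nw + nG) / 2 -> `|wS| <= (nw + nS) / 2 ->
    phn <= phg - p * gamma * (nG + Gh) + m * (p * gamma) ^+ 2 * nS ->
    phg <= ph + u * wG ->
    a * p * c * phg + 3 * a * p * (nA - 2 * (1 - u) * Aw + (1 - u) ^+ 2 * nw) <=
      a * p * c * (AG - (1 - u) * wG) ->
  nA - 2 * k1 * Aw + k1 ^+ 2 * nw - a * p * c * AG - a * p * c * Ah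
    + a * p * c * k1 * wS + (a * p * c / 2) ^+ 2 * nS + c * phn
  <= (1 - a * p) * (nA + c * ph) - (a * p * c * Ah + p * gamma * c * Gh)
    + p ^+ 2 * (c + 79 + 2 * ((a * c / 2) ^+ 2 + c * m * gamma ^+ 2) + 8 * a * c) * (nA + nw + nG + nh).
Proof.
move=> c_0 m_0 nA0 nw0 nG0 nh0 nS0 hS hAw hwG hwS s1 s2 s3.
have pp := ltW p0; have aa := ltW a0; have gg := ltW gamma0.
have mn : `|u - p * a| <= p ^+ 2 := mix_near mu0 gamma0 a0 a2 ah p0 p1.
have m0 : 0 <= u := mix_ge0 mu0 gamma0 a0 a2 ah p0 p1.
have m2 : u <= 2 * p := mix_le mu0 gamma0 a0 a2 ah p0 p1.
have dn : `|k1 - 2 * p * a| <= 6 * p ^+ 2 := drift_near mu0 gamma0 a0 a2 ah p0 p1.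
have p2 := sqr_ge0 p; have p_le1 := p1.
have p2p : p ^+ 2 <= p by rewrite expr2 ger_pMr.
have pa : p * a <= p * 2^-1 by rewrite ler_pM2l.
have pau : p * a * u <= p ^+ 2.
  have : p * a * u <= p * 2^-1 * (2 * p) by apply: ler_pM => //; exact: mulr_ge0.
  by rewrite (_ : p * 2^-1 * (2 * p) = p ^+ 2)//; field.
have pau0 : 0 <= p * a * u by apply: mulr_ge0 => //; exact: mulr_ge0.
have k1b : `|k1| <= 7 * p.
  rewrite -(subrK (2 * p * a) k1); apply: (le_trans (ler_normD _ _)).
  have : `|2 * p * a| <= p by rewrite ger0_norm ?mulr_ge0//; lra.
  lra.
have k1s : k1 ^+ 2 <= 49 * p ^+ 2.
  rewrite -real_normK ?num_real// (_ : 49 * p ^+ 2 = (7 * p) ^+ 2); last ring.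
  by rewrite lerXn2r// nnegrE// mulr_ge0.
have t1 : c * phn <= c * phg - p * gamma * c * (nG + Gh) + c * m * (p * gamma) ^+ 2 * nS.
  have := ler_wpM2l c_0 s1; lra.
have t2 : c * (1 - a * p) * phg <= c * (1 - a * p) * (ph + u * wG).
  by apply: ler_wpM2l => //; apply: mulr_ge0 => //; lra.
have t1' : 0 <= p * gamma * c * nG by do !apply: mulr_ge0 => //.
have e1 : c * ((u - p * a) * wG) <= c * (p ^+ 2 * ((nw + nG) / 2)).
  by apply: ler_wpM2l => //; exact: mul_le_bound.
have e2 : (3 * (p * a * u) + (k1 - 2 * p * a)) * - Aw <= (9 * p ^+ 2) * ((nA + nw) / 2).
  apply: mul_le_bound; last by rewrite normrN.
  apply: (le_trans (ler_normD _ _)); rewrite [`|3 * _|]ger0_norm; last by apply: mulr_ge0.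
  lra.
have e2' : p * a * Aw <= p * a * ((nA + nw) / 2).
  apply: ler_wpM2l; first exact: mulr_ge0.
  exact: le_trans (ler_norm _) hAw.
have e3 : k1 ^+ 2 * nw <= 49 * p ^+ 2 * nw by apply: ler_wpM2r.
have e3' : p * a * u * nw <= p ^+ 2 * nw by apply: ler_wpM2r.
have e3'' : 0 <= p * a * u ^+ 2 * nw by do !apply: mulr_ge0 => //; exact: sqr_ge0.
have e3a : 0 <= p * a * nw by do !apply: mulr_ge0.
have e3b : 0 <= p * a * nA by do !apply: mulr_ge0.
have ac0 : 0 <= a * p * c by do !apply: mulr_ge0.
have e4 : (a * c / 2) ^+ 2 * p ^+ 2 * nS <= (a * c / 2) ^+ 2 * p ^+ 2 * (2 * (nG + nh)).
  by apply: ler_wpM2l => //; apply: mulr_ge0; exact: sqr_ge0.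
have e4' : c * m * (p * gamma) ^+ 2 * nS <= c * m * (p * gamma) ^+ 2 * (2 * (nG + nh)).
  by apply: ler_wpM2l => //; do !apply: mulr_ge0 => //; exact: sqr_ge0.
have e5 : a * p * c * (k1 * wS) <= a * p * c * (7 * p * ((nw + 2 * (nG + nh)) / 2)).
  apply: ler_wpM2l => //; apply: mul_le_bound => //; apply: (le_trans hwS); lra.
have pn (x : R) : 0 <= x -> 0 <= p ^+ 2 * x by exact: mulr_ge0.
have q1 := pn _ nA0; have q2 := pn _ nw0; have q3 := pn _ nG0; have q4 := pn _ nh0.
have cn (x : R) : 0 <= x -> 0 <= c * (p ^+ 2 * x) by move=> x0; apply: mulr_ge0 => //; exact: pn.
have r1 := cn _ nA0; have r2 := cn _ nw0; have r3 := cn _ nG0; have r4 := cn _ nh0.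
have an (x : R) : 0 <= x -> 0 <= a * (c * (p ^+ 2 * x)) by move=> x0; apply: mulr_ge0 => //; exact: cn.
have v1 := an _ nA0; have v2 := an _ nw0; have v3 := an _ nG0; have v4 := an _ nh0.
have bn (x : R) : 0 <= x -> 0 <= (a * c / 2) ^+ 2 * (p ^+ 2 * x).
  by move=> x0; apply: mulr_ge0; [exact: sqr_ge0|exact: pn].
have b1 := bn _ nA0; have b2 := bn _ nw0.
have gn (x : R) : 0 <= x -> 0 <= c * m * gamma ^+ 2 * (p ^+ 2 * x).
  move=> x0; apply: mulr_ge0; last exact: pn.
  by do !apply: mulr_ge0 => //.
have g1 := gn _ nA0; have g2 := gn _ nw0.
clear - s3 t1 t2 t1' e1 e2 e2' e3 e3' e3'' e3a e3b e4 e4' e5 q1 q2 q3 q4 r1 r2 r3 r4 v1 v2 v3 v4 b1 b2 g1 g2.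
lra.
Qed.

(** The distance part contributes -2 p (gamma / a) dotp A G, which by strong
    convexity dominates a multiple of the gap at the query point. Since
    2 p gamma / a = a p (6 / mu), this takes the share a p off the function part,
    which contracts like the distance part. The other terms are of order p^2. *)
Lemma lyapunov_step xf x S (G := grad f (query p xf x)) (A := x - xstar)
    (w := x - xf) (h := S - G) :
  lyapunov (next_f p xf x S) (next_x p xf x S) <=
  (1 - a * p) * lyapunov xf x - dotp ((a * p * c0) *: A + (p * gamma * c0) *: G) h
  + p ^+ 2 * step_rate * (sq A + sq w + sq G + sq h).
Proof.
have hS : S = G + h by rewrite /h addrC subrK.
rewrite /lyapunov next_x_sub -/A -/w hS distance_expansion -hS -/c0.
(* the identity gamma / a = 3 a / mu that couples the two parts of V *)
have ellE : p * ell = a * p * c0 / 2.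
  have -> : ell = a * c0 / 2.
    rewrite /ell /c0; have -> : gamma = 3 * a ^+ 2 / mu by rewrite a2; field; rewrite lt0r_neq0.
    by field; rewrite !lt0r_neq0.
  ring.
set xg := query p xf x in G h hS *.
have Gx : xg - xstar = A - (1 - u) *: w by exact: query_sub.
(* smoothness for the gradient step, convexity at the query point *)
have s1 : f (next_f p xf x S) - f xstar <= f xg - f xstar - p * gamma * dotp G S
    + 2 * L * (p * gamma) ^+ 2 * sq S.
  have := f_smooth xg (- ((p * gamma) *: S)).
  rewrite /next_f -/xg !dotpE -/G; set b := f _; lra.
have s2 : f xg - f xstar <= f xf - f xstar + u * dotp w G.
  have := f_convex xg (xf - xg); rewrite (addrC xg) subrK -/G.
  have -> : xf - xg = - u *: w.
    by apply/rowP => i; rewrite /xg /query /w /u /mix !mxE; ring.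
  rewrite dotpZr (dotpC w); lra.
clearbody A w h.
have s3 : f xg - f xstar + mu / 2 * (sq A - 2 * (1 - u) * dotp A w + (1 - u) ^+ 2 * sq w) <=
    dotp A G - (1 - u) * dotp w G.
  have := fconv xstar xg; rewrite -(opprB xg) Gx enorm_sqr !dotpE -/G.
  rewrite (dotpC w A) (dotpC G A) (dotpC G w); lra.
have := descent_scalar (c := c0) (m := 2 * L) (nA := sq A) (nw := sq w) (nG := sq G)
  (nh := sq h) (nS := sq S) (Aw := dotp A w) (AG := dotp A G) (wG := dotp w G)
  (wS := dotp w S) (Gh := dotp G h) (ph := f xf - f xstar)
  (phg := f xg - f xstar) (phn := f (next_f p xf x S) - f xstar) (dotp A h).
have d1 := dotp_young A w; have d2 := dotp_young w G; have d3 := dotp_young w S.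
have nS : sq S <= 2 * (sq G + sq h).
  have := dotp_ge0 (G - h); rewrite hS !dotpE (dotpC h G); lra.
have GS : dotp G S = sq G + dotp G h by rewrite [X in dotp G X]hS dotpDr.
rewrite GS in s1.
have s3' : a * p * c0 * (f xg - f xstar) + 3 * a * p * (sq A - 2 * (1 - u) * dotp A w +
    (1 - u) ^+ 2 * sq w) <= a * p * c0 * (dotp A G - (1 - u) * dotp w G).
  have ac : 0 <= a * p * c0 by apply: ltW; rewrite mulr_gt0// mulr_gt0.
  apply: le_trans (ler_wpM2l ac s3); rewrite le_eqVlt; apply/orP; left; apply/eqP.
  by rewrite /c0; field; rewrite lt0r_neq0.
have L20 : 0 <= 2 * L by apply: mulr_ge0 => //; exact: ltW.
move=> /(_ (ltW c0_gt0) L20 (dotp_ge0 _) (dotp_ge0 _) (dotp_ge0 _) (dotp_ge0 _) (dotp_ge0 _)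
  nS d1 d2 d3 s1 s2 s3').
have -> : step_rate = c0 + 79 + 2 * ((a * c0 / 2) ^+ 2 + c0 * (2 * L) * gamma ^+ 2) + 8 * a * c0.
  have el : ell = a * c0 / 2.
    rewrite /ell /c0; have -> : gamma = 3 * a ^+ 2 / mu by rewrite a2; field; rewrite lt0r_neq0.
    by field; rewrite !lt0r_neq0.
  by rewrite /step_rate el; field.
rewrite ellE dotpDl !dotpZl => H; apply: le_trans H; rewrite le_eqVlt; apply/orP; left; apply/eqP.
by field.
Qed.

Lemma lyapunov_dist xf x : sq (x - xstar) <= lyapunov xf x.
Proof.
rewrite /lyapunov lerDl; apply: mulr_ge0; first by rewrite divr_ge0// ltW.
by rewrite subr_ge0.
Qed.

Lemma lyapunov_ge0 xf x : 0 <= lyapunov xf x.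
Proof. exact: le_trans (dotp_ge0 _) (lyapunov_dist xf x). Qed.

Lemma lyapunov_gap xf x : 3 * sq (xf - xstar) <= lyapunov xf x.
Proof.
have := f_gap_ge xf.
have m6 : 0 <= 6 / mu by rewrite divr_ge0// ltW.
move=> /(ler_wpM2l m6); rewrite /lyapunov.
have -> : 6 / mu * (mu / 2 * sq (xf - xstar)) = 3 * sq (xf - xstar).
  by field; rewrite lt0r_neq0.
by have := dotp_ge0 (x - xstar); lra.
Qed.

Lemma sq_sub_le (y z : rV) : sq (y - z) <= 2 * (sq y + sq z).
Proof. have := dotp_ge0 (y + z); rewrite !dotpE (dotpC z y); lra. Qed.

Lemma lyapunov_lag xf x : sq (x - xf) <= 4 * lyapunov xf x.
Proof.
have -> : x - xf = (x - xstar) - (xf - xstar) by rewrite opprB addrA subrK.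
have := sq_sub_le (x - xstar) (xf - xstar); have := lyapunov_dist xf x.
have := lyapunov_gap xf x; have := lyapunov_ge0 xf x; lra.
Qed.

Lemma lyapunov_grad xf x :
  sq (grad f (query p xf x)) <= 160 * L ^+ 2 * lyapunov xf x.
Proof.
set xg := query p xf x; set G := grad f xg.
have h1 : sq G <= 8 * L * (f xg - f xstar).
  exact: (grad_sqr_le xg).
have h2 : f xg - f xstar <= 2 * L * sq (xg - xstar).
  exact: (f_gap_le xg).
have m0 := mix_ge0 mu0 gamma0 a0 a2 ah p0 p1; have m1 := mix_le1 mu0 gamma0 a0 a2 ah p0 p1.
have h3 : sq (xg - xstar) <= 10 * lyapunov xf x.
  rewrite /xg query_sub; apply: (le_trans (sq_sub_le _ _)).
  rewrite dotpZl dotpZr mulrA.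
  have h4 : (1 - mix mu gamma p) * (1 - mix mu gamma p) * sq (x - xf) <= 1 * sq (x - xf).
    apply: ler_wpM2r; first exact: dotp_ge0.
    by rewrite -[leRHS]mulr1; apply: ler_pM; lra.
  have := lyapunov_lag xf x; have := lyapunov_dist xf x; lra.
have L8 : 0 <= 8 * L by rewrite mulr_ge0// ltW.
have L2 : 0 <= 2 * L by rewrite mulr_ge0// ltW.
apply: (le_trans h1); apply: (le_trans (ler_wpM2l L8 h2)).
apply: (le_trans (ler_wpM2l L8 (ler_wpM2l L2 h3))).
by rewrite le_eqVlt; apply/orP; left; apply/eqP; ring.
Qed.

Definition drift_rate : R := step_rate * (5 + 160 * L ^+ 2).
Definition slope_rate : R := 2 * ((c0 * a) ^+ 2 + (gamma * c0) ^+ 2 * (160 * L ^+ 2)).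
Definition slope xf x : rV :=
  - ((a * p * c0) *: (x - xstar) + (p * gamma * c0) *: grad f (query p xf x)).

Lemma drift_rate_ge0 : 0 <= drift_rate.
Proof. by apply: mulr_ge0; [exact: step_rate_ge0|have := sqr_ge0 L; lra]. Qed.

Lemma slope_rate_ge0 : 0 <= slope_rate.
Proof.
apply: mulr_ge0 => //; apply: addr_ge0; first exact: sqr_ge0.
by apply: mulr_ge0; [exact: sqr_ge0|have := sqr_ge0 L; lra].
Qed.

(** The error S - G enters through a linear term, for which only its mean
    matters, and a quadratic one with a factor p^2. *)
Lemma lyapunov_descent xf x S (h := S - grad f (query p xf x)) :
  lyapunov (next_f p xf x S) (next_x p xf x S) <=
  (1 - a * p + drift_rate * p ^+ 2) * lyapunov xf x
  + dotp (slope xf x) h + p ^+ 2 * step_rate * sq h.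
Proof.
have := lyapunov_step xf x S; rewrite /= -/h /slope dotpNl.
have r0 : 0 <= p ^+ 2 * step_rate by apply: mulr_ge0; [exact: sqr_ge0|exact: step_rate_ge0].
have b : sq (x - xstar) + sq (x - xf) + sq (grad f (query p xf x)) <=
   (5 + 160 * L ^+ 2) * lyapunov xf x.
  have := lyapunov_dist xf x; have := lyapunov_lag xf x; have := lyapunov_grad xf x.
  move: (lyapunov xf x) (sq (x - xstar)) (sq (x - xf)) (sq (grad _ _)) => *; lra.
have := ler_wpM2l r0 b; rewrite /drift_rate.
move: (sq h) (lyapunov xf x) (lyapunov _ _) (dotp _ h) (sq (x - xstar)) (sq (x - xf)) (sq (grad _ _)) step_rate.
move=> *; lra.
Qed.

(** The slope is of order p times the root of the potential, so that a bias of
    order p produces a term of order p^2. *)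
Lemma slope_le xf x : sq (slope xf x) <= p ^+ 2 * slope_rate * lyapunov xf x.
Proof.
rewrite /slope dotpNl dotpNr opprK.
set y := _ *: (x - xstar); set G := grad f _; set z := _ *: G.
have -> : y + z = y - (- z) by rewrite opprK.
apply: (le_trans (sq_sub_le _ _)); rewrite dotpNl dotpNr opprK /y /z !dotpZl !dotpZr.
have h1 : (a * p * c0) ^+ 2 * sq (x - xstar) <= (a * p * c0) ^+ 2 * lyapunov xf x.
  by apply: ler_wpM2l; [exact: sqr_ge0|exact: lyapunov_dist].
have h2 : (p * gamma * c0) ^+ 2 * sq G <= (p * gamma * c0) ^+ 2 * (160 * L ^+ 2 * lyapunov xf x).
  by apply: ler_wpM2l; [exact: sqr_ge0|exact: lyapunov_grad].
move: h1 h2; rewrite /slope_rate.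
move: (sq (x - xstar)) (sq G) (lyapunov xf x) => *; lra.
Qed.
End one_step.
End lyapunov.

End objective.

(** * The algorithm as a sequence of samples *)

Section sampled_state.
Context {R : realType} {d : nat} {dZ : measure_display} {Z : measurableType dZ}.
Variables (pi : probability Z R) (F : 'rV[R]_d -> Z -> R) (f : 'rV[R]_d -> R).
Variables (mu gamma t p : R) (xstar : 'rV[R]_d).
Hypothesis Fint : forall x, pi.-integrable setT (EFin \o F x).
Hypothesis Fdiff : forall x z, differentiable (F^~ z) x.
Hypothesis fdiff : forall x, differentiable f x.
Local Notation BV := (borel 'rV[R]_d).
Local Notation ST := ((BV * BV) * BV)%type.

(** The state carries the two iterates and the weighted sum of the estimates
    drawn so far in the current batch. *)
Definition add_sample (w : R) (u : ST * (Z * BV)) : ST :=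
  (u.1.1, u.1.2 + w *: estimate F t (query mu gamma p u.1.1.1 u.1.1.2) u.2.1 (clip u.2.2)).

Definition conclude (y : ST) : ST :=
  ((next_f mu gamma p y.1.1 y.1.2 y.2 : BV, next_x mu gamma p y.1.1 y.1.2 y.2 : BV), 0 : BV).

Definition potential (y : ST) : R := lyapunov f mu xstar y.1.1 y.1.2.

Lemma measurable_query dT (T : measurableType dT) (xf x : T -> BV) :
  measurable_fun setT xf -> measurable_fun setT x ->
  measurable_fun setT (fun w => query mu gamma p (xf w) (x w) : BV).
Proof.
move=> mf mx; apply: measurable_rowD; apply: measurable_rowZ => //; exact: measurable_cst.
Qed.

Lemma measurable_add_sample w : measurable_fun setT (add_sample w).
Proof.
have m1 : measurable_fun setT (fun u : ST * (Z * BV) => u.1.1).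
  exact: (measurableT_comp measurable_fst measurable_fst).
apply: measurable_fun_pair => //; apply: measurable_rowD.
  exact: (measurableT_comp measurable_snd measurable_fst).
apply: measurable_rowZ; first exact: measurable_cst.
apply: (measurable_estimate Fint Fdiff t
  (x := fun u : ST * (Z * BV) => query mu gamma p u.1.1.1 u.1.1.2)
  (z := fun u => u.2.1) (v := fun u => clip u.2.2)).
- apply: measurable_query.
    exact: (measurableT_comp measurable_fst m1).
  exact: (measurableT_comp measurable_snd m1).
- exact: (measurableT_comp measurable_fst measurable_snd).
- apply: (measurableT_comp measurable_clip).
  exact: (measurableT_comp measurable_snd measurable_snd).
Qed.

Lemma measurable_conclude : measurable_fun setT conclude.
Proof.
have m1 : measurable_fun setT (fun y : ST => y.1.1).
  exact: (measurableT_comp measurable_fst measurable_fst).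
have m2 : measurable_fun setT (fun y : ST => y.1.2).
  exact: (measurableT_comp measurable_snd measurable_fst).
have mq := measurable_query m1 m2.
have mc (c : R) (g : ST -> BV) : measurable_fun setT g ->
    measurable_fun setT (fun y => c *: g y : BV).
  by move=> mg; apply: measurable_rowZ => //; exact: measurable_cst.
have mf : measurable_fun setT (fun y : ST =>
    next_f mu gamma p y.1.1 y.1.2 y.2 : BV).
  by apply: measurable_rowB => //; exact: mc.
apply: measurable_fun_pair; last exact: measurable_cst.
apply: measurable_fun_pair => //.
by do 3 (apply: measurable_rowD; last exact: mc); exact: mc.
Qed.

Lemma measurable_potential : measurable_fun setT potential.
Proof.
have m1 : measurable_fun setT (fun y : ST => y.1.1).
  exact: (measurableT_comp measurable_fst measurable_fst).
have m2 : measurable_fun setT (fun y : ST => y.1.2 - xstar : BV).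
  apply: measurable_rowB; last exact: measurable_cst.
  exact: (measurableT_comp measurable_snd measurable_fst).
apply: measurable_funD; first exact: measurable_dotp.
apply: measurable_funM; first exact: measurable_cst.
apply: measurable_funB; last exact: measurable_cst.
exact: (measurableT_comp (f_measurable fdiff) m1).
Qed.

End sampled_state.

(** * The law of the effective level *)

Section levels.
Context {R : realType}.

Lemma level_enabled (M : R) J : 1 <= M ->
  (2 ^+ J <= M) = (J <= Num.truncn (ln M / ln 2))%N.
Proof.
move=> M1; have l2 : 0 < ln 2 :> R by apply: ln_gt0; rewrite ltr1n.
rewrite truncn_ge_nat; last by apply: divr_ge0; [exact: ln_ge0|exact: ltW].
rewrite ler_pdivlMr// mulr_natl -lnXn// ler_ln ?posrE ?exprn_gt0//.
exact: lt_le_trans M1.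
Qed.

(** A disabled correction and J = 0 both reduce the estimator to the base batch,
    which is also what level 0 gives. *)
Definition effective_level (m n : nat) : nat := if (0 < n <= m)%N then n else 0%N.

Lemma effective_level_le m n : (effective_level m n <= m)%N.
Proof. by rewrite /effective_level; case: ifP => // /andP[]. Qed.

Context {d : measure_display} {Om : measurableType d} {P : probability Om R}.
Variable J : {RV P >-> nat}.
Hypothesis geo : geometric_half J.

Let mJ (A : set nat) : measurable (J @^-1` A).
Proof. by rewrite -[X in measurable X]setTI; exact: measurable_funP. Qed.

Lemma effective_level_law m j : (j <= m)%N ->
  P (J @^-1` (effective_level m @^-1` [set j])) = (level_prob m j)%:E.
Proof.
have pos i : (0 < i <= m)%N ->
    P (J @^-1` (effective_level m @^-1` [set i])) = (level_prob m i)%:E.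
  move=> /andP[i0 im]; rewrite /level_prob gtn_eqF// -geo//; congr (P _).
  apply/seteqP; split => w /=; rewrite /effective_level; last by move=> ->; rewrite i0 im.
  by case: ifP => [_ //|_ E]; rewrite -E in i0.
have [->|j0 jm] := posnP j; last by apply: pos; rewrite j0.
move=> _; pose S i := J @^-1` (effective_level m @^-1` [set i]).
have tS : trivIset setT S by move=> i k _ _ [w [/= <- <-]].
have := measure_bigsetU P (fun i => mJ (effective_level m @^-1` [set i])) tS m.+1.
have -> : \big[setU/set0]_(i < m.+1) S i = setT.
  apply/seteqP; split => // w _; rewrite -bigcup_mkord.
  by exists (effective_level m (J w)) => //=; rewrite ltnS effective_level_le.
rewrite big_ord_recl => H; have {H} := etrans (esym (probability_setT P)) H.
rewrite (eq_bigr (fun i : 'I_m => (level_prob m i.+1)%:E)); last first.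
  by move=> i _; apply: (pos i.+1); exact: ltn_ord.
rewrite sumEFin; have := level_prob_sum (R := R) m; rewrite big_ord_recl => <-.
rewrite EFinD => /(congr1 (fun x => x - (\sum_(i < m) level_prob m i.+1)%:E)%E).
by rewrite !addeK// => /esym.
Qed.

Lemma effective_level_mean m l :
  (\int[P]_w ((2 ^ effective_level m (J w) * l)%:R)%:E <= (m.+1 * l)%:R%:E)%E.
Proof.
pose S i := J @^-1` (effective_level m @^-1` [set i]).
have -> : (fun w => ((2 ^ effective_level m (J w) * l)%:R)%:E : \bar R) =
    (fun w => \sum_(j < m.+1) ((2 ^ j * l)%:R%:E * (\1_(S j) w)%:E))%E.
  apply/funext => w; have jm : (effective_level m (J w) < m.+1)%N.
    by rewrite ltnS effective_level_le.
  rewrite (bigD1 (Ordinal jm))//= indicE mem_set// mule1 big1 ?adde0// => j /eqP jw.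
  rewrite indicE memNset ?mule0//= => E; apply: jw; exact/val_inj.
rewrite ge0_integral_sum//; last first.
  by move=> j; apply: emeasurable_funM => //; apply/measurable_EFinP/measurable_indic/mJ.
apply: (@le_trans _ _ (\sum_(j < m.+1) (level_prob m j * 2 ^+ j * l%:R)%:E)%E).
  apply: lee_sum => j _; rewrite ge0_integralZl//; last first.
    by apply/measurable_EFinP/measurable_indic/mJ.
  rewrite integral_indic ?setIT//; last exact: mJ.
  have jm : (j <= m)%N by rewrite -ltnS.
  rewrite [X in (_ * X)%E](effective_level_law jm) -EFinM lee_fin natrM natrX.
  by rewrite mulrC mulrA.
by rewrite sumEFin lee_fin -mulr_suml natrM ler_wpM2r// level_prob_pow.
Qed.

End levels.

(** * Identification with the algorithm *)

Section identification.
Context {R : realType} {d : nat} {dZ : measure_display} {Z : measurableType dZ}.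
Variables (F : 'rV[R]_d -> Z -> R) (mu gamma t p : R) (B : nat).
Local Notation BV := (borel 'rV[R]_d).
Context {dO : measure_display} {Om : measurableType dO} {P : probability Om R}.
Variables (X : nat -> {RV P >-> Z}) (e : nat -> {RV P >-> BV}) (J : nat -> {RV P >-> nat}).

Definition top_level : nat := Num.truncn (ln (Defs.Mlev mu gamma p) / ln 2).

Local Notation l := (Defs.batch mu B gamma p).
Local Notation upd := (add_sample F mu gamma t p).

Lemma trajectory_add_sample ws s (Y : Om -> (BV * BV) * BV) w :
  trajectory X e [seq upd c | c <- ws] s Y w =
  ((Y w).1, (Y w).2 + \sum_(i < size ws)
     ws`_i *: estimate F t (query mu gamma p (Y w).1.1 (Y w).1.2) (X (s + i) w) (clip (e (s + i) w))
     : BV).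
Proof.
elim: ws s Y => [|c ws IH] s Y /=; first by rewrite big_ord0 addr0; case: (Y w).
rewrite IH /= big_ord_recl /= addn0 addrA; congr (_, _ + _).
by apply: eq_bigr => i _; rewrite /bump /= addSnnS.
Qed.

Definition batch_updates (j : nat) := [seq upd c | c <- ml_weights l j].

Lemma size_batch_updates j : size (batch_updates j) = (2 ^ j * l)%N.
Proof. by rewrite size_map size_ml_weights. Qed.

Hypothesis M1 : 1 <= Defs.Mlev mu gamma p.
Local Notation lev := (effective_level top_level).
Local Notation g_ml_at w := (Defs.g_ml F mu B gamma t p (fun m => X m w) (fun m => e m w)).
Local Notation run_at w := (Defs.run F mu B gamma t p (fun m => X m w)
  (fun m => e m w) (fun k => J k w)).

Lemma g_ml_calls_level j : Defs.g_ml_calls mu B gamma p j = (2 ^ lev j * l)%N.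
Proof.
rewrite /Defs.g_ml_calls level_enabled// -/top_level /effective_level.
by case: j => [|j] /=; [rewrite expn0 mul1n|case: ifP => _; rewrite ?expn0 ?mul1n].
Qed.

Lemma g_ml_level w j s x : (forall k, clip (e k w) = e k w) ->
  g_ml_at w j s x = \sum_(i < 2 ^ lev j * l)
    ml_weight l (lev j) i *: estimate F t x (X (s + i) w) (clip (e (s + i) w)).
Proof.
move=> ew; rewrite (sum_ml_weights l (lev j) (fun i => estimate F t x (X (s + i) w) (clip (e (s + i) w)))).
have rd n : Defs.g_rd F t (fun m => X m w) (fun m => e m w) n s x =
    avg n (fun i => estimate F t x (X (s + i) w) (clip (e (s + i) w))).
  by rewrite /Defs.g_rd /avg; congr (_ *: _); apply: eq_bigr => i _; rewrite ew.
rewrite /Defs.g_ml !rd level_enabled// -/top_level /effective_level.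
case: j => [|j] /=; first by [].
case: ifP => _ //=.
by rewrite expn0 mul1n subrr scaler0.
Qed.

Lemma pos_level w x0 N :
  pos batch_updates (fun i => lev (J i w)) N = Defs.st_calls (run_at w x0 N).
Proof.
elim: N => [|N IH]; first by rewrite /pos big_ord0.
rewrite /pos big_ord_recr/= [X in (X + _)%N]IH.
by rewrite size_batch_updates g_ml_calls_level.
Qed.

(** The algorithm is the sample-by-sample run: its estimator is the weighted sum
    with the multilevel weights, and it consumes 2^j * l samples on level j. *)
Lemma random_run_algorithm w x0 N : (forall k, clip (e k w) = e k w) ->
  random_run X e J batch_updates (conclude mu gamma p) ((x0, x0), 0) lev N w =
  ((Defs.st_xf (run_at w x0 N) : BV, Defs.st_x (run_at w x0 N) : BV), 0 : BV).
Proof.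
move=> ew; rewrite /random_run; elim: N => [//|N IH] /=.
rewrite trajectory_add_sample IH /= (pos_level w x0) size_ml_weights add0r.
rewrite (eq_bigr (fun i : 'I_(2 ^ lev (J N w) * l) => ml_weight l (lev (J N w)) i *:
   estimate F t (query mu gamma p (Defs.st_xf (run_at w x0 N)) (Defs.st_x (run_at w x0 N)))
   (X (Defs.st_calls (run_at w x0 N) + i) w) (clip (e (Defs.st_calls (run_at w x0 N) + i) w)))).
  by rewrite -(g_ml_level _ _ _ ew).
by move=> i _; rewrite nth_ml_weights.
Qed.

End identification.

(** * Convergence and cost of the algorithm *)

Section convergence.
Context {R : realType} {d : nat} {dZ : measure_display} {Z : measurableType dZ}.
Variables (Q : R.-pker Z ~> Z) (pi : probability Z R).
Variables (F : 'rV[R]_d -> Z -> R) (f : 'rV[R]_d -> R).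
Variables (L mu sigma : R) (x0 xstar : 'rV[R]_d) (tau : nat).
Hypothesis Fint : forall x, pi.-integrable setT (EFin \o F x).
Hypothesis Fmean : forall x, ('E_pi[F x] = (f x)%:E)%E.
Hypothesis L0 : 0 < L.
Hypothesis Fdiff : forall x z, differentiable (F^~ z) x.
Hypothesis Flip : forall x y z,
  enorm (grad (F^~ z) x - grad (F^~ z) y) <= L * enorm (x - y).
Hypothesis fdiff : forall x, differentiable f x.
Hypothesis mu0 : 0 < mu.
Hypothesis fconv : forall x y,
  mu / 2 * enorm (x - y) ^+ 2 <= f x - f y - dotp (grad f y) (x - y).
Hypothesis noise : forall x z, enorm (grad (F^~ z) x - grad f x) ^+ 2 <= sigma ^+ 2.
Hypothesis xmin : forall x, f xstar <= f x.
Hypothesis tau0 : (0 < tau)%N.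
Hypothesis invpi : invariant_measure Q pi.
Hypothesis ergQ : uniformly_geometrically_ergodic Q tau.
Variables (gamma a : R).
Hypotheses (gamma0 : 0 < gamma) (a0 : 0 < a) (a2 : a ^+ 2 = mu * gamma / 3).
Hypothesis ah : a <= 2^-1.
Local Notation BV := (borel 'rV[R]_d).
Local Notation ST := ((BV * BV) * BV)%type.
Local Notation sq v := (dotp v v).

Definition bias_rate : R := 128 * tau%:R ^+ 2 * d%:R ^+ 2 + 2 * d%:R ^+ 2 * L ^+ 2.
Definition growth_rate : R := drift_rate L mu gamma a + slope_rate L mu gamma a
  + step_rate L mu gamma a * d%:R * 16 * (960 * d.+1%:R ^+ 2 * L ^+ 2).
Definition noise_rate : R := d%:R * bias_rate
  + step_rate L mu gamma a * d%:R * 16 * (6 * d%:R ^+ 2 * (L ^+ 2 + 1) + bias_rate).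

Lemma bias_rate_ge0 : 0 <= bias_rate.
Proof.
by apply: addr_ge0; (apply: mulr_ge0; last exact: sqr_ge0);
  (apply: mulr_ge0; last exact: sqr_ge0); exact: ler0n.
Qed.

Lemma noise_rate_ge0 : 0 <= noise_rate.
Proof.
have h := bias_rate_ge0; have s0 := step_rate_ge0 L0 mu0 gamma0 a0.
have sd : 0 <= step_rate L mu gamma a * d%:R by apply: mulr_ge0 => //; exact: ler0n.
apply: addr_ge0; first by apply: mulr_ge0 => //; exact: ler0n.
apply: mulr_ge0; first by apply: mulr_ge0 => //; exact: ler0n.
apply: addr_ge0 => //; apply: mulr_ge0.
  by apply: mulr_ge0; [exact: ler0n|exact: sqr_ge0].
by apply: addr_ge0; [exact: sqr_ge0|exact: ler01].
Qed.

Lemma growth_rate_ge0 : 0 <= growth_rate.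
Proof.
have s0 := step_rate_ge0 L0 mu0 gamma0 a0.
have sd : 0 <= step_rate L mu gamma a * d%:R by apply: mulr_ge0 => //; exact: ler0n.
apply: addr_ge0.
  by apply: addr_ge0; [exact: drift_rate_ge0|exact: slope_rate_ge0].
apply: mulr_ge0; first by apply: mulr_ge0 => //; exact: ler0n.
by apply: mulr_ge0; [|exact: sqr_ge0]; apply: mulr_ge0; [exact: ler0n|exact: sqr_ge0].
Qed.

Variables (t p : R) (B : nat).
Hypotheses (t0 : 0 < t) (p0 : 0 < p) (p1 : p <= 1) (B0 : (0 < B)%N).
Local Notation upd := (add_sample F mu gamma t p).
Local Notation fin := (conclude mu gamma p).
Local Notation V := (potential f mu xstar).
Context {dO : measure_display} {Om : measurableType dO} {P : probability Om R}.
Variables (X : nat -> {RV P >-> Z}) (e : nat -> {RV P >-> BV}) (J : nat -> {RV P >-> nat}).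
Hypothesis model : sampling_model Q pi X e J.

Let unif i : uniform_on_sphere (distribution P (e i)).
Proof. by have [] := model. Qed.

(** The bias Y / N is at most 2 p Y, and 2 |b| (p Y) <= b^2 + (p Y)^2. *)
Lemma batch_scalar (T N St K Y s al W : R) (b : 'I_d -> R) :
  N^-1 <= 2 * p -> 0 <= St -> 0 <= Y ->
  \sum_i b i ^+ 2 <= W ->
  K ^+ 2 <= s ->
  Y ^+ 2 <= T ->
  al + \sum_i `|b i| * (Y / N) + p ^+ 2 * St * d%:R * 16 * (K ^+ 2 + 2 * K * Y) <=
  al + W + p ^+ 2 * (d%:R * T + St * d%:R * 16 * (2 * s + T)).
Proof.
move=> Np St0 Y0 bW Ks YT.
have h1 : \sum_i `|b i| * (Y / N) <= W + p ^+ 2 * (d%:R * T).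
  have -> : p ^+ 2 * (d%:R * T) = \sum_(i < d) p ^+ 2 * T.
    by rewrite sumr_const card_ord -mulr_natl; ring.
  apply: (@le_trans _ _ (\sum_i (b i ^+ 2 + p ^+ 2 * T))); last by rewrite big_split/= lerD2r.
  apply: ler_sum => i _.
  have h2 : `|b i| * (Y / N) <= `|b i| * (Y * (2 * p)) by do 2 apply: ler_wpM2l => //.
  have h3 : p ^+ 2 * Y ^+ 2 <= p ^+ 2 * T by apply: ler_wpM2l => //; exact: sqr_ge0.
  have := sqr_ge0 (`|b i| - p * Y).
  rewrite sqrrB real_normK ?num_real// exprMn; lra.
have h2 : K ^+ 2 + 2 * K * Y <= 2 * s + T.
  by have := sqr_ge0 (K - Y); rewrite sqrrB; lra.
have c0 : 0 <= p ^+ 2 * St * d%:R * 16 by do 3 (apply: mulr_ge0 => //); exact: sqr_ge0.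
have := ler_wpM2l c0 h2; lra.
Qed.

(** The longest batch has length at least 1 / (2 p), so the mixing bias is O(p)
    and every contribution of the estimator is p^2 times the potential, the
    noise level or the smoothing bias accumulated over the longest batch. *)
Lemma one_iteration_contraction m l s (y : ST) (r : {measure set Z -> \bar R}) :
    (y.2 : 'rV[R]_d) = 0 -> r setT = 1%E -> (m < l)%N -> (2 ^ m * l)%:R^-1 <= 2 * p ->
  (\sum_(j <- iota 0 m.+1) (level_prob m j)%:E *
     iter_exp Q e [seq upd w | w <- ml_weights l j] s (EFin \o V \o fin) y r <=
   ((1 - a * p + growth_rate * p ^+ 2) * V y
    + noise_rate * p ^+ 2 * (sigma ^+ 2 + ((2 ^ m * l)%:R * t) ^+ 2))%:E)%E.
Proof.
move=> y2 r1 ml Np.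
pose xg := query mu gamma p y.1.1 y.1.2; pose G := grad f xg.
pose K := estimator_range f L sigma t xg.
pose N : R := (2 ^ m * l)%:R.
have N1 : 1 <= N.
  by rewrite /N ler1n muln_gt0 expn_gt0/=; exact: leq_ltn_trans ml.
have V0 : 0 <= V y.
  exact: (lyapunov_ge0 mu0 xmin).
have s0 := step_rate_ge0 L0 mu0 gamma0 a0.
pose Inv (y' : ST) := y'.1 = y.1.
pose S (i : 'I_d) (y' : ST) : R := (y'.2 : 'rV[R]_d) ord0 i.
pose g (i : 'I_d) : R := G ord0 i.
pose H (i : 'I_d) := centred F f t xg i.
have Inv_upd w (y' : ST) zv : Inv y' -> Inv (upd w (y', zv)) by [].
have S_upd w (y' : ST) zv i : Inv y' ->
    S i (upd w (y', zv)) = S i y' + w * (g i + H i zv).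
  rewrite /Inv => y'y; rewrite /S /add_sample /= y'y mxE; congr (_ + _).
  rewrite mxE; congr (_ * _); rewrite /g /H /centred addrC subrK; by [].
have K0 : 0 <= K by exact: estimator_range_ge0.
have A0 : 0 <= 4 * (d%:R * `|sigma|) :> R by rewrite !mulr_ge0.
have D0 : 0 <= d%:R * (L * t) by rewrite !mulr_ge0// ltW.
have mH i : measurable_fun setT (H i) by exact: centred_measurable.
have HK i zv : `|H i zv| <= K by exact: (centred_le Fint Fmean L0 Fdiff Flip fdiff mu0 fconv noise t0).
have md i s' k z : `|Ex (kpow Q k z) (mean_field e H i s')| <=
    4 * (d%:R * `|sigma|) * 4^-1 ^+ (k %/ tau) + d%:R * (L * t).
  exact: (mean_field_decay Fint Fmean L0 Fdiff Flip fdiff mu0 fconv noise t0 invpi ergQ xg (unif s')).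
have Phi0 y' : (0 <= (EFin \o V \o fin) y')%E.
  by rewrite /= lee_fin; exact: (lyapunov_ge0 mu0 xmin).
have c0 : 0 <= p ^+ 2 * step_rate L mu gamma a by apply: mulr_ge0 => //; exact: sqr_ge0.
pose b (i : 'I_d) : R := slope f mu xstar gamma a p y.1.1 y.1.2 ord0 i.
pose alpha := (1 - a * p + drift_rate L mu gamma a * p ^+ 2) * V y.
have PhiB y' : Inv y' -> ((EFin \o V \o fin) y' <=
    (alpha + \sum_i (b i * (S i y' - g i) + (p ^+ 2 * step_rate L mu gamma a) * (S i y' - g i) ^+ 2))%:E)%E.
  rewrite /Inv => y'y; rewrite /= lee_fin /potential /conclude /= y'y.
  have := lyapunov_descent Fint Fmean L0 Fdiff Flip mu0 fconv xmin gamma0 a0 a2 ah p0 p1 y.1.1 y.1.2 y'.2.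
  move=> /le_trans; apply; rewrite -/xg -/G -addrA lerD2l big_split/= -mulr_sumr.
  rewrite le_eqVlt; apply/orP; left; apply/eqP; congr (_ + _ * _); apply: eq_bigr => i _.
    by congr (_ * _); rewrite mxE mxE.
  by rewrite expr2; congr (_ * _); rewrite mxE mxE.
have Sy i : S i y = 0 by rewrite /S y2 mxE.
have := batch_bound Inv_upd S_upd tau0 K0 A0 D0 mH HK md Phi0 c0 PhiB s (erefl : Inv y) Sy r1 ml.
move=> /le_trans; apply; rewrite lee_fin -/N; rewrite -/N in Np; clearbody N.
have NN : 0 < N by apply: lt_le_trans N1.
set Y := 2 * tau%:R * (4 * (d%:R * `|sigma|)) + N * (d%:R * (L * t)).
have -> : 2 * tau%:R * (4 * (d%:R * `|sigma|)) / N + d%:R * (L * t) = Y / N.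
  by rewrite /Y; field; rewrite lt0r_neq0.
have X0 : 0 <= Y by apply: addr_ge0; apply: mulr_ge0 => //; exact: ltW.
set sg := sigma ^+ 2 + (N * t) ^+ 2.
have XT : Y ^+ 2 <= bias_rate * sg.
  have h1 := sqr_ge0 (2 * tau%:R * (4 * (d%:R * `|sigma|)) - N * (d%:R * (L * t))).
  have h2 : 0 <= (2 * tau%:R ^+ 2 * d%:R ^+ 2) * (N * t) ^+ 2 :> R.
    by apply: mulr_ge0; [apply: mulr_ge0; [apply: mulr_ge0 => //; exact: sqr_ge0|exact: sqr_ge0]|exact: sqr_ge0].
  have h3 : 0 <= d%:R ^+ 2 * L ^+ 2 * sigma ^+ 2.
    by apply: mulr_ge0; [apply: mulr_ge0|]; exact: sqr_ge0.
  have h4 : `|sigma| ^+ 2 = sigma ^+ 2 by rewrite real_normK ?num_real.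
  rewrite /bias_rate /sg /Y; move: h1; rewrite -h4 in h3 *.
  move: (tau%:R : R) (d%:R : R) `|sigma| h2 h3 => *; lra.
have tN : t ^+ 2 <= (N * t) ^+ 2.
  by rewrite exprMn ler_peMl ?sqr_ge0// exprn_ege1.
have KV : K ^+ 2 <= 480 * d.+1%:R ^+ 2 * L ^+ 2 * V y
    + 3 * d%:R ^+ 2 * (L ^+ 2 + 1) * sg.
  have hG : enorm G ^+ 2 <= 160 * L ^+ 2 * V y.
    rewrite enorm_sqr; exact: (lyapunov_grad Fint Fmean L0 Fdiff Flip mu0 fconv xmin gamma0 a0 a2 ah p0 p1).
  have h4 : `|sigma| ^+ 2 = sigma ^+ 2 by rewrite real_normK ?num_real.
  have cd : 0 <= 3 * d.+1%:R ^+ 2 :> R by apply: mulr_ge0 => //; exact: sqr_ge0.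
  have g1 := ler_wpM2l cd hG.
  have g2 : 3 * d%:R ^+ 2 * (L ^+ 2 * t ^+ 2 + sigma ^+ 2) <= 3 * d%:R ^+ 2 * ((L ^+ 2 + 1) * sg).
    apply: ler_wpM2l; first by apply: mulr_ge0 => //; exact: sqr_ge0.
    have := ler_wpM2l (sqr_ge0 L) tN; have : 0 <= L ^+ 2 * sigma ^+ 2 by apply: mulr_ge0; exact: sqr_ge0.
    have := sqr_ge0 (N * t); rewrite /sg; lra.
  rewrite /K /estimator_range -/G -h4 in g2 *.
  have := sqr_ge0 (d.+1%:R * enorm G - d%:R * (L * t)).
  have := sqr_ge0 (d.+1%:R * enorm G - d%:R * `|sigma|).
  have := sqr_ge0 (d%:R * (L * t) - d%:R * `|sigma|).
  move: g1 g2; move: (sg) (V y) (d%:R : R) (d.+1%:R : R) (enorm G) `|sigma| => *; lra.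
have bW : \sum_i b i ^+ 2 <= p ^+ 2 * slope_rate L mu gamma a * V y.
  have := slope_le Fint Fmean L0 Fdiff Flip mu0 fconv xmin gamma0 a0 a2 ah p0 p1 y.1.1 y.1.2.
  rewrite /dotp; apply: le_trans; rewrite le_eqVlt; apply/orP; left; apply/eqP.
  by apply: eq_bigr => i _; rewrite expr2.
apply: (le_trans (batch_scalar alpha Np s0 X0 bW KV XT)).
rewrite /alpha /growth_rate /noise_rate le_eqVlt; apply/orP; left; apply/eqP.
move: (drift_rate _ _ _ _) (slope_rate _ _ _ _) (step_rate _ _ _ _) bias_rate (V y) => *.
ring.
Qed.

Local Notation m := (top_level mu gamma p).
Local Notation l := (Defs.batch mu B gamma p).
Local Notation lev := (effective_level m).
Local Notation run_at w := (Defs.run F mu B gamma t p (fun m => X m w)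
  (fun m => e m w) (fun k => J k w) x0).

Lemma Mlev_ge : p^-1 <= Defs.Mlev mu gamma p.
Proof.
rewrite /Defs.Mlev mul1r lerDl (betaE a0 a2 p0); apply: divr_ge0 => //.
by do 2 (apply: mulr_ge0 => //; try exact: ltW).
Qed.

Lemma Mlev_ge1 : 1 <= Defs.Mlev mu gamma p.
Proof. by apply: le_trans Mlev_ge; rewrite -[leLHS]invr1 lef_pV2 ?posrE. Qed.

Lemma batchE : l = (m.+1 * B)%N. Proof. by []. Qed.

(** Level m is the last one enabled, hence 2^m exceeds M / 2 and M >= 1 / p. *)
Lemma longest_batch_inv : (2 ^ m * l)%:R^-1 <= 2 * p.
Proof.
have M2 : Defs.Mlev mu gamma p < 2 ^+ m.+1.
  rewrite ltNge level_enabled ?Mlev_ge1// -/(top_level mu gamma p); apply/negP.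
  by rewrite ltnn.
have h : p^-1 <= 2 * (2 ^ m * l)%:R.
  apply: (le_trans Mlev_ge); apply: (le_trans (ltW M2)).
  rewrite exprS -natrX ler_wpM2l// ler_nat leq_pmulr// batchE muln_gt0.
  exact: B0.
have N0 : 0 < (2 ^ m * l)%:R :> R.
  by rewrite ltr0n muln_gt0 expn_gt0/= batchE muln_gt0.
move: ((2 ^ m * l)%:R : R) h N0 => N h N0.
rewrite -div1r ler_pdivrMr//; have := ler_wpM2l (ltW p0) h.
by rewrite mulfV ?lt0r_neq0// mulrCA mulrA.
Qed.

Definition directions_ok : set Om := \bigcap_k [set w | dotp (e k w : 'rV[R]_d) (e k w) = 1].

Lemma directions_okE w : directions_ok w -> forall k, clip (e k w) = e k w.
Proof. by move=> ok k; rewrite /clip ok// eqxx scale1r. Qed.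

Let mdir k : measurable [set w | dotp (e k w : 'rV[R]_d) (e k w) = 1].
Proof.
rewrite -[X in measurable X]setTI.
exact: (measurable_funP (e k) measurableT _ (measurable_sphere)).
Qed.

Lemma directions_ok_measurable : measurable directions_ok.
Proof. exact: bigcapT_measurable. Qed.

Lemma directions_ok_mass : P (~` directions_ok) = 0%E.
Proof.
have nk k : P (~` [set w | dotp (e k w : 'rV[R]_d) (e k w) = 1]) = 0%E.
  rewrite probability_setC//; have := sphere_mass (unif k).
  by rewrite /= /distribution /pushforward => ->; rewrite subee.
have : P.-negligible (~` directions_ok).
  rewrite setC_bigcap; apply: negligible_bigcup => k.
  by apply/negligibleP; [exact: measurableC|exact: nk].
by move/negligibleP; apply; apply: measurableC; exact: directions_ok_measurable.
Qed.

(** One iteration contracts the potential by 1 - a p / 2 up to an error of order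
    p^2; the geometric series turns the latter into an error of order p. *)
Lemma mean_square_bound N : growth_rate * p <= a / 2 ->
  ('E_P[fun w => (enorm (Defs.st_x (run_at w N) - xstar) ^+ 2)%R] <=
   ((1 - a * p / 2) ^+ N * lyapunov f mu xstar x0 x0 +
    2 * noise_rate / a * p * (sigma ^+ 2 + ((2 ^ m * l)%:R * t) ^+ 2))%:E)%E.
Proof.
move=> gp; have [markov _ geo indep] := model.
pose us := batch_updates F mu gamma t p B.
pose y0 : ST := ((x0 : BV, x0 : BV), 0 : BV).
pose rr := random_run X e J us fin y0 lev N.
pose c := noise_rate * p ^+ 2 * (sigma ^+ 2 + ((2 ^ m * l)%:R * t) ^+ 2).
have us_meas j : all_measurable (us j).
  move=> u; rewrite /us /batch_updates; elim: (ml_weights l j) => //= b ws IH [<-|] //.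
  exact: (measurable_add_sample mu gamma t p Fint Fdiff b).
have V0 y : 0 <= V y by exact: (lyapunov_ge0 mu0 xmin).
have mV : measurable_fun setT V by exact: measurable_potential.
have ap : a * p <= 2^-1.
  by rewrite -[leRHS]mulr1; apply: ler_pM => //; exact: ltW.
have r0 : 0 <= 1 - a * p / 2 by have := mulr_gt0 a0 p0; lra.
have c0 : 0 <= c.
  apply: mulr_ge0; last by apply: addr_ge0; exact: sqr_ge0.
  by apply: mulr_ge0; [exact: noise_rate_ge0|exact: sqr_ge0].
have contraction s w y : (y.2 : 'rV[R]_d) = 0 ->
  (\sum_(j <- iota 0 m.+1) (level_prob m j)%:E *
    iter_exp Q e (us j) s (EFin \o V \o fin) y (next_law Q pi X s w) <=
   ((1 - a * p / 2) * V y + c)%:E)%E.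
  move=> y2.
  have r1 : next_law Q pi X s w setT = 1%E.
    by case: s => [|s]; [exact: (probability_setT pi)|exact: prob_kernel].
  have ml : (m < l)%N by rewrite batchE leq_pmulr.
  have := one_iteration_contraction s y2 r1 ml longest_batch_inv.
  move=> /le_trans; apply; rewrite lee_fin lerD2r; apply: ler_wpM2r; first exact: V0.
  have := ler_wpM2l (ltW p0) gp; rewrite expr2; lra.
have qE k j : (j <= m)%N -> P (J k @^-1` (lev @^-1` [set j])) = (level_prob m j)%:E.
  exact: effective_level_law.
have qsum : \sum_(j <- iota 0 m.+1) level_prob m j = 1 :> R.
  have -> : iota 0 m.+1 = index_iota 0 m.+1 by rewrite /index_iota subn0.
  by rewrite big_mkord level_prob_sum.
have Hrun := random_run_bound indep markov us_meas (measurable_conclude mu gamma p) (effective_level_le m)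
  (level_prob_ge0 m) qsum qE (erefl : (fun y : ST => (y.2 : 'rV[R]_d) = 0) y0)
  (fun _ => erefl) V0 mV r0 c0 contraction N.
have mrr : measurable_fun setT rr.
  apply: measurable_random_run => //; first exact: measurable_conclude.
  exact: effective_level_le.
(* the clipped run agrees with the algorithm off a null set; the value +oo on
   that set dominates whatever the algorithm does there *)
pose h : Om -> \bar R := patch (fun=> 0%E) (~` directions_ok) (cst +oo%E).
have mok : measurable (~` directions_ok) by apply: measurableC; exact: directions_ok_measurable.
have h0 w : (0 <= h w)%E by rewrite /h patchE; case: ifP => _ //; exact: leey.
have mh : measurable_fun setT h by apply/(measurable_restrictT _ mok); exact: measurable_cst.
have ih : (\int[P]_w h w = 0)%E.
  rewrite /h -integral_mkcond integral_cst//.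
  by rewrite [X in (_ * X)%E]directions_ok_mass mule0.
have mV' : measurable_fun setT (fun w => (V (rr w))%:E).
  by apply/measurable_EFinP; exact: (measurableT_comp mV mrr).
have : ('E_P[fun w => (enorm (Defs.st_x (run_at w N) - xstar) ^+ 2)%R] <=
    \int[P]_w ((V (rr w))%:E + h w))%E.
  rewrite unlock; apply: ge0_le_integral_nomeas => w.
    by rewrite lee_fin sqr_ge0.
  rewrite /h patchE; case: ifPn => [_|/negP ok]; first by rewrite addey// leey.
  have {}ok : directions_ok w by apply: contrapT => nok; apply: ok; rewrite inE.
  rewrite adde0 lee_fin /rr /us random_run_algorithm ?Mlev_ge1//; last exact: directions_okE.
  by rewrite enorm_sqr /potential /=; exact: (lyapunov_dist mu0 xmin).
rewrite ge0_integralD//; last by move=> w _; rewrite lee_fin.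
rewrite ih adde0 => /le_trans; apply; apply: (le_trans Hrun).
rewrite lee_fin; apply: lerD; first by [].
have gs : \sum_(i < N) (1 - a * p / 2) ^+ i <= 2 / (a * p).
  have ap0 := mulr_gt0 a0 p0.
  have := subrX1 (1 - a * p / 2) N.
  move: (\sum_(i < N) _) => s.
  have -> : 1 - a * p / 2 - 1 = - (a * p / 2) by ring.
  have := exprn_ge0 N r0; move: (_ ^+ N) => q q0 E.
  rewrite ler_pdivlMr//; lra.
apply: (le_trans (ler_wpM2l c0 gs)); rewrite /c le_eqVlt; apply/orP; left; apply/eqP.
move: ((2 ^ m * l)%:R : R) noise_rate => n n'.
by field; rewrite !lt0r_neq0.
Qed.

(** Iteration k costs 2^j * l calls with j its effective level, whose mean is at
    most m.+1 * l. *)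
Lemma mean_calls_bound N :
  ('E_P[fun w => (Defs.st_calls (run_at w N))%:R%R] <= (N * (m.+1 * l))%:R%:E)%E.
Proof.
have [_ _ geo _] := model.
rewrite unlock.
have -> : (fun w => ((Defs.st_calls (run_at w N))%:R)%:E : \bar R) =
    (fun w => \sum_(k < N) ((2 ^ lev (J k w) * l)%:R)%:E)%E.
  apply/funext => w; rewrite -(pos_level F t B X e J Mlev_ge1) /pos natr_sum -sumEFin.
  by apply: eq_bigr => k _; rewrite size_batch_updates.
rewrite ge0_integral_sum//; last first.
  move=> k; apply/measurable_EFinP.
  apply: (measurableT_comp (f := fun n => (2 ^ lev n * l)%:R : R)) => //.
apply: (@le_trans _ _ (\sum_(k < N) (m.+1 * l)%:R%:E)%E).
  by apply: lee_sum => k _; exact: effective_level_mean.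
by rewrite sumEFin sumr_const card_ord lee_fin (natrM _ N) mulr_natl.
Qed.

End convergence.

(** * Asymptotics as the accuracy tends to 0 *)

Section asymptotics.
Context {R : realType}.

Lemma near_ln_inv (A : R) : \forall eps \near 0^'+, A <= ln (1 / eps).
Proof.
near=> eps.
have e0 : 0 < eps by near: eps; exact: nbhs_right_gt.
have eA : eps <= expR (- A) by near: eps; apply: nbhs_right_le; exact: expR_gt0.
rewrite div1r lnV ?posrE// lerNr -[leRHS]expRK.
by rewrite ler_ln ?posrE ?expR_gt0.
Unshelve. all: by end_near. Qed.

Definition iterations (a V p eps : R) : nat :=
  (Num.truncn (2 / (a * p) * ln (1 + 2 * V / eps))).+1.

Section one_accuracy.
Variables (a V p eps : R).
Hypotheses (a0 : 0 < a) (ah : a <= 2^-1) (V0 : 0 <= V) (p0 : 0 < p) (p1 : p <= 1).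
Hypothesis (e0 : 0 < eps).

Let ap0 : 0 < a * p. Proof. exact: mulr_gt0. Qed.

Lemma iterations_contract :
  (1 - a * p / 2) ^+ iterations a V p eps * V <= eps / 2.
Proof.
have apn := ap0.
set y := 1 + 2 * V / eps.
have y1 : 1 <= y by rewrite lerDl; apply: divr_ge0; [exact: mulr_ge0|exact: ltW].
have y0 : 0 < y by apply: lt_le_trans y1.
have ap1 : a * p <= 1.
  by rewrite -[leRHS]mulr1; apply: ler_pM => //; [exact: ltW|exact: ltW|have := ah; lra].
have h1 : 1 - a * p / 2 <= expR (- (a * p / 2)) by apply: expR_ge1Dx.
have h2 : (1 - a * p / 2) ^+ iterations a V p eps <= y^-1.
  apply: (@le_trans _ _ (expR (- (a * p / 2)) ^+ iterations a V p eps)).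
    by rewrite lerXn2r ?nnegrE ?expR_ge0//; lra.
  rewrite -expRM_natl -[leRHS]lnK ?posrE ?invr_gt0// ler_expR lnV ?posrE//.
  have h3 : 0 <= 2 / (a * p) * ln y.
    by apply: mulr_ge0; [apply: divr_ge0 => //; exact: ltW|exact: ln_ge0].
  have /andP[_ h4] := truncn_itv h3.
  have := ler_wpM2l (ltW apn) (ltW h4); rewrite -/(iterations a V p eps).
  have -> : a * p * (2 / (a * p) * ln y) = 2 * ln y by field; rewrite !lt0r_neq0.
  by move: ((iterations a V p eps)%:R : R) (ln y) => n ly ?; lra.
apply: (le_trans (ler_wpM2r V0 h2)).
rewrite mulrC ler_pdivrMr// /y mulrDr mulr1.
have -> : eps / 2 * (2 * V / eps) = V by field; rewrite lt0r_neq0.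
by rewrite lerDr divr_ge0// ltW.
Qed.

Lemma iterations_le : 1 + ln (1 + 2 * V) <= ln (1 / eps) ->
  (iterations a V p eps)%:R <= 5 * ln (1 / eps) / (a * p).
Proof.
have apn := ap0; set la := ln (1 / eps) => hla.
have V1 : 0 < 1 + 2 * V by have := V0; lra.
have lV0 : 0 <= ln (1 + 2 * V) by apply: ln_ge0; have := V0; lra.
have e1 : eps <= 1.
  rewrite -ler_ln ?posrE// ln1; move: hla; rewrite /la div1r lnV ?posrE//; lra.
have ap1 : a * p <= 1.
  by rewrite -[leRHS]mulr1; apply: ler_pM => //; [exact: ltW|exact: ltW|have := ah; lra].
have hy : ln (1 + 2 * V / eps) <= 2 * la.
  apply: (@le_trans _ _ (ln ((1 + 2 * V) / eps))).
    rewrite ler_ln ?posrE; last 2 first.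
    - by apply: ltr_wpDr => //; apply: divr_ge0; [exact: mulr_ge0|exact: ltW].
    - exact: divr_gt0.
    have : 1 <= eps^-1 by rewrite -[leLHS]invr1 lef_pV2 ?posrE.
    by rewrite mulrDl mul1r; lra.
  rewrite lnM ?posrE ?invr_gt0//; rewrite /la div1r in hla *; lra.
have y0 : 0 <= ln (1 + 2 * V / eps).
  by apply: ln_ge0; rewrite lerDl; apply: divr_ge0; [exact: mulr_ge0|exact: ltW].
have h3 : 0 <= 2 / (a * p) * ln (1 + 2 * V / eps).
  by apply: mulr_ge0 => //; apply: divr_ge0 => //; exact: ltW.
have /andP[h4 _] := truncn_itv h3.
rewrite /iterations -natr1.
have h5 : 2 / (a * p) * ln (1 + 2 * V / eps) <= 2 / (a * p) * (2 * la).
  by apply: ler_wpM2l => //; apply: divr_ge0 => //; exact: ltW.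
have h6 : 1 <= la / (a * p).
  by rewrite ler_pdivlMr// mul1r; apply: (le_trans ap1); lra.
have -> : 5 * la / (a * p) = 2 / (a * p) * (2 * la) + la / (a * p) by ring.
lra.
Qed.

End one_accuracy.

Lemma top_level_le (mu gamma p a : R) : 0 < a -> a ^+ 2 = mu * gamma / 3 -> 0 < p -> p <= 1 ->
  (top_level mu gamma p).+1%:R <= ln ((1 + a^-1) / p) / ln 2 + 1.
Proof.
move=> a0 a2 p0 p1; have l2 : 0 < ln 2 :> R by apply: ln_gt0; rewrite ltr1n.
have -> : (1 + a^-1) / p = Defs.Mlev mu gamma p.
  by rewrite /Defs.Mlev (betaE a0 a2 p0); field; rewrite !lt0r_neq0.
have h : 0 <= ln (Defs.Mlev mu gamma p) / ln 2.
  by apply: divr_ge0; [apply: ln_ge0; exact: (Mlev_ge1 a0 a2 p0 p1)|exact: ltW].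
by have /andP[h' _] := truncn_itv h; rewrite -natr1 lerD2r.
Qed.

(** With noise the probability p is proportional to eps: the number of
    iterations is of order ln(1/eps)/eps and the levels are of order
    ln(1/eps). *)
Lemma noisy_asymptotics (mu gamma a V c s : R) (S : R -> R) :
    0 < a -> a <= 2^-1 -> a ^+ 2 = mu * gamma / 3 -> 0 <= V -> 0 < c -> 0 < s ->
    (\forall eps \near 0^'+, s / eps <= S eps) ->
  \forall eps \near 0^'+,
    (iterations a V (c * eps) eps)%:R * (top_level mu gamma (c * eps)).+1%:R ^+ 2
    <= ln (S eps) ^+ 4 * S eps.
Proof.
move=> a0 ah a2 V0 c0 s0 HS.
have l2 : 0 < ln 2 :> R by apply: ln_gt0; rewrite ltr1n.
pose k : R := 2 / ln 2 + 1.
have k0 : 0 <= k by apply: addr_ge0 => //; apply: divr_ge0 => //; exact: ltW.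
pose K := 5 * k ^+ 2 / (a * c).
have K0 : 0 <= K.
  by apply: divr_ge0; [apply: mulr_ge0 => //; exact: sqr_ge0|apply: mulr_ge0; exact: ltW].
near=> eps.
have e0 : 0 < eps by near: eps; exact: nbhs_right_gt.
have ce : c * eps <= 1.
  rewrite -ler_pdivlMl// mulr1; near: eps; by apply: nbhs_right_le; rewrite invr_gt0.
have Se : s / eps <= S eps by near: eps.
have l_V : 1 + ln (1 + 2 * V) <= ln (1 / eps) by near: eps; exact: near_ln_inv.
have l_a : ln ((1 + a^-1) / c) <= ln (1 / eps) by near: eps; exact: near_ln_inv.
have l_s : - 2 * ln s <= ln (1 / eps) by near: eps; exact: near_ln_inv.
have l_K : 16 * K / s <= ln (1 / eps) by near: eps; exact: near_ln_inv.
set la := ln (1 / eps) in l_V l_a l_s l_K.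
have lV0 : 0 <= ln (1 + 2 * V) by apply: ln_ge0; lra.
have l1 : 1 <= la by lra.
have p0 : 0 < c * eps by exact: mulr_gt0.
have h1 := iterations_le a0 ah V0 p0 ce e0 l_V; rewrite -/la in h1.
have h2 : (top_level mu gamma (c * eps)).+1%:R <= k * la.
  apply: (le_trans (top_level_le a0 a2 p0 ce)).
  have -> : (1 + a^-1) / (c * eps) = (1 + a^-1) / c * (1 / eps).
    by field; rewrite !lt0r_neq0.
  rewrite lnM ?posrE ?divr_gt0//; last by apply: addr_gt0 => //; rewrite invr_gt0.
  rewrite -/la; have -> : k * la = 2 * la / ln 2 + la by rewrite /k; ring.
  by apply: lerD => //; rewrite ler_pM2r ?invr_gt0//; lra.
have h3 : (iterations a V (c * eps) eps)%:R * (top_level mu gamma (c * eps)).+1%:R ^+ 2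
    <= 5 * la / (a * (c * eps)) * (k * la) ^+ 2.
  apply: ler_pM => //.
  by rewrite lerXn2r ?nnegrE ?mulr_ge0//; lra.
apply: (le_trans h3).
have h4 : 5 * la / (a * (c * eps)) * (k * la) ^+ 2 <= K / s * la ^+ 3 * S eps.
  have -> : 5 * la / (a * (c * eps)) * (k * la) ^+ 2 = K / s * la ^+ 3 * (s / eps).
    by rewrite /K; field; rewrite !lt0r_neq0.
  apply: ler_wpM2l => //; apply: mulr_ge0; first by apply: divr_ge0 => //; exact: ltW.
  by apply: exprn_ge0; lra.
apply: (le_trans h4).
have S0 : 0 < S eps by apply: lt_le_trans Se; exact: divr_gt0.
rewrite ler_pM2r//.
have h5 : la / 2 <= ln (S eps).
  apply: (@le_trans _ _ (ln (s / eps))); last by rewrite ler_ln ?posrE ?divr_gt0.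
  have -> : s / eps = s * (1 / eps) by rewrite mulrA mulr1.
  by rewrite lnM ?posrE ?divr_gt0// -/la; lra.
have h6 : 8 * (K / s) <= ln (S eps) by lra.
have h7 : (la / 2) ^+ 3 <= ln (S eps) ^+ 3.
  by rewrite lerXn2r ?nnegrE//; lra.
have -> : K / s * la ^+ 3 = 8 * (K / s) * (la / 2) ^+ 3 by field; rewrite lt0r_neq0.
rewrite [leRHS]exprS; apply: ler_pM => //.
- by apply: mulr_ge0 => //; apply: divr_ge0 => //; exact: ltW.
- by apply: exprn_ge0; lra.
Unshelve. all: by end_near. Qed.

(** Without noise p, and with it the levels, stay fixed: the cost is of order
    ln(1/eps) and only the first term of the complexity remains. *)
Lemma noiseless_asymptotics (mu gamma a V p s : R) (S : R -> R) :
    0 < a -> a <= 2^-1 -> 0 <= V -> 0 < p -> p <= 1 -> 0 < s ->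
    (\forall eps \near 0^'+, s * ln (1 / eps) <= S eps) ->
  \forall eps \near 0^'+,
    (iterations a V p eps)%:R * (top_level mu gamma p).+1%:R ^+ 2
    <= ln (S eps) ^+ 4 * S eps.
Proof.
move=> a0 ah V0 p0 p1 s0 HS; set M := (top_level mu gamma p).+1%:R ^+ 2.
have M0 : 0 <= M by exact: sqr_ge0.
pose K := 5 * M / (a * p * s).
have K0 : 0 <= K.
  apply: divr_ge0; first exact: mulr_ge0.
  by apply: mulr_ge0; [apply: mulr_ge0|]; exact: ltW.
near=> eps.
have e0 : 0 < eps by near: eps; exact: nbhs_right_gt.
have Se : s * ln (1 / eps) <= S eps by near: eps.
have l_V : 1 + ln (1 + 2 * V) <= ln (1 / eps) by near: eps; exact: near_ln_inv.
have l_K : expR (1 + K) / s <= ln (1 / eps) by near: eps; exact: near_ln_inv.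
have h1 := iterations_le a0 ah V0 p0 p1 e0 l_V; set la := ln (1 / eps) in Se l_V l_K h1.
apply: (le_trans (ler_wpM2r M0 h1)).
have -> : 5 * la / (a * p) * M = K * (s * la) by rewrite /K; field; rewrite !lt0r_neq0.
have eS : expR (1 + K) <= S eps.
  by apply: le_trans Se; rewrite mulrC -ler_pdivrMr.
have S0 : 0 < S eps by apply: lt_le_trans eS; exact: expR_gt0.
have hS : 1 + K <= ln (S eps).
  by rewrite -[leLHS]expRK ler_ln ?posrE ?expR_gt0.
apply: (le_trans (ler_wpM2l K0 Se)); apply: ler_wpM2r; first exact: ltW.
have h : ln (S eps) ^+ 1 <= ln (S eps) ^+ 4 by apply: ler_weXn2l => //; lra.
by apply: le_trans h; rewrite expr1; lra.
Unshelve. all: by end_near. Qed.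

End asymptotics.

(** * Choice of the parameters *)

Section complexity.
Context {R : realType}.
Variables (d B tau : nat) (L mu sigma : R).
Hypotheses (d0 : (0 < d)%N) (B0 : (0 < B)%N) (L0 : 0 < L) (mu0 : 0 < mu).
Local Notation S := (Defs.complexity d B tau L mu sigma).

Definition deterministic_rate : R := Num.max 1 (d%:R / B%:R) * Num.sqrt (L / mu).
Definition stochastic_rate : R := (d + tau)%:R * sigma ^+ 2 / (B%:R * mu ^+ 2).

Lemma deterministic_rate_gt0 : 0 < deterministic_rate.
Proof.
by apply: mulr_gt0; [rewrite lt_max ltr01|rewrite sqrtr_gt0; exact: divr_gt0].
Qed.

Lemma stochastic_rate_gt0 : sigma != 0 -> 0 < stochastic_rate.
Proof.
move=> s0; apply: divr_gt0; last by rewrite mulr_gt0 ?exprn_gt0// ltr0n.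
apply: mulr_gt0; first by rewrite ltr0n addn_gt0 d0.
by rewrite lt_neqAle eq_sym sqrf_eq0 s0 sqr_ge0.
Qed.

Lemma complexityE eps : 0 < eps ->
  S eps = deterministic_rate * ln (1 / eps) + stochastic_rate / eps.
Proof.
move=> e0; rewrite /Defs.complexity /deterministic_rate /stochastic_rate; congr (_ + _).
have B1 : B%:R != 0 :> R by rewrite pnatr_eq0 -lt0n.
by move: (_%:R : R) (B%:R : R) B1 => n b b0; field; rewrite b0 !lt0r_neq0.
Qed.

Lemma complexity_noisy : \forall eps \near 0^'+, stochastic_rate / eps <= S eps.
Proof.
near=> eps; have e0 : 0 < eps by near: eps; exact: nbhs_right_gt.
have l0 : 0 <= ln (1 / eps) by near: eps; exact: near_ln_inv.
rewrite complexityE// lerDr; apply: mulr_ge0 => //; exact: ltW deterministic_rate_gt0.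
Unshelve. all: by end_near. Qed.

Lemma complexity_noiseless : sigma = 0 ->
  \forall eps \near 0^'+, deterministic_rate * ln (1 / eps) <= S eps.
Proof.
move=> s0; near=> eps; have e0 : 0 < eps by near: eps; exact: nbhs_right_gt.
by rewrite complexityE// /stochastic_rate s0 expr0n mulr0 !mul0r addr0.
Unshelve. all: by end_near. Qed.

End complexity.

Theorem theorem1 (R : realType) :
  exists Pol : {poly R},
  forall (d : nat) (Z : completeMetricType R)
    (Q : R.-pker (borel Z) ~> (borel Z)) (pi : probability (borel Z) R)
    (F : 'rV[R]_d -> Z -> R) (f : 'rV[R]_d -> R)
    (L mu sigma : R) (tau : nat) (x0 xstar : 'rV[R]_d) (B : nat),
  (0 < d)%N -> separable Z ->
  (* f(x) = E_pi[F(x, Z)] *)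
  (forall x, pi.-integrable setT (EFin \o F x)) ->
  (forall x, 'E_pi[F x] = (f x)%:E)%E ->
  (* (i) *)
  0 < L ->
  (forall x z, differentiable (F^~ z) x) ->
  (forall x y z,
     enorm (grad (F^~ z) x - grad (F^~ z) y) <= L * enorm (x - y)) ->
  (* (ii) *)
  (forall x, differentiable f x) -> continuous (grad f) ->
  0 < mu ->
  (forall x y, mu / 2 * enorm (x - y) ^+ 2
               <= f x - f y - dotp (grad f y) (x - y)) ->
  (* (iii) *)
  invariant_measure Q pi ->
  (forall pi' : probability (borel Z) R, invariant_measure Q pi' ->
     forall A : set (borel Z), measurable A -> pi' A = pi A) ->
  (0 < tau)%N -> uniformly_geometrically_ergodic Q tau ->
  (* (iv) *)
  (forall x i, 'E_pi[fun z => grad (F^~ z) x ord0 i]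
               = (grad f x ord0 i)%:E)%E ->
  (forall x z, enorm (grad (F^~ z) x - grad f x) ^+ 2 <= sigma ^+ 2) ->
  (forall x, f xstar <= f x) ->
  (0 < B)%N ->
  exists (gamma t p : R -> R) (N : R -> nat),
    (forall eps, 0 < eps ->
       [/\ 0 < gamma eps <= 3 / (4 * L), 0 < t eps & 0 < p eps <= 1]) /\
    forall (disp : measure_display) (Om : measurableType disp)
      (P : probability Om R) (X : nat -> {RV P >-> borel Z})
      (e : nat -> {RV P >-> borel 'rV[R]_d}) (J : nat -> {RV P >-> nat}),
    sampling_model Q pi X e J ->
    let out eps w :=
      run F mu B (gamma eps) (t eps) (p eps)
        (fun m => X m w) (fun m => e m w) (fun k => J k w) x0 (N eps) in
    (forall eps, 0 < eps ->
       ('E_P[fun w => (enorm (st_x (out eps w) - xstar) ^+ 2)%R] <= eps%:E)%E) /\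
    (\forall eps \near 0^'+,
       ('E_P[fun w => (st_calls (out eps w))%:R%R] <=
        (B%:R * (Pol.[ln (complexity d B tau L mu sigma eps)]
                 * complexity d B tau L mu sigma eps))%R%:E)%E).
Proof.
exists 'X^4 => d Z Q pi F f L mu sigma tau x0 xstar B d0 _ Fint Fmean L0 Fdiff Flip fdiff _ mu0
  fconv invpi _ tau0 ergQ _ noise xmin B0.
(* the bound 3 / (4 mu) makes a at most 1 / 2 *)
pose g : R := Num.min (3 / (4 * L)) (3 / (4 * mu)).
have g0 : 0 < g by rewrite lt_min !divr_gt0// mulr_gt0.
have gL : g <= 3 / (4 * L) by rewrite ge_min lexx.
pose a := Num.sqrt (mu * g / 3).
have mg0 : 0 < mu * g / 3 by rewrite divr_gt0// mulr_gt0.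
have a0 : 0 < a by rewrite sqrtr_gt0.
have a2 : a ^+ 2 = mu * g / 3 by rewrite sqr_sqrtr// ltW.
have ah : a <= 2^-1.
  have gm : g <= 3 / (4 * mu) by rewrite ge_min lexx orbT.
  rewrite -ler_sqr ?nnegrE ?invr_ge0// ?(ltW a0)// a2.
  have := ler_wpM2l (ltW mu0) gm.
  have -> : mu * (3 / (4 * mu)) = 3 / 4 by field; rewrite lt0r_neq0.
  rewrite (_ : 2^-1 ^+ 2 = 4^-1 :> R); [lra|by field].
pose V := lyapunov f mu xstar x0 x0.
have V0 : 0 <= V by exact: (lyapunov_ge0 mu0 xmin).
pose Gr := growth_rate (d := d) L mu g a.
have Gr0 : 0 <= Gr by exact: growth_rate_ge0.
pose K := 2 * noise_rate (d := d) L mu tau g a / a.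
have K0 : 0 <= K.
  by apply: divr_ge0; [apply: mulr_ge0 => //; exact: noise_rate_ge0|exact: ltW].
(* below pm the growth p^2 of the potential is at most half of the gain a p *)
pose pm : R := Num.min 1 (a / (2 * (Gr + 1))).
have pm0 : 0 < pm.
  by rewrite lt_min ltr01/= divr_gt0// mulr_gt0//; apply: ltr_wpDl.
have pm1 : pm <= 1 by rewrite ge_min lexx.
have Grp p : 0 <= p -> p <= pm -> Gr * p <= a / 2.
  move=> p0 ppm; have : p <= a / (2 * (Gr + 1)) by apply: le_trans ppm _; rewrite ge_min lexx orbT.
  rewrite ler_pdivlMr; [lra|by rewrite mulr_gt0//; apply: ltr_wpDl].
(* the share of the noise in the error is at most eps / 4 for p <= c * eps *)
pose c : R := (4 * (K + 1) * (sigma ^+ 2 + 1))^-1.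
have c0 : 0 < c.
  by rewrite invr_gt0 mulr_gt0 ?mulr_gt0//; apply: ltr_wpDl => //; exact: sqr_ge0.
pose p eps : R := if sigma == 0 then pm else Num.min pm (c * eps).
have p_pm eps : p eps <= pm by rewrite /p; case: ifP => // _; rewrite ge_min lexx.
have p0 eps : 0 < eps -> 0 < p eps.
  by move=> e0; rewrite /p; case: ifP => // _; rewrite lt_min pm0 mulr_gt0.
have p1 eps : p eps <= 1 by exact: le_trans (p_pm eps) pm1.
pose len eps : R := (2 ^ top_level mu g (p eps) * Defs.batch mu B g (p eps))%:R.
have len0 eps : 0 < len eps by rewrite ltr0n muln_gt0 expn_gt0/= muln_gt0 B0.
(* t is so small that the smoothing bias summed over the longest batch is
   negligible *)
pose t eps : R := Num.sqrt (eps / (4 * (K + 1))) / len eps.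
have t0 eps : 0 < eps -> 0 < t eps.
  move=> e0; apply: divr_gt0 => //; rewrite sqrtr_gt0 divr_gt0// mulr_gt0//; exact: ltr_wpDl.
pose N eps := iterations a V (p eps) eps.
exists (fun=> g), t, p, N; split.
  by move=> eps e0; split; rewrite ?g0 ?t0 ?p0 ?gL ?p1.
move=> disp Om P X e J model out; split.
  move=> eps e0.
  have gp : Gr * p eps <= a / 2 by apply: Grp => //; exact: ltW (p0 _ e0).
  have := mean_square_bound x0 Fint Fmean L0 Fdiff Flip fdiff mu0 fconv noise xmin tau0 invpi ergQ
    g0 a0 a2 ah (t0 _ e0) (p0 _ e0) (p1 eps) B0 model (N eps) gp.
  move=> /le_trans; apply; rewrite lee_fin -/V -/K -/(len eps).
  have h1 := iterations_contract a0 ah V0 (p0 _ e0) (p1 eps) e0.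
  have h2 : (len eps * t eps) ^+ 2 = eps / (4 * (K + 1)).
    rewrite /t mulrCA mulfV ?lt0r_neq0// mulr1 sqr_sqrtr//.
    by apply: divr_ge0; [exact: ltW|apply: mulr_ge0 => //; exact: addr_ge0].
  have KK : 0 < 4 * (K + 1) by apply: mulr_gt0 => //; exact: ltr_wpDl.
  have h3 : K * p eps * (eps / (4 * (K + 1))) <= eps / 4.
    have -> : eps / 4 = (K + 1) * 1 * (eps / (4 * (K + 1))).
      by field; rewrite lt0r_neq0//; exact: ltr_wpDl.
    apply: ler_wpM2r; first by apply: divr_ge0; exact: ltW.
    by apply: ler_pM => //; [exact: ltW (p0 _ e0)|rewrite lerDl].
  have h4 : K * p eps * sigma ^+ 2 <= eps / 4.
    have [s0|s0] := eqVneq sigma 0.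
      by rewrite s0 expr0n mulr0; apply: divr_ge0 => //; exact: ltW.
    have pc : p eps <= c * eps by rewrite /p (negPf s0) ge_min lexx orbT.
    have s2 := sqr_ge0 sigma.
    have ce : c * eps * ((K + 1) * (sigma ^+ 2 + 1)) = eps / 4.
      by rewrite /c; field; rewrite !lt0r_neq0// ltr_wpDl.
    rewrite -ce mulrAC mulrC; apply: ler_pM => //; first exact: ltW (p0 _ e0).
      exact: mulr_ge0.
    by apply: ler_pM => //; rewrite lerDl.
  rewrite h2 [leRHS](_ : _ = eps / 2 + (eps / 4 + eps / 4)); last by field.
  by apply: lerD; [exact: h1|rewrite mulrDr; exact: lerD h4 h3].
have calls : \forall eps \near 0^'+,
    (N eps)%:R * (top_level mu g (p eps)).+1%:R ^+ 2 <=
    ln (complexity d B tau L mu sigma eps) ^+ 4 * complexity d B tau L mu sigma eps.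
  have [s0|s0] := eqVneq sigma 0.
    have /= := noiseless_asymptotics mu g a0 ah V0 pm0 pm1 (deterministic_rate_gt0 d B L0 mu0)
      (complexity_noiseless d tau L B0 mu0 s0).
    by apply: filterS => eps; rewrite /N /p s0 eqxx.
  have HN := noisy_asymptotics a0 ah a2 V0 c0 (stochastic_rate_gt0 tau d0 B0 mu0 s0)
    (complexity_noisy d tau sigma B0 L0 mu0).
  near=> eps.
  have ce : c * eps <= pm.
    by rewrite -ler_pdivlMl//; near: eps; apply: nbhs_right_le; rewrite mulr_gt0// invr_gt0.
  have pE : p eps = c * eps by rewrite /p (negPf s0) (min_idPr ce).
  by rewrite /N pE; near: eps.
near=> eps.
have e0 : 0 < eps by near: eps; exact: nbhs_right_gt.
have := @mean_calls_bound _ _ _ _ Q pi F mu x0 g a a0 a2 (t eps) _ B (p0 _ e0) (p1 eps) _ _ _ _ _ _ model (N eps).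
move=> /le_trans; apply.
rewrite lee_fin hornerXn batchE.
set m := top_level _ _ _.
have -> : (N eps * (m.+1 * (m.+1 * B)))%:R = B%:R * ((N eps)%:R * m.+1%:R ^+ 2) :> R.
  by rewrite !natrM expr2; ring.
by apply: ler_wpM2l => //; rewrite /m; near: eps.
Unshelve. all: by end_near. Qed.
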